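(* Let $0\le\delta<\rho\le1$ and $m_1,m_2\in\mathbb{R}$. Let $a\in S^{m_1}_{\rho,\delta}(G\times\mathbb{R}^n)$ and $b\in S^{m_2}_{\rho,\delta}(G\times\mathbb{R}^n)$. Then there exists a symbol $c\in S^{m_1+m_2}_{\rho,\delta}(G\times\mathbb{R}^n)$ such that $c(x,\mathfrak{D})=a(x,\mathfrak{D})\circ b(x,\mathfrak{D})$. Moreover $c(x,\xi)\sim\sum_{\alpha}\frac{(2\pi i)^{-|\alpha|}}{\alpha!}(\partial_\xi^\alpha a(x,\xi))(\mathfrak{D}_x^\alpha b(x,\xi))$, in the sense that for every $N\in\mathbb{N}$, $$c(x,\xi)-\sum_{|\alpha|<N}\frac{(2\pi i)^{-|\alpha|}}{\alpha!}\,(\partial_\xi^\alpha a(x,\xi))\,(\mathfrak{D}_x^\alpha b(x,\xi))\in S^{m_1+m_2-(\rho-\delta)N}_{\rho,\delta}(G\times\mathbb{R}^n).$$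
   Context: Let $n\ge1$ and $G=(-1,1)^n$. The map $t:G\to\mathbb{R}^n$, $t(x)=\left(\tfrac12\ln\tfrac{1-x_1}{1+x_1},\dots,\tfrac12\ln\tfrac{1-x_n}{1+x_n}\right)$, is a diffeomorphism with inverse $x(t)=(-\tanh t_1,\dots,-\tanh t_n)$. The Schwartz space on $G$ is $\mathcal{S}(G)=\{f\circ t: f\in\mathcal{S}(\mathbb{R}^n)\}$; the Haar measure is $d\mu_G(x)=\frac{dx}{(1-x_1^2)\cdots(1-x_n^2)}$. Canonical derivatives: $\mathfrak{D}_{x_j}=-(1-x_j^2)\frac{\partial}{\partial x_j}$, $\mathfrak{D}_x^\beta=\mathfrak{D}_{x_1}^{\beta_1}\cdots\mathfrak{D}_{x_n}^{\beta_n}$. Symbols: for $m\in\mathbb{R}$, $S^m_{\rho,\delta}(G\times\mathbb{R}^n)$ is the set of $\sigma\in C^\infty(G\times\mathbb{R}^n)$ such that for all $\alpha,\beta\in\mathbb{N}_0^n$ there is $C_{\alpha,\beta}>0$ with $|\partial_\xi^\alpha\mathfrak{D}_x^\beta\sigma(x,\xi)|\le C_{\alpha,\beta}(1+|\xi|)^{m-\rho|\alpha|+\delta|\beta|}$ for all $(x,\xi)\in G\times\mathbb{R}^n$. Quantisation: for $f\in\mathcal{S}(G)$, $\mathscr{F}_Gf(\xi)=\int_G\left(\frac{1-x}{1+x}\right)^{-i\pi\xi}f(x)\,d\mu_G(x)$, where $\left(\frac{1-x}{1+x}\right)^{i\pi\xi}:=\prod_{j}\left(\frac{1-x_j}{1+x_j}\right)^{i\pi\xi_j}=e^{2\pi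 it(x)\cdot\xi}$, and $\sigma(x,\mathfrak{D})f(x)=\int_{\mathbb{R}^n}\left(\frac{1-x}{1+x}\right)^{i\pi\xi}\sigma(x,\xi)\,\mathscr{F}_Gf(\xi)\,d\xi$. The operators act on $\mathcal{S}(G)$. *)

(* Defs.v *)
From HB Require Import structures.
From mathcomp Require Import all_boot all_order all_algebra.
From mathcomp Require Import complex.
From mathcomp Require Import all_classical all_reals all_analysis.

Set Implicit Arguments.
Unset Strict Implicit.
Unset Printing Implicit Defensive.
Import Order.TTheory GRing.Theory Num.Theory.
Import numFieldNormedType.Exports.
Import Normc.

Local Open Scope classical_set_scope.
Local Open Scope ring_scope.
Local Open Scope complex_scope.

Section lebesgue_cons.
Context {R : realType} {n : nat}.
Local Open Scope ereal_scope.
Variable mu : {sigma_finite_measure set (n.-tuple (measurableTypeR R)) -> \bar R}.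

Definition tuple_cons (p : measurableTypeR R * n.-tuple (measurableTypeR R)) :
    n.+1.-tuple (measurableTypeR R) :=
  [the n.+1.-tuple _ of p.1 :: p.2].

Lemma measurable_tuple_cons : measurable_fun setT tuple_cons.
Proof. exact: measurable_cons. Qed.

Definition lebesgue_cons :=
  pushforward (@lebesgue_measure R \x mu) tuple_cons.

Let lebesgue_cons0 : lebesgue_cons set0 = 0.
Proof. by rewrite /lebesgue_cons /pushforward preimage_set0 measure0. Qed.

Let lebesgue_cons_ge0 A : 0 <= lebesgue_cons A.
Proof.
rewrite /lebesgue_cons /pushforward.
exact: (measure_ge0 (@lebesgue_measure R \x mu)%E).
Qed.

Let measurable_preimage_cons (A : set (n.+1.-tuple (measurableTypeR R))) :
  measurable A -> measurable (tuple_cons @^-1` A).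
Proof.
by move=> mA; rewrite -[X in measurable X]setTI; exact: measurable_tuple_cons.
Qed.

Let lebesgue_cons_sigma_additive : semi_sigma_additive lebesgue_cons.
Proof.
move=> F mF tF mUF; rewrite /lebesgue_cons /pushforward preimage_bigcup.
apply: measure_semi_sigma_additive.
- by move=> k; exact: measurable_preimage_cons.
- apply/trivIsetP => /= i j _ _ ij; rewrite -preimage_setI.
  by move/trivIsetP : tF => /(_ _ _ _ _ ij) ->//; rewrite preimage_set0.
- by rewrite -preimage_bigcup; exact: measurable_preimage_cons.
Qed.

HB.instance Definition _ := isMeasure.Build _ _ _ lebesgue_cons
  lebesgue_cons0 lebesgue_cons_ge0 lebesgue_cons_sigma_additive.

Definition tuple_uncons (t : n.+1.-tuple (measurableTypeR R)) :
    measurableTypeR R * n.-tuple (measurableTypeR R) :=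
  (thead t, [tuple of behead t]).

Lemma measurable_tuple_uncons : measurable_fun setT tuple_uncons.
Proof.
apply/measurable_fun_pairP; split.
  exact: measurable_tnth.
exact: measurable_behead.
Qed.

Lemma tuple_consK : cancel tuple_cons tuple_uncons.
Proof.
move=> [x t]; rewrite /tuple_uncons /tuple_cons theadE; congr pair.
exact: val_inj.
Qed.

Let lebesgue_cons_sigma_finite : sigma_finite setT lebesgue_cons.
Proof.
have /sigma_finiteP[F [TF ndF Foo]] := sigma_finiteT (@lebesgue_measure R).
have /sigma_finiteP[G [TG ndG Goo]] := sigma_finiteT mu.
exists (fun k => tuple_uncons @^-1` (F k `*` G k)).
  rewrite -preimage_bigcup (_ : \bigcup_k _ = setT) ?preimage_setT//.
  rewrite -setXTT TF TG; apply/seteqP; split=> [p [k _ [Fp Gp]]|].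
    by split; exists k.
  move=> [x t] [/= [k _ Fx] [l _ Gt]]; exists (maxn k l) => //; split => /=.
  - by move: x Fx; exact/subsetPset/ndF/leq_maxl.
  - by move: t Gt; exact/subsetPset/ndG/leq_maxr.
move=> k; have [mF Fk] := Foo k; have [mG Gk] := Goo k; split.
  rewrite -[X in measurable X]setTI; apply: measurable_tuple_uncons => //.
  exact: measurableX.
rewrite /lebesgue_cons /pushforward -comp_preimage.
rewrite (_ : _ \o _ = id) ?preimage_id; last first.
  by apply/funext => p; exact: tuple_consK.
by rewrite product_measure1E// lte_mul_pinfty// ge0_fin_numE.
Qed.

HB.instance Definition _ := Measure_isSigmaFinite.Build _ _ _ lebesgue_cons
  lebesgue_cons_sigma_finite.
End lebesgue_cons.

(* Lebesgue measure on R^n, as the n-fold product of Lebesgue measure on R. *)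
Fixpoint lebesgue_tuple (R : realType) (n : nat) :
    {sigma_finite_measure set (n.-tuple (measurableTypeR R)) -> \bar R} :=
  match n with
  | 0 => \d_([tuple] : 0.-tuple (measurableTypeR R))
  | n'.+1 => lebesgue_cons (lebesgue_tuple R n')
  end.

Lemma lebesgue_tuple_box (R : realType) (n : nat)
    (A : 'I_n -> set (measurableTypeR R)) : (forall i, measurable (A i)) ->
  lebesgue_tuple R n [set t | forall i, A i (tnth t i)] =
  (\prod_(i < n) @lebesgue_measure R (A i))%E.
Proof.
elim: n A => [|n IHn] A mA /=.
  by rewrite big_ord0 /= diracE mem_set//= => -[].
rewrite big_ord_recl /lebesgue_cons /pushforward.
have -> : tuple_cons @^-1` [set t | forall i, A i (tnth t i)] =
    A ord0 `*` [set t : n.-tuple (measurableTypeR R) |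
                forall i, A (lift ord0 i) (tnth t i)].
  apply/seteqP; split=> -[x t] /=.
    move=> At; split; first exact: (At ord0).
    by move=> i; have := At (lift ord0 i); rewrite tnthS.
  move=> [Ax At] i; case: (unliftP ord0 i) => [j ->|->//].
  by rewrite tnthS; exact: At.
have mB : measurable [set t : n.-tuple (measurableTypeR R) |
    forall i, A (lift ord0 i) (tnth t i)].
  rewrite (_ : [set t | _] = \bigcap_(i in [set: 'I_n])
      ((fun t => tnth t i) @^-1` A (lift ord0 i))).
    apply: fin_bigcap_measurable => // i _.
    by rewrite -[X in measurable X]setTI; exact: measurable_tnth.
  by apply/seteqP; split=> t /= At i *; exact: At.
rewrite product_measure1E//; congr (_ * _)%E.
by apply: (IHn (fun i => A (lift ord0 i))) => i; exact: mA.
Qed.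

Section calculus.
Context {R : realType}.
Local Notation Re := (@complex.Re R).
Local Notation Im := (@complex.Im R).

Definition rv_of_tuple (n : nat) (t : n.-tuple (measurableTypeR R)) :
  'rV[R]_n := \row_j tnth t j.

(* R[i] carries no normed module structure over R, so complex-valued functions
   are integrated and differentiated through real and imaginary parts. *)
Definition integral_Rn (n : nat) (D : set 'rV[R]_n) (f : 'rV[R]_n -> R[i]) :
    R[i] :=
  (\int[lebesgue_tuple R n]_(t in @rv_of_tuple n @^-1` D)
      Re (f (rv_of_tuple t)))
  +i* (\int[lebesgue_tuple R n]_(t in @rv_of_tuple n @^-1` D)
      Im (f (rv_of_tuple t))).

Definition cderive (V : normedModType R) (v : V) (f : V -> R[i]) : V -> R[i] :=
  fun x => 'D_v (fun y => Re (f y)) x +i* 'D_v (fun y => Im (f y)) x.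

(* [e] lists the coordinate directions: [f] is smooth on the open set [D] when
   its iterated partial derivatives, in any order, exist and are continuous. *)
Definition smooth (V : normedModType R) (I : Type) (e : I -> V) (D : set V)
    (f : V -> R[i]) : Prop :=
  forall (s : seq I) (x : V), D x ->
  let g := foldr (fun i => cderive (e i)) f s in
  [/\ {for x, continuous (fun y => Re (g y))},
      {for x, continuous (fun y => Im (g y))} &
      forall i, derivable (fun y => Re (g y)) x (e i) /\
                derivable (fun y => Im (g y)) x (e i)].

Definition mindex (n : nat) := 'I_n -> nat.

Definition mdegree (n : nat) (alpha : mindex n) : nat :=
  (\sum_(j < n) alpha j)%N.

Definition mfact (n : nat) (alpha : mindex n) : nat :=
  (\prod_(j < n) (alpha j)`!)%N.

(* [mpower D alpha] is D_1^alpha_1 o ... o D_n^alpha_n. *)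
Definition mpower (n : nat) (T : Type) (D : 'I_n -> T -> T) (alpha : mindex n)
    (f : T) : T :=
  foldr (fun j g => iter (alpha j) (D j) g) f (enum 'I_n).

Section space.
Context {n : nat}.
Implicit Types (x xi : 'rV[R]_n) (alpha beta : mindex n).

Definition basis (j : 'I_n) : 'rV[R]_n := delta_mx 0 j.

(* The library norm on 'rV[R]_n is the sup norm; |xi| is Euclidean. *)
Definition enorm xi : R := Num.sqrt (\sum_(j < n) xi 0 j ^+ 2).

Definition schwartz (f : 'rV[R]_n -> R[i]) : Prop :=
  smooth basis setT f /\
  forall alpha beta, exists C : R, forall x,
    `|\prod_(j < n) x 0 j ^+ alpha j|
      * normc (mpower (fun j => cderive (basis j)) beta f x) <= C.

(* A function on G (resp. on G x R^n) is encoded by a total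
   function of which only the values on G (resp. on G x R^n) matter. *)

Definition G : set 'rV[R]_n := [set x | forall j, -1 < x 0 j < 1].

Definition tmap x : 'rV[R]_n :=
  \row_j (2^-1 * ln ((1 - x 0 j) / (1 + x 0 j))).

Definition schwartz_G (f : 'rV[R]_n -> R[i]) : Prop :=
  exists2 g : 'rV[R]_n -> R[i], schwartz g &
    forall x, G x -> f x = g (tmap x).

Definition integral_G (f : 'rV[R]_n -> R[i]) : R[i] :=
  integral_Rn G (fun x => f x / (\prod_(j < n) (1 - x 0 j ^+ 2))%:C).

Definition GxRn : set ('rV[R]_n * 'rV[R]_n) := [set p | G p.1].

Definition phase_basis (k : 'I_n + 'I_n) : 'rV[R]_n * 'rV[R]_n :=
  match k with inl j => (basis j, 0) | inr j => (0, basis j) end.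

Definition pderiv_xi (j : 'I_n) (sigma : 'rV[R]_n * 'rV[R]_n -> R[i]) :=
  cderive (phase_basis (inr j)) sigma.

Definition canonical_deriv (j : 'I_n) (sigma : 'rV[R]_n * 'rV[R]_n -> R[i]) :
    'rV[R]_n * 'rV[R]_n -> R[i] :=
  fun p => (- (1 - p.1 0 j ^+ 2))%:C * cderive (phase_basis (inl j)) sigma p.

Definition symbol_class (m rho delta : R)
    (sigma : 'rV[R]_n * 'rV[R]_n -> R[i]) : Prop :=
  smooth phase_basis GxRn sigma /\
  forall alpha beta, exists2 C : R, 0 < C & forall x xi, G x ->
    normc (mpower pderiv_xi alpha (mpower canonical_deriv beta sigma) (x, xi))
    <= C * (1 + enorm xi)
         `^ (m - rho * (mdegree alpha)%:R + delta * (mdegree beta)%:R).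

(* [cpow_im r s] is r^(i s) = exp (i s ln r), for r > 0. *)
Definition cpow_im (r s : R) : R[i] := cos (s * ln r) +i* sin (s * ln r).

(* ((1 - x) / (1 + x))^(i pi xi) = exp (2 i pi t(x).xi) on G *)
Definition character x xi : R[i] :=
  \prod_(j < n) cpow_im ((1 - x 0 j) / (1 + x 0 j)) (pi * xi 0 j).

Definition fourier_G (f : 'rV[R]_n -> R[i]) : 'rV[R]_n -> R[i] :=
  fun xi => integral_G (fun x => character x (- xi) * f x).

Definition quantisation (sigma : 'rV[R]_n * 'rV[R]_n -> R[i])
    (f : 'rV[R]_n -> R[i]) : 'rV[R]_n -> R[i] :=
  fun x => integral_Rn setT
    (fun xi => character x xi * sigma (x, xi) * fourier_G f xi).

Definition composition_term (a b : 'rV[R]_n * 'rV[R]_n -> R[i]) alpha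
    (p : 'rV[R]_n * 'rV[R]_n) : R[i] :=
  (0 +i* (2 * pi)) ^- mdegree alpha / (mfact alpha)%:R
  * mpower pderiv_xi alpha a p * mpower canonical_deriv alpha b p.

(* The sum over |alpha| < N: such an alpha has all its entries < N, so it is a
   function to 'I_N. *)
Definition composition_sum (a b : 'rV[R]_n * 'rV[R]_n -> R[i]) (N : nat)
    (p : 'rV[R]_n * 'rV[R]_n) : R[i] :=
  \sum_(alpha : {ffun 'I_n -> 'I_N} | (mdegree (fun j => alpha j) < N)%N)
    composition_term a b (fun j => alpha j) p.

End space.
End calculus.

(* Main.v *)
(** In the coordinates t = t(x) the canonical derivatives become the partial
    derivatives in t and the quantisation becomes the usual one on R^n, so that
    [a] and [b] become ordinary symbols of type rho, delta. Put
      c_th(t,xi) = INT INT exp(-2 i pi y.eta) a(t,xi+eta) b(t+th*y,xi) dy deta;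
    then c_0 = a b and c_1 is the symbol of the composition. The integral is
    made absolutely convergent by writing 1 = w(y) PROD (1+y_j^2)^2, with
    w = PROD (1+y_j^2)^-2, and integrating by parts in eta: this replaces [a] by
    PROD (1-d_{xi_j}^2/(4 pi^2))^2 a. Integrating by parts once more,
      d/dth c_th(a,b) = (2 i pi)^-1 SUM_j c_th(d_{xi_j} a, d_{t_j} b),
    so the asymptotic expansion is Taylor's formula at th = 0. The Leibniz rule
    d c_th(a,b) = c_th(da,b) + c_th(a,db) reduces all symbol estimates to bounds
    without derivatives; these lose a factor (1+|xi|)^(2n), which is recovered by
    expanding to a higher order. *)

Require Import Defs.
From HB Require Import structures.
From mathcomp Require Import all_boot all_order all_algebra.
From mathcomp Require Import complex.
From mathcomp Require Import all_classical all_reals all_analysis.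
From mathcomp Require Import measurable_realfun ring lra.
Set Implicit Arguments.
Unset Strict Implicit.
Unset Printing Implicit Defensive.
Import Order.TTheory GRing.Theory Num.Theory.
Import numFieldNormedType.Exports.
Import Normc.
Local Open Scope classical_set_scope.
Local Open Scope ring_scope.
Local Open Scope complex_scope.

(** * Changes of variables for the Lebesgue measure on R^n *)

Section coordinates.
Context {R : realType}.
Implicit Types (x t u : R).

(** No integral is left conditionally convergent: every integrand is dominated by a multiple of one
    fixed function, [wgt], so each limit, derivative or use of Fubini is justified by exhibiting a
    constant. Integration by parts has no boundary terms, being the derivative of a
    translation-invariant integral. The weight w is a square because differentiating in th or eta
    brings out a coordinate of y: one factor [wgt] absorbs it, the other one dominates. The outer
    integral converges because a power of eta costs only delta in the order of b, and delta < 1. The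
    loss of 2n is the price of dominating by [wgt] the region where eta is not larger than xi; it
    does not depend on the order of the expansion, whereas each order gains rho - delta > 0. That
    c_0 = a b is Fourier inversion: the regularisation can be undone only in front of a Schwartz
    function, so the constant 1 is approached by Gaussians. Partial derivatives commute by
    Clairaut's theorem, which enters wherever iterated derivatives have to be sorted. *)

Definition tcoord (x : R) : R := (2^-1 * ln ((1 - x) / (1 + x))).
(** This is [- tanh t], written with a single exponential. *)
Definition xcoord (t : R) : R := ((1 - expR (2 * t)) / (1 + expR (2 * t))).

Lemma xcoord_itv t : (-1 < xcoord t < 1).
Proof.
have e0 := expR_gt0 (2 * t); rewrite /xcoord.
by rewrite ltr_pdivlMr ?ltr_pdivrMr ?addr_gt0//; apply/andP; split; lra.
Qed.

Lemma xcoordK t : tcoord (xcoord t) = t.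
Proof.
have e0 := expR_gt0 (2 * t); rewrite /tcoord /xcoord.
rewrite (_ : (_ / _) = expR (2 * t)); first by rewrite expRK; field.
by field; apply/andP; split; apply/eqP; lra.
Qed.

Lemma tcoord_expR x : (-1 < x < 1)%R ->
  expR (2 * tcoord x) = ((1 - x) / (1 + x)).
Proof.
move=> /andP[x1 x2]; rewrite /tcoord mulrA divff ?mul1r//.
by rewrite lnK// posrE divr_gt0//; lra.
Qed.

Lemma tcoordK x : (-1 < x < 1)%R -> xcoord (tcoord x) = x.
Proof.
move=> xx; rewrite /xcoord tcoord_expR//; case/andP: xx => x1 x2.
by field; apply/andP; split; apply/eqP; lra.
Qed.

Lemma ltr_xcoord t u : (xcoord t < xcoord u) = (u < t).
Proof.
have e0 := expR_gt0 (2 * t); have e1 := expR_gt0 (2 * u); rewrite /xcoord.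
rewrite ltr_pdivrMr ?addr_gt0// mulrAC ltr_pdivlMr ?addr_gt0//.
rewrite -[RHS](ltr_pM2l (_ : 0 < 2)%R)// -[RHS]ltr_expR.
by apply/idP/idP; nra.
Qed.

Lemma is_derive_tcoord x : (-1 < x < 1) ->
  is_derive (x : R^o) (1 : R^o) (tcoord : R^o -> R^o) (- (1 - x ^+ 2)^-1).
Proof.
move=> /andP[x1 x2].
have q0 : (0 < (1 - x) / (1 + x)) by apply: divr_gt0; lra.
have n0 : 1 + x != 0 by apply/eqP; lra.
have d2 := is_derive1_ln q0.
have d1 : is_derive (x : R^o) (1 : R^o) (fun x : R^o => (1 - x) / (1 + x) : R^o) (- 2 / (1 + x) ^+ 2).
  apply: is_derive_eq.
  rewrite /GRing.scale /=.
  by field.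
have d3 := @is_derive1_comp _ (@ln R) (fun x : R => (1 - x) / (1 + x)) x _ _ d2 d1.
apply: is_derive_eq.
rewrite /GRing.scale /=.
by field; apply/and3P; split; apply/eqP; nra.
Qed.

End coordinates.

Section tuple_integral.
Import HBNNSimple.
Context {R : realType}.
Local Open Scope ereal_scope.
Local Notation leb := (@lebesgue_measure R).
Local Notation mR := (measurableTypeR R).

Lemma lebesgue_tupleS_integral n (f : n.+1.-tuple mR -> \bar R) :
  measurable_fun setT f -> (forall t, 0 <= f t) ->
  \int[lebesgue_tuple R n.+1]_t f t =
  \int[leb]_x \int[lebesgue_tuple R n]_t f (tuple_cons (x, t)).
Proof.
move=> mf f0.
rewrite (_ : \int[_]_t f t = \int[lebesgue_cons (lebesgue_tuple R n)]_t f t)//.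
rewrite /lebesgue_cons ge0_integral_pushforward//; last exact: measurable_tuple_cons.
rewrite preimage_setT.
rewrite fubini_tonelli1//; last by move=> x; exact: f0.
apply: (measurableT_comp mf); exact: measurable_tuple_cons.
Qed.

Lemma measurable_integral_cons n (f : n.+1.-tuple mR -> \bar R) :
  measurable_fun setT f -> (forall t, 0 <= f t) ->
  measurable_fun setT
    (fun x : mR => \int[lebesgue_tuple R n]_t f (tuple_cons (x, t))).
Proof.
move=> mf f0.
apply: (@measurable_fun_fubini_tonelli_F _ _ _ _ _ (lebesgue_tuple R n)
  (f \o @tuple_cons R n)); last by move=> x; exact: f0.
apply: (measurableT_comp mf); exact: measurable_tuple_cons.
Qed.

(** In other words [phi] pushes the measure [k dx] forward to Lebesgue measure. In this form, maps
    acting coordinatewise combine by Tonelli and no Jacobian determinant is needed. *)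
Definition change_of_variable (phi k : mR -> mR) :=
  [/\ measurable_fun setT phi, measurable_fun setT k, forall x, (0 <= k x)%R &
      forall F : mR -> \bar R, measurable_fun setT F -> (forall x, 0 <= F x) ->
      \int[leb]_x (F (phi x) * (k x)%:E) = \int[leb]_x F x].

(** One coordinate at a time: the first is changed in the outer integral, whose integrand [G] is the
    inner integral, and the induction hypothesis changes the others. *)
Lemma change_of_variable_tuple n (phi k : 'I_n -> mR -> mR)
    (F : n.-tuple mR -> \bar R) :
  (forall i, change_of_variable (phi i) (k i)) ->
  measurable_fun setT F -> (forall t, 0 <= F t) ->
  \int[lebesgue_tuple R n]_t
     (F [tuple phi i (tnth t i) | i < n] * (\prod_(i < n) k i (tnth t i))%:E) =
  \int[lebesgue_tuple R n]_t F t.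
Proof.
elim: n phi k F => [|n IH] phi k F cov mF F0.
  apply: eq_integral => t _; rewrite big_ord0 mule1; congr F.
  by rewrite [RHS]tuple0; apply: val_inj => /=; rewrite enum_ord0.
have mphi : measurable_fun setT
    (fun t : n.+1.-tuple mR => [tuple phi i (tnth t i) | i < n.+1]).
  apply/measurable_fun_tnthP => i /=.
  rewrite (_ : _ \o _ = phi i \o (fun t => tnth t i)).
    by apply: measurableT_comp; [case: (cov i)|exact: measurable_tnth].
  by apply/funext => t /=; rewrite tnth_mktuple.
have mk m (u : 'I_m -> mR -> mR) : (forall i, measurable_fun setT (u i)) ->
    measurable_fun setT (fun t : m.-tuple mR => (\prod_(i < m) u i (tnth t i))%R).
  move=> mu; apply: measurable_prod => i _.
  by apply: measurableT_comp; [exact: mu|exact: measurable_tnth].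
have k0 i x : (0 <= k i x)%R by case: (cov i).
have mFk : measurable_fun setT (fun t : n.+1.-tuple mR =>
   F [tuple phi i (tnth t i) | i < n.+1] * (\prod_(i < n.+1) k i (tnth t i))%:E).
  apply: emeasurable_funM; first exact: measurableT_comp.
  by apply/measurable_EFinP; apply: mk => i; case: (cov i).
rewrite [RHS]lebesgue_tupleS_integral//.
rewrite [LHS]lebesgue_tupleS_integral//; last first.
  by move=> t; apply: mule_ge0 => //; rewrite lee_fin prodr_ge0.
pose G (x : mR) := \int[lebesgue_tuple R n]_t F (tuple_cons (x, t)).
have [mphi0 mk0 _ cov0] := cov ord0.
rewrite -[RHS](cov0 G); first last.
- by move=> x; apply: integral_ge0 => t _; exact: F0.
- exact: measurable_integral_cons.
apply: eq_integral => x _.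
have mFx : measurable_fun setT
    (fun t : n.-tuple mR => F (tuple_cons (phi ord0 x, t))).
  apply: (measurableT_comp mF).
  apply: (measurableT_comp (@measurable_tuple_cons R n)).
  exact: measurable_pair1.
rewrite /G.
rewrite -(IH (fun i => phi (lift ord0 i)) (fun i => k (lift ord0 i))
  (fun t => F (tuple_cons (phi ord0 x, t))))//.
rewrite -ge0_integralZr//=; first last.
- by rewrite lee_fin k0.
- by move=> t _; apply: mule_ge0 => //; rewrite lee_fin prodr_ge0.
- apply: emeasurable_funM.
    apply: (measurableT_comp mFx); apply/measurable_fun_tnthP => i /=.
    rewrite (_ : _ \o _ = phi (lift ord0 i) \o (fun t => tnth t i)).
      by apply: measurableT_comp; [case: (cov (lift ord0 i))|exact: measurable_tnth].
    by apply/funext => t /=; rewrite tnth_mktuple.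
  apply/measurable_EFinP; apply: (mk n (fun i => k (lift ord0 i))) => i.
  by case: (cov (lift ord0 i)).
apply: eq_integral => t _.
rewrite -muleA -EFinM big_ord_recl mulrC; congr (F _ * (_ * _)%:E).
- apply: eq_from_tnth => i; rewrite tnth_mktuple.
  case: (unliftP ord0 i) => [j ->|->]; last by [].
  by rewrite !tnthS tnth_mktuple.
- by apply: eq_bigr => i _; rewrite tnthS.
Qed.

Lemma integral_prod_tuple n (u : 'I_n -> mR -> mR) :
  (forall i, measurable_fun setT (u i)) -> (forall i x, (0 <= u i x)%R) ->
  \int[lebesgue_tuple R n]_t (\prod_(i < n) u i (tnth t i))%:E =
  \prod_(i < n) \int[leb]_x (u i x)%:E.
Proof.
elim: n u => [|n IH] u mu u0.
  under eq_integral do rewrite big_ord0.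
  by rewrite integral_cst//= mul1e big_ord0 diracE mem_set.
have mp m (uu : 'I_m -> mR -> mR) : (forall i, measurable_fun setT (uu i)) ->
    measurable_fun setT (fun t : m.-tuple mR => (\prod_(i < m) uu i (tnth t i))%:E).
  move=> muu; apply/measurable_EFinP; apply: measurable_prod => i _.
  by apply: measurableT_comp; [exact: muu|exact: measurable_tnth].
have p0 m (uu : 'I_m -> mR -> mR) t : (forall i x, (0 <= uu i x)%R) ->
    0 <= (\prod_(i < m) uu i (tnth t i))%:E.
  by move=> uu0; rewrite lee_fin; apply: prodr_ge0 => i _.
rewrite lebesgue_tupleS_integral; [|exact: mp|by move=> t; exact: p0].
rewrite big_ord_recl -(IH (fun i => u (lift ord0 i)))//.
rewrite -ge0_integralZr//; first last.
- by apply: integral_ge0 => t _; exact: (p0 n (fun i => u (lift ord0 i))).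
- by move=> x _; rewrite lee_fin.
- by apply/measurable_EFinP; exact: mu.
apply: eq_integral => x _; rewrite -ge0_integralZl//=; first last.
- by rewrite lee_fin.
- by move=> t _; exact: (p0 n (fun i => u (lift ord0 i))).
- exact: (mp n (fun i => u (lift ord0 i))).
apply: eq_integral => t _; rewrite big_ord_recl EFinM; congr (_ * _%:E).
by apply: eq_bigr => i _; rewrite tnthS.
Qed.

(** Half-open intervals determine Lebesgue measure, which settles indicator functions; simple
    functions and monotone convergence give the rest. *)
Lemma change_of_variable_measure (phi k : mR -> mR) :
  measurable_fun setT phi -> measurable_fun setT k ->
  (forall x, (0 <= k x)%R) ->
  (forall a b : R, (a <= b)%R ->
    \int[leb]_(x in phi @^-1` `]a, b]) (k x)%:E = (b - a)%:E) ->
  change_of_variable phi k.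
Proof.
move=> mphi mk k0 phik; split => // F mF F0.
have mpre (A : set mR) : measurable A -> measurable (phi @^-1` A).
  by move=> mA; rewrite -[X in measurable X]setTI; exact: mphi.
have mkE (A : set mR) : measurable_fun A (fun x => (k x)%:E).
  by apply/measurable_EFinP/measurable_funTS.
(* The image under [phi] of the measure with density [k]; it has to be identified with Lebesgue
   measure. *)
pose nu (A : set mR) := \int[leb]_(x in phi @^-1` A) (k x)%:E.
have nu0 : nu set0 = 0 by rewrite /nu preimage_set0 integral_set0.
have nu_ge0 A : 0 <= nu A by apply: integral_ge0 => x _; rewrite lee_fin.
have nu_sigma : semi_sigma_additive nu.
  move=> A mA tA mUA; rewrite /nu preimage_bigcup.
  rewrite ge0_integral_bigcup//.
  - by apply: is_cvg_nneseries => n _ _; exact: nu_ge0.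
  - by move=> i; exact: mpre.
  - by move=> x _; rewrite lee_fin.
  - apply/trivIsetP => /= i j _ _ ij; rewrite -preimage_setI.
    by move/trivIsetP : tA => /(_ _ _ _ _ ij) ->//; rewrite preimage_set0.
pose nuM : {measure set mR -> \bar R} := HB.pack nu
  (isMeasure.Build _ _ _ nu nu0 nu_ge0 nu_sigma).
have nuE A : measurable A -> leb A = nu A.
  move=> mA; apply: (@lebesgue_measure_unique R nuM) => // X [[a b] /= ab <-].
  rewrite /nu; have [ab'|ba] := leP a b.
    rewrite phik//=; transitivity (leb `]a, b]) => //.
    rewrite lebesgue_measure_itv/= lte_fin.
    by case: ltgtP ab' => //= ->; rewrite subrr.
  rewrite set_itv_ge ?bnd_simp -?leNgt ?(ltW ba)// measure0.
  by rewrite preimage_set0 integral_set0.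
have ind (A : set mR) : measurable A ->
   \int[leb]_x (\1_A (phi x) * k x)%:E = \int[leb]_x (\1_A x)%:E.
  move=> mA.
  have -> : \int[leb]_x (\1_A x)%:E = nu A.
    by rewrite integral_indic// setIT; exact: nuE.
  rewrite /nu [RHS]integral_mkcond; apply: eq_integral => x _.
  rewrite patchE indicE; case: ifPn => [/set_mem xA|].
    by rewrite mem_set// mul1r.
  rewrite notin_setE => xA.
  by rewrite memNset// mul0r.
pose h := nnsfun_approx measurableT mF.
have hF x : F x = limn (fun n => (h n x)%:E).
  apply/esym/cvg_lim => //; exact: cvg_nnsfun_approx.
under [RHS]eq_integral do rewrite hF.
rewrite [RHS]monotone_convergence//; first last.
- by move=> x _ a b ab; rewrite lee_fin; exact/lefP/nd_nnsfun_approx.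
- by move=> n x _; rewrite lee_fin.
- by move=> n; apply/measurable_EFinP; exact/measurable_funP.
have hFk x : F (phi x) * (k x)%:E = limn (fun n => (h n (phi x) * k x)%:E).
  apply/esym/cvg_lim => //; under eq_fun do rewrite EFinM.
  by apply: cvgeZr => //; exact: cvg_nnsfun_approx.
under [LHS]eq_integral do rewrite hFk.
have mhk n : measurable_fun setT (fun x : mR => (h n (phi x) * k x)%:E).
  by apply/measurable_EFinP/measurable_funM => //; exact: measurableT_comp.
rewrite [LHS]monotone_convergence//; first last.
- move=> x _ a b ab; rewrite lee_fin ler_wpM2r//.
  by exact/lefP/nd_nnsfun_approx.
- by move=> n x _; rewrite lee_fin mulr_ge0.
congr (limn _); apply/funext => n.
have pos r x : (0 <= r * \1_(h n @^-1` [set r]) x)%R.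
  by rewrite -lee_fin; exact: nnfun_muleindic_ge0.
have mA r : measurable (h n @^-1` [set r] : set mR) by [].
transitivity (\int[leb]_x (\sum_(r \in range (h n))
    (r * \1_(h n @^-1` [set r]) (phi x) * k x)%:E)).
  apply: eq_integral => x _; rewrite fsumEFin//; congr EFin.
  rewrite fimfunE !fsbig_finite//= mulr_suml.
  by apply: eq_bigr.
rewrite ge0_integral_fsum//; first last.
- by move=> r x _; rewrite lee_fin mulr_ge0.
- move=> r; apply/measurable_EFinP/measurable_funM => //.
  apply: measurable_funM => //.
  by apply: measurableT_comp => //; exact: measurable_indic.
transitivity (\int[leb]_x (\sum_(r \in range (h n))
    (r * \1_(h n @^-1` [set r]) x)%:E)); last first.
  by apply: eq_integral => x _; rewrite fsumEFin//; congr EFin; rewrite [RHS]fimfunE.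
rewrite ge0_integral_fsum//; first last.
- by move=> r x _; rewrite lee_fin.
- move=> r; apply/measurable_EFinP/measurable_funM => //.
apply: eq_fsbigr => r _.
(* A negative value is not attained by a nonnegative simple function: its preimage is empty and both
   integrals vanish. *)
have [r0|r0] := ltP r 0%R.
  rewrite (_ : h n @^-1` [set r] = set0); last exact: preimage_nnfun0.
  by under eq_integral do rewrite indicE in_set0 mulr0 mul0r;
     under [RHS]eq_integral do rewrite indicE in_set0 mulr0.
under eq_integral do rewrite -mulrA EFinM.
under [RHS]eq_integral do rewrite EFinM.
rewrite !ge0_integralZl//; first by rewrite ind.
- by apply/measurable_EFinP; exact: measurable_indic.
- by apply/measurable_EFinP/measurable_funM => //; apply: measurableT_comp => //; exact: measurable_indic.
- by move=> x _; rewrite lee_fin mulr_ge0// indicE.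
Qed.

Lemma change_of_variable_shift (v : R) :
  change_of_variable (fun x => x + v)%R (fun=> 1%R).
Proof.
have mv : measurable_fun setT (fun x : mR => (x + v)%R : mR).
  exact: (@measurable_funD _ mR _ setT).
apply: change_of_variable_measure => // a b ab.
rewrite (_ : _ @^-1` _ = `](a - v)%R, (b - v)%R]%classic); last first.
  by apply/seteqP; split => x /=; rewrite !in_itv/= ltrBlDr lerBrDr.
rewrite integral_cst//= mul1e lebesgue_measure_itv/= lte_fin ltrD2r.
case: ltgtP ab => //= [_ _|-> _]; last by rewrite subrr.
by congr (_%:E); ring.
Qed.

Lemma change_of_variable_scale (e : R) : (0 < e)%R ->
  change_of_variable (fun x => e * x)%R (fun=> e).
Proof.
move=> e0.
have mv : measurable_fun setT (fun x : mR => (e * x)%R : mR).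
  exact: (@measurable_funM _ mR _ setT).
apply: change_of_variable_measure => // [x|a b ab]; first exact: ltW.
rewrite (_ : _ @^-1` _ = `](e^-1 * a)%R, (e^-1 * b)%R]%classic); last first.
  apply/seteqP; split => x /=; rewrite !in_itv/=;
  by rewrite ![(e^-1 * _)%R]mulrC ltr_pdivrMr// ler_pdivlMr// [(x * e)%R]mulrC.
rewrite integral_cst//= lebesgue_measure_itv/= lte_fin ltr_pM2l ?invr_gt0//.
case: ltgtP ab => //= [_ _|-> _]; last by rewrite mule0 subrr.
by rewrite -EFinB -EFinM; congr (_%:E); field; rewrite gt_eqF.
Qed.

Lemma integral_oneDsqrV : \int[leb]_x ((1 + x ^+ 2)^-1)%:E = pi%:E.
Proof.
rewrite ge0_symfun_integralT; first last.
- by move=> x /=; rewrite sqrrN.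
- exact: continuous_oneDsqrV.
- by move=> x; rewrite invr_ge0 addr_ge0// sqr_ge0.
rewrite -set_itvcy integral0y_oneDsqr -EFinM; by congr (_%:E); field.
Qed.

Lemma integral_gauss_pi : \int[leb]_x (expR (- pi * x ^+ 2))%:E = 1.
Proof.
have sp : (0 < Num.sqrt (pi : R))%R by rewrite sqrtr_gt0 pi_gt0.
have [_ _ _ /(_ (fun x => (gauss_fun x)%:E))] := change_of_variable_scale sp.
rewrite integralT_gauss => H.
have mg : measurable_fun setT (fun x : mR => (@gauss_fun R x)%:E).
  by apply/measurable_EFinP; exact: measurable_gauss_fun.
have {}H := H mg (fun x => ltac:(by rewrite lee_fin gauss_fun_ge0)).
have mh : measurable_fun setT (fun x : mR => (expR (- pi * x ^+ 2))%:E).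
  apply/measurable_EFinP; apply: continuous_measurable_fun => x.
  apply: (continuous_comp (f := fun x : R => (- pi * x ^+ 2)%R) (g := @expR R)); last exact: continuous_expR.
  apply: (@continuousM _ R^o); first exact: cst_continuous.
  exact: exprn_continuous.
have e0 : (0 <= (Num.sqrt (pi : R))%:E) by rewrite lee_fin ltW.
move: H; under eq_integral.
  move=> x _; rewrite /gauss_fun exprMn sqr_sqrtr ?pi_ge0// -mulNr; over.
rewrite ge0_integralZr//.
set J := integral _ _ _ => H; rewrite -[LHS]/J; move: H.
have : 0 <= J by apply: integral_ge0 => x _; rewrite lee_fin expR_ge0.
(* Cancelling [sqrt pi] requires [J] to be finite: [J = +oo] would make the product infinite, and
   [-oo] is excluded by positivity. *)
case: J => [r| |]//=.
  rewrite -EFinM => _ [] /(congr1 (fun x => x / Num.sqrt pi)%R).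
  by rewrite mulfK ?gt_eqF// divff ?gt_eqF// => ->.
by rewrite mulyr gtr0_sg// mul1e.
Qed.

End tuple_integral.

Section tcoord_change_of_variable.
Context {R : realType}.
Local Notation leb := (@lebesgue_measure R).
Local Notation mR := (measurableTypeR R).

(** One factor of the density of the Haar measure, equal to minus the derivative of [tcoord] on
    []-1, 1[]. *)
Definition tdensity (x : R) : R := (1 - x ^+ 2)^-1.

(** Outside []-1, 1[] the extended density is 0, so the value given there to the extended [tcoord]
    has no influence. On intervals the claim is the fundamental theorem of calculus for
    [- tcoord]. *)
Lemma change_of_variable_tcoord : change_of_variable
  ((@tcoord R : mR -> mR) \_ `]-1, 1[) ((tdensity : mR -> mR) \_ `]-1, 1[).
Proof.
have sq (x : R) : x \in `]-1, 1[%R -> (0 < 1 - x ^+ 2)%R.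
  by rewrite in_itv/= => /andP[x1 x2]; nra.
have dt (x : R) : x \in `]-1, 1[%R ->
    is_derive (x : R^o) (1 : R^o)%R (@tcoord R : R^o -> R^o) (- tdensity x)%R.
  by move=> xx; apply: is_derive_tcoord; rewrite in_itv/= in xx.
have ct (x : R) : x \in `]-1, 1[%R -> {for x, continuous (@tcoord R)}.
  move=> xx; apply: differentiable_continuous; apply/derivable1_diffP.
  by have [] := dt _ xx.
have ck (x : R) : x \in `]-1, 1[%R -> {for x, continuous tdensity}.
  move=> xx; apply: (@continuousV _ R^o); first by rewrite gt_eqF ?sq.
  apply: (@continuousB _ R^o); first exact: cst_continuous.
  exact: exprn_continuous.
apply: change_of_variable_measure.
- apply/(measurable_restrictT _ (measurable_itv `]-1, 1[)); apply: open_continuous_measurable_fun => //.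
  by move=> x; rewrite inE => xx; apply: ct; exact: xx.
- apply/(measurable_restrictT _ (measurable_itv `]-1, 1[)); apply: open_continuous_measurable_fun => //.
  by move=> x; rewrite inE => xx; apply: ck; exact: xx.
- move=> x; rewrite patchE; case: ifPn => //; rewrite inE/= => xx.
  by rewrite invr_ge0 ltW ?sq.
move=> a b ab.
have [xa1 xa2] := andP (xcoord_itv a); have [xb1 xb2] := andP (xcoord_itv b).
(* [tcoord] is decreasing, so the preimage of []a, b]] is closed on the left and open on the
   right. *)
transitivity (\int[leb]_(x in `[xcoord b, xcoord a[) (tdensity x)%:E)%E.
  rewrite integral_mkcond [RHS]integral_mkcond; apply: eq_integral => x _.
  rewrite !patchE.
  have [xx|xx] := boolP (x \in `]-1, 1[%classic); last first.
    have -> : (point : R)%:E = point :> \bar R by [].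
    rewrite if_same [RHS]ifF//; apply/negbTE; move: xx.
    rewrite !notin_setE /= !in_itv/= => /negP xx; apply/negP.
    by apply: contra xx => /andP[y1 y2]; apply/andP; split; lra.
  have xI : (-1 < x < 1)%R by move: xx; rewrite inE/= in_itv.
  have tE : ((@tcoord R : mR -> mR) \_ `]-1, 1[) x = tcoord x by rewrite patchE xx.
  have le1 : (xcoord b <= x) = (tcoord x <= b).
    by rewrite -{1}(tcoordK xI) leNgt ltr_xcoord -leNgt.
  have lt1 : (x < xcoord a) = (a < tcoord x).
    by rewrite -{1}(tcoordK xI) ltr_xcoord.
  congr (if _ then _ else _); apply/idP/idP; rewrite !inE/= tE !in_itv/= le1 lt1;
  by rewrite andbC.
have [<-|ab'] := eqVneq a b.
  by rewrite set_itv_ge ?bnd_simp ?ltxx// integral_set0 subrr.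
have {}ab : (xcoord b < xcoord a)%R by rewrite ltr_xcoord lt_neqAle ab'.
have sub x : (xcoord b <= x <= xcoord a)%R -> x \in `]-1, 1[%R.
  by move=> /andP[y1 y2]; rewrite in_itv/=; apply/andP; split; lra.
rewrite integral_itv_bndo_bndc; last first.
  apply/measurable_EFinP; apply: subspace_continuous_measurable_fun => //.
  apply: continuous_in_subspaceT => x; rewrite inE/= in_itv/= => /andP[y1 y2].
  by apply: ck; apply: sub; rewrite y1 ltW.
rewrite (@continuous_FTC2 _ _ (fun x => - tcoord x)%R)//.
- by rewrite !xcoordK -EFinD opprK addrC.
- apply: continuous_in_subspaceT => x; rewrite inE/= in_itv/= => y.
  by apply: ck; exact: sub.
- split.
  + move=> x /subset_itv_oo_cc; rewrite in_itv/= => /sub/dt[+ _].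
    exact: derivableN.
  + apply: cvgN; apply: cvg_at_right_filter; apply: ct; apply: sub.
    by rewrite lexx ltW.
  + apply: cvgN; apply: cvg_at_left_filter; apply: ct; apply: sub.
    by rewrite lexx ltW.
- move=> x /subset_itv_oo_cc; rewrite in_itv/= => /sub/dt[dx dxE].
  by rewrite derive1E deriveN// dxE opprK.
Qed.

End tcoord_change_of_variable.

(** * Dominated integrals over R^n *)

Section continuous_measurable_tuple.
Context {R : realType}.
Local Notation mR := (measurableTypeR R).

Lemma rational_approx (x e : R) : 0 < e -> exists q : rat, `|x - ratr q| < e.
Proof.
move=> e0; have xe : x < x + e by rewrite ltrDl.
have [q] := rat_in_itvoo xe; rewrite in_itv/= => /andP[q1 q2].
by exists q; rewrite distrC gtr0_norm ?subr_gt0// ltrBlDl.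
Qed.

(** The topology is that of the sup norm: an open set is the union of the cubes it contains that
    have a rational centre and radius 1/(k+1). There are countably many of them, and each is a
    finite intersection of coordinate conditions. In [A] the other cubes are replaced by the empty
    set. *)
Lemma measurable_open_rv n (U : set 'rV[R]_n) : open U ->
  measurable (@rv_of_tuple R n @^-1` U).
Proof.
move=> oU.
pose A (i : 'rV[rat]_n * nat) : set (n.-tuple mR) :=
  if pselect (ball (map_mx ratr i.1 : 'rV[R]_n) i.2.+1%:R^-1 `<=` U) then
    \bigcap_(j in [set: 'I_n])
      ((fun t : n.-tuple mR => tnth t j) @^-1` (ball (ratr (i.1 0 j) : R) (i.2.+1%:R^-1 : R)))
  else set0.
have -> : @rv_of_tuple R n @^-1` U = \bigcup_(i in [set: 'rV[rat]_n * nat]) A i.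
  apply/seteqP; split => t /=; last first.
    move=> [i _]; rewrite /A; case: pselect => //= /(_ (rv_of_tuple t)) iU At; apply: iU.
    split; first by rewrite invr_gt0.
    move=> a b; rewrite !mxE ord1; exact: At.
  move=> Ut.
  have /nbhs_ballP[e /= e0 eU] : nbhs (rv_of_tuple t) U by exact: open_nbhs_nbhs.
  (* The centre lies within the radius of [t], so the cube reaches at most twice its radius away
     from [t]; hence [e / 2]. *)
  have [k ke] : exists k, (k.+1%:R^-1 : R) < e / 2.
    have e2 : 0 < e / 2 by rewrite divr_gt0.
    by have [N _ HN] := near_infty_natSinv_lt (PosNum e2); exists N; apply: HN => /=.
  have k0 : 0 < k.+1%:R^-1 :> R by rewrite invr_gt0.
  have /choice[q qP] : forall j, exists q : rat, `|tnth t j - ratr q| < k.+1%:R^-1.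
    by move=> j; exact: rational_approx.
  exists (\row_j q j, k) => //; rewrite /A; case: pselect => [_|[]] /=.
    by move=> j _; rewrite /= mxE /ball/= distrC.
  move=> y [_ By]; apply: eU; split => // a j; rewrite ord1 !mxE /ball/=.
  have := By 0 j; rewrite !mxE /ball/= => H.
  rewrite (le_lt_trans (ler_distD (ratr (q j)) _ _))//.
  by move: (k.+1%:R^-1) ke H (qP j) => d; clear; lra.
apply: countable_bigcupT_measurable; [exact: countableP|move=> i].
rewrite /A; case: pselect => h /=; last exact: measurable0.
apply: fin_bigcap_measurable => // j _.
rewrite -[X in measurable X]setTI; apply: measurable_tnth => //.
exact: measurable_ball.
Qed.

Lemma continuous_measurable_rv n (f : 'rV[R]_n -> R) : continuous f ->
  measurable_fun setT (fun t : n.-tuple mR => f (rv_of_tuple t)).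
Proof.
move=> cf; apply: (measurability _ (RGenOpens.measurableE R)).
move=> _ [_ [a [b ->] <-]]; rewrite setTI.
have := @measurable_open_rv n (f @^-1` `]a, b[); apply.
apply: open_comp => // x _; exact: cf.
Qed.

Lemma continuous_rV (T : topologicalType) n (F : T -> 'rV[R]_n) (x : T) :
  (forall j, {for x, continuous (fun y => F y 0 j)}) -> {for x, continuous F}.
Proof.
move=> cF A [P PF PA]; rewrite /nbhs/=.
have : \forall y \near x, forall j, P 0 j (F y 0 j).
  by apply: filter_forall => j; apply: cF; exact: PF.
by apply: filterS => y Py; apply: PA => i j; rewrite ord1.
Qed.

Lemma eq_continuous_at (T U : topologicalType) (f g : T -> U) (x : T) :
  f =1 g -> {for x, continuous f} -> {for x, continuous g}.
Proof. by move=> /funext ->. Qed.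

Lemma continuous_pair (T U V : topologicalType) (f : T -> U) (g : T -> V) (x : T) :
  {for x, continuous f} -> {for x, continuous g} ->
  {for x, continuous (fun y => (f y, g y))}.
Proof. by move=> cf cg; exact: (cvg_pair cf cg). Qed.

Lemma continuous_for_id (T : topologicalType) (x : T) : {for x, continuous (fun y : T => y)}.
Proof. exact: cvg_id. Qed.

Lemma continuous_for_cst (T U : topologicalType) (a : U) (x : T) :
  {for x, continuous (fun=> a)}.
Proof. exact: cvg_cst. Qed.

Lemma continuous_for_comp (S T U : topologicalType) (f : T -> U) (g : S -> T) (x : S) :
  {for x, continuous g} -> {for g x, continuous f} ->
  {for x, continuous (fun y => f (g y))}.
Proof. exact: continuous_comp. Qed.

Lemma continuous_pairr (T U : topologicalType) (a : T) (y : U) :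
  {for y, continuous (fun y : U => (a, y))}.
Proof.
have H := @continuous_pair U T U (fun=> a) (fun y => y) y
  (@continuous_for_cst _ _ a y) (@continuous_for_id _ y).
exact: H.
Qed.

Lemma continuous_pairl (T U : topologicalType) (a : U) (x : T) :
  {for x, continuous (fun x : T => (x, a))}.
Proof.
have H := @continuous_pair T T U (fun y => y) (fun=> a) x
  (@continuous_for_id _ x) (@continuous_for_cst _ _ a x).
exact: H.
Qed.

(** The two vectors are concatenated into one of length n + m, and concatenation of tuples is
    measurable for the product sigma-algebra. *)
Lemma continuous_measurable_rv2 n m (f : 'rV[R]_n * 'rV[R]_m -> R) :
  continuous f ->
  measurable_fun setT (fun t : n.-tuple mR * m.-tuple mR =>
     f (rv_of_tuple t.1, rv_of_tuple t.2)).
Proof.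
move=> cf.
pose g (z : 'rV[R]_(n + m)) := f (lsubmx z, rsubmx z).
have cg : continuous g.
  move=> z; apply: (@continuous_comp _ _ _ (fun z : 'rV[R]_(n + m) => (lsubmx z, rsubmx z))); last exact: cf.
  have cl : continuous (fun z : 'rV[R]_(n + m) => lsubmx z).
    move=> y; apply: continuous_rV => j; apply: eq_continuous_at (@coord_continuous R _ _ 0 (lshift m j) y).
    by move=> x /=; rewrite mxE.
  have cr : continuous (fun z : 'rV[R]_(n + m) => rsubmx z).
    move=> y; apply: continuous_rV => j; apply: eq_continuous_at (@coord_continuous R _ _ 0 (rshift n j) y).
    by move=> x /=; rewrite mxE.
  exact: (cvg_pair (cl z) (cr z)).
have mcat : measurable_fun setT (fun t : n.-tuple mR * m.-tuple mR => [tuple of t.1 ++ t.2]).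
  apply/measurable_fun_tnthP => i /=; rewrite -(splitK i); case: (fintype.split i) => j /=.
  - rewrite (_ : _ \o _ = (fun t => tnth t j) \o fst); last first.
      by apply/funext => t /=; rewrite tnth_lshift.
    by apply: measurableT_comp => //; exact: measurable_tnth.
  - rewrite (_ : _ \o _ = (fun t => tnth t j) \o snd); last first.
      by apply/funext => t /=; rewrite tnth_rshift.
    by apply: measurableT_comp => //; exact: measurable_tnth.
have := measurableT_comp (continuous_measurable_rv cg) mcat.
congr (measurable_fun _ _); apply/funext => t /=; rewrite /g; congr (f (_, _)).
- by apply/rowP => j; rewrite !mxE tnth_lshift.
- by apply/rowP => j; rewrite !mxE tnth_rshift.
Qed.
End continuous_measurable_tuple.

Section real_integral.
Context {R : realType}.
Local Notation mR := (measurableTypeR R).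
Local Notation leb := (@lebesgue_measure R).

(** The universal dominating function. As a product it has integral [pi ^+ n] by Tonelli, and a
    translation multiplies it by at most a constant. *)
Definition wgt n (x : 'rV[R]_n) : R := \prod_(j < n) (1 + x 0 j ^+ 2)^-1.

Lemma wgt_gt0 n (x : 'rV[R]_n) : 0 < wgt x.
Proof.
by apply: prodr_gt0 => j _; rewrite invr_gt0 ltr_pwDl// sqr_ge0.
Qed.

Lemma continuous_prod (T : topologicalType) (I : Type) (r : seq I)
    (F : I -> T -> R) (x : T) : (forall i, {for x, continuous (F i)}) ->
  {for x, continuous (fun y => \prod_(i <- r) F i y)}.
Proof.
move=> cF; elim: r => [|i r IH].
  by apply: eq_continuous_at (@cst_continuous _ _ (1 : R) x) => y; rewrite big_nil.
by apply: eq_continuous_at (continuousM (cF i) IH) => y; rewrite big_cons.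
Qed.

Lemma continuous_wgt n : continuous (@wgt n).
Proof.
move=> x; apply: continuous_prod => j.
apply: (continuous_comp (f := fun y : 'rV[R]_n => y 0 j) (g := fun y : R => (1 + y ^+ 2)^-1)).
  exact: coord_continuous.
exact: continuous_oneDsqrV.
Qed.

Definition rint n (f : 'rV[R]_n -> R) : R :=
  (\int[lebesgue_tuple R n]_t f (rv_of_tuple t))%R.

Lemma integral_wgt n :
  (\int[lebesgue_tuple R n]_t (wgt (rv_of_tuple t))%:E = (pi ^+ n)%:E)%E.
Proof.
transitivity (\prod_(j < n) \int[leb]_x ((1 + x ^+ 2)^-1)%:E)%E.
  rewrite -(integral_prod_tuple (u := fun _ x => (1 + x ^+ 2)^-1)).
  - apply: eq_integral => t _; congr (_%:E); apply: eq_bigr => j _.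
    by rewrite mxE.
  - move=> _; apply: continuous_measurable_fun; exact: continuous_oneDsqrV.
  - by move=> _ x; rewrite invr_ge0 addr_ge0// sqr_ge0.
rewrite (eq_bigr (fun=> pi%:E)); last by move=> *; exact: integral_oneDsqrV.
by rewrite prodEFin prodr_const card_ord.
Qed.

(** Continuity is there to provide measurability, and the bound makes [C * wgt] the majorant in
    every use of dominated convergence. *)
Definition dominated n (C : R) (f : 'rV[R]_n -> R) :=
  continuous f /\ forall x, `|f x| <= C * wgt x.

Lemma integrable_wgt n (C : R) : (lebesgue_tuple R n).-integrable setT
  (fun t => (C * wgt (rv_of_tuple t))%:E).
Proof.
under eq_fun do rewrite EFinM.
apply: integrableZl => //; apply/integrableP; split.
  by apply/measurable_EFinP; apply: continuous_measurable_rv; exact: continuous_wgt.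
rewrite (_ : integral _ _ _ = (pi ^+ n)%:E) ?ltry//.
rewrite -integral_wgt; apply: eq_integral => t _.
by rewrite /= ger0_norm// ltW// wgt_gt0.
Qed.

Lemma dominated_integrable n (C : R) (f : 'rV[R]_n -> R) : dominated C f ->
  (lebesgue_tuple R n).-integrable setT (EFin \o (fun t => f (rv_of_tuple t))).
Proof.
move=> [cf fC]; apply: le_integrable (integrable_wgt n C) => //.
  by apply/measurable_EFinP; exact: continuous_measurable_rv.
move=> t _; rewrite /= lee_fin; apply: le_trans (fC _) _; exact: ler_norm.
Qed.

Lemma rintD n C D (f g : 'rV[R]_n -> R) : dominated C f -> dominated D g ->
  rint (fun x => f x + g x) = rint f + rint g.
Proof.
by move=> /dominated_integrable f1 /dominated_integrable g1; exact: RintegralD.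
Qed.

Lemma rintB n C D (f g : 'rV[R]_n -> R) : dominated C f -> dominated D g ->
  rint (fun x => f x - g x) = rint f - rint g.
Proof.
by move=> /dominated_integrable f1 /dominated_integrable g1; exact: RintegralB.
Qed.

Lemma rintZ n C k (f : 'rV[R]_n -> R) : dominated C f ->
  rint (fun x => k * f x) = k * rint f.
Proof. by move=> /dominated_integrable f1; exact: RintegralZl. Qed.

Lemma rint_le n C (f : 'rV[R]_n -> R) : dominated C f ->
  `|rint f| <= C * pi ^+ n.
Proof.
move=> df; have fi := dominated_integrable df.
apply: le_trans (le_normr_Rintegral _ fi) _ => //.
have -> : C * pi ^+ n =
    (\int[lebesgue_tuple R n]_t (C * wgt (rv_of_tuple t)))%R.
  rewrite RintegralZl//; last first.
    have := integrable_wgt n 1; by under eq_fun do rewrite mul1r.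
  by congr (_ * _); rewrite /Rintegral integral_wgt.
apply: le_Rintegral => //; last by move=> t _; exact: df.2.
- exact: (integrable_norm fi).
- exact: integrable_wgt.
Qed.

Lemma rint_gauss n : rint (fun x : 'rV[R]_n => \prod_j expR (- pi * x 0 j ^+ 2)) = 1.
Proof.
rewrite /rint /Rintegral.
rewrite (_ : integral _ _ _ = 1%E)//.
transitivity (\prod_(j < n) \int[leb]_x (expR (- pi * x ^+ 2))%:E)%E.
  rewrite -(integral_prod_tuple (u := fun _ x => expR (- pi * x ^+ 2))).
  - apply: eq_integral => t _; congr (_%:E); apply: eq_bigr => j _.
    by rewrite mxE.
  - move=> _; apply: continuous_measurable_fun => x.
    apply: (continuous_comp (f := fun x : R => (- pi * x ^+ 2)%R) (g := @expR R)); last exact: continuous_expR.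
    apply: (@continuousM _ R^o); first exact: cst_continuous.
    exact: exprn_continuous.
  - by move=> _ x; exact: expR_ge0.
by rewrite big1// => j _; exact: integral_gauss_pi.
Qed.

Lemma rint_change_of_variable n (phi k : 'I_n -> mR -> mR) (f : 'rV[R]_n -> R) :
  (forall i, change_of_variable (phi i) (k i)) -> continuous f ->
  (\int[lebesgue_tuple R n]_t
     (f (\row_i phi i (tnth t i)) * \prod_(i < n) k i (tnth t i)))%R = rint f.
Proof.
move=> cov cf; rewrite /rint /Rintegral; congr fine.
rewrite integralE [RHS]integralE.
have mf : measurable_fun setT (fun t : n.-tuple mR => (f (rv_of_tuple t))%:E).
  by apply/measurable_EFinP; exact: continuous_measurable_rv.
have k0 (t : n.-tuple mR) : 0 <= \prod_(i < n) k i (tnth t i).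
  by apply: prodr_ge0 => i _; case: (cov i).
have E (t : n.-tuple mR) : \row_i phi i (tnth t i) =
    rv_of_tuple [tuple phi i (tnth t i) | i < n].
  by apply/rowP => i; rewrite !mxE tnth_mktuple.
congr (_ - _)%E.
- rewrite -[RHS](change_of_variable_tuple (phi := phi) (k := k))//; last first.
    exact: measurable_funepos.
  apply: eq_integral => t _; rewrite !funeposE E.
  by rewrite -!EFin_max -EFinM maxr_pMl// mul0r.
- rewrite -[RHS](change_of_variable_tuple (phi := phi) (k := k))//; last first.
    exact: measurable_funeneg.
  apply: eq_integral => t _; rewrite !funenegE E.
  by rewrite -!EFinN -!EFin_max -EFinM maxr_pMl// mul0r mulNr.
Qed.

Lemma rint_shift n (v : 'rV[R]_n) (f : 'rV[R]_n -> R) : continuous f ->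
  rint (fun x => f (x + v)) = rint f.
Proof.
move=> cf; rewrite -[RHS](rint_change_of_variable (phi := fun i x => x + v 0 i) (k := fun i x => 1))//; last first.
  by move=> i; exact: change_of_variable_shift.
rewrite /rint; apply: eq_Rintegral => t _; rewrite big1// mulr1.
by congr f; apply/rowP => i; rewrite !mxE.
Qed.

Lemma rint_scale n C (e : R) (f : 'rV[R]_n -> R) : 0 < e ->
  dominated C (fun x => f (e *: x)) -> continuous f ->
  e ^+ n * rint (fun x => f (e *: x)) = rint f.
Proof.
move=> e0 df cf; rewrite -[RHS](rint_change_of_variable (phi := fun i x => e * x) (k := fun i x => e))//; last first.
  by move=> i; exact: change_of_variable_scale.
rewrite -(rintZ _ df) /rint; apply: eq_Rintegral => t _.
rewrite prodr_const card_ord mulrC.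
by congr (f _ * _); apply/rowP => i; rewrite !mxE.
Qed.

Lemma rint_tmap n (f : 'rV[R]_n -> R) : continuous f ->
  (\int[lebesgue_tuple R n]_(t in @rv_of_tuple R n @^-1` G)
    (f (tmap (rv_of_tuple t)) / \prod_(j < n) (1 - rv_of_tuple t 0 j ^+ 2)))%R =
  rint f.
Proof.
move=> cf; rewrite -(rint_change_of_variable
  (fun=> change_of_variable_tcoord))//.
rewrite Rintegral_mkcond; apply: eq_Rintegral => t _.
rewrite patchE; case: ifPn => [/set_mem/= tG|].
  have tj j : tnth t j \in `]-1, 1[%classic.
    by rewrite inE/= in_itv/=; have := tG j; rewrite mxE.
  congr (f _ * _).
    by apply/rowP => j; rewrite !mxE patchE tj.
  rewrite -prodfV; apply: eq_bigr => j _; rewrite patchE tj /tdensity mxE//.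
(* Outside [G] some coordinate leaves []-1, 1[], where the extended density is 0 and annihilates the
   product. *)
rewrite notin_setE /= => tG.
have [j tj] : exists j, tnth t j \notin `]-1, 1[%classic.
  apply: contrapT => H; apply: tG => j; rewrite mxE; apply: contrapT => Hj.
  by apply: H; exists j; rewrite notin_setE/= in_itv.
by rewrite (bigD1 j)//= patchE (negbTE tj) mul0r mulr0.
Qed.

(** Dominated convergence speaks of sequences: a failure of continuity would produce points [q k] in
    the balls of radius 1/(k+1) at which the integral stays [e] away from its value at [p]. *)
Lemma rint_continuous (T : pseudoMetricType R) n (F : T -> 'rV[R]_n -> R)
    (p : T) (C : R) :
  (\forall q \near p, dominated C (F q)) ->
  (forall x, {for p, continuous (F^~ x)}) ->
  {for p, continuous (fun q => rint (F q))}.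
Proof.
move=> dF cF; apply/cvgrPdist_lt => e e0; apply: contrapT => nA.
have /choice[q qP] : forall k, exists q,
    [/\ ball p k.+1%:R^-1 q, dominated C (F q) & e <= `|rint (F p) - rint (F q)|].
  move=> k; apply: contrapT => nq; apply: nA; near=> q.
  rewrite ltNge; apply/negP => eq'; apply: nq; exists q; split => //.
    by near: q; apply: nbhsx_ballx; rewrite invr_gt0.
  by near: q.
have qp : q k @[k --> \oo] --> p.
  apply/cvg_ballP => d d0; near=> k.
  have [+ _ _] := qP k; apply: le_ball; apply: ltW.
  by near: k; exact: (near_infty_natSinv_lt (PosNum d0)).
have dp : dominated C (F p) by exact: (nbhs_singleton dF).
have : rint (F (q k)) @[k --> \oo] --> rint (F p).
  apply: fine_cvg; rewrite fineK; last first.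
    exact: integrable_fin_num (dominated_integrable dp).
  apply: (@dominated_cvg _ _ _ _ _ measurableT _ _
    (fun t => (C * wgt (rv_of_tuple t))%:E)) => //.
  - move=> k; have [_ + _] := qP k => /dominated_integrable.
    exact: measurable_int.
  - move=> t _; apply: cvg_EFin; first exact: nearW.
    exact: (cvg_comp _ _ qp (cF (rv_of_tuple t))).
  - exact: integrable_wgt.
  - by move=> k t _; rewrite /= lee_fin; have [_ [_ +] _] := qP k; exact.
move/cvgrPdist_lt => /(_ _ e0) [N _ /(_ N (leqnn N))] /=.
by have [_ _ +] := qP N; rewrite leNgt => /negP.
Unshelve. all: by end_near. Qed.

(** Stated at the parameter 0 only, as [is_derive_line] brings every other point and direction
    there. *)
Lemma rint_derive n (F F' : R -> 'rV[R]_n -> R) (C : R) :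
  (forall s, `|s| < 1 -> dominated C (F s)) ->
  (forall (s : R) x, `|s| < 1 -> is_derive s (1 : R) (F^~ x) (F' s x)) ->
  (forall s x, `|s| < 1 -> `|F' s x| <= C * wgt x) ->
  is_derive (0 : R) (1 : R) (fun s => rint (F s)) (rint (F' 0)).
Proof.
move=> dF derF F'C.
have I1 (s : R) : `]-1, 1[%classic s -> `|s| < 1.
  by rewrite /= in_itv/= ltr_norml.
have I0 : `]-1, 1[%classic (0 : R) by rewrite /= in_itv/= ltrN10 ltr01.
have C0 : 0 <= C.
  have [_ /(_ 0)] := dF 0 (I1 _ I0).
  by move=> /(le_trans (normr_ge0 _)); rewrite pmulr_lge0// wgt_gt0.
have pE s x : `|s| < 1 -> partial1of2 F s x = F' s x.
  by move=> s1; rewrite partial1of2E; have [_ ->] := derF s x s1.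
have pE' s x : `|s| < 1 ->
  partial1of2 (fun s (t : n.-tuple mR) => F s (rv_of_tuple t)) s x = F' s (rv_of_tuple x).
  by move=> s1; rewrite partial1of2E; have [_ ->] := derF s (rv_of_tuple x) s1.
have H := @cvg_differentiation_under_integral R _ _ (lebesgue_tuple R n)
  (fun s t => F s (rv_of_tuple t)) setT measurableT 0 (-1) 1 I0
  (fun s sI => dominated_integrable (dF s (I1 s sI)))
  (fun s y sI _ => @ex_derive _ _ _ _ _ _ _ (derF s (rv_of_tuple y) (I1 s sI)))
  (fun t => C * wgt (rv_of_tuple t))
  (fun t => mulr_ge0 C0 (ltW (wgt_gt0 _)))
  (integrable_wgt n C)
  (fun s y sI _ => ltac:(rewrite pE'; [exact: F'C (I1 s sI)|exact: I1])).
have {}H : h^-1 *: (rint (F (h + 0)) - rint (F 0)) @[h --> 0^'] --> rint (F' 0).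
  have E : (\int[lebesgue_tuple R n]_t partial1of2
      (fun s (t : n.-tuple mR) => F s (rv_of_tuple t)) 0 t)%R = rint (F' 0).
    by apply: eq_Rintegral => t _; rewrite pE'// normr0.
  by move: H; rewrite E.
have {}H : h^-1 *: (((fun s => rint (F s)) \o shift (0 : R)) (h *: (1 : R)) - rint (F 0))
    @[h --> 0^'] --> rint (F' 0).
  by under eq_fun do rewrite /= scaler1.
split; first by apply/cvg_ex; exists (rint (F' 0)).
exact: cvg_lim H.
Qed.

Lemma rint_fubini n m (C : R) (F : 'rV[R]_n * 'rV[R]_m -> R) : continuous F ->
  (forall x y, `|F (x, y)| <= C * wgt x * wgt y) ->
  rint (fun x => rint (fun y => F (x, y))) =
  rint (fun y => rint (fun x => F (x, y))).
Proof.
move=> cF FC.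
have mF := continuous_measurable_rv2 cF.
pose f := fun t : n.-tuple mR * m.-tuple mR =>
  (F (rv_of_tuple t.1, rv_of_tuple t.2))%:E.
have C0 : 0 <= C.
  have := FC 0 0; rewrite -mulrA => /(le_trans (normr_ge0 _)).
  by rewrite pmulr_lge0// mulr_gt0// wgt_gt0.
have cwgt k : measurable_fun setT (fun t : k.-tuple mR => wgt (rv_of_tuple t)).
  by apply: continuous_measurable_rv; exact: continuous_wgt.
have cwgtE k : measurable_fun setT (fun t : k.-tuple mR => (wgt (rv_of_tuple t))%:E).
  by apply/measurable_EFinP; exact: cwgt.
have w0 k (t : k.-tuple mR) : 0 <= wgt (rv_of_tuple t) by exact: ltW (wgt_gt0 _).
(* Tonelli: the inner integral of the absolute value is at most [C * wgt x * pi ^+ m], which is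
   integrable in x. *)
have If : (lebesgue_tuple R n \x lebesgue_tuple R m)%E.-integrable setT f.
  apply/integrable12ltyP; first exact/measurable_EFinP.
  apply: (@le_lt_trans _ _ (\int[lebesgue_tuple R n]_x
     ((C * wgt (rv_of_tuple x))%:E * (pi ^+ m)%:E))%E).
    apply: ge0_le_integral => //.
    - by move=> x _; exact: integral_ge0.
    - apply: (measurable_fun_fubini_tonelli_F (m2 := lebesgue_tuple R m)
        (fun t => `|f t|%E)) => //.
      by apply: measurableT_comp => //; exact/measurable_EFinP.
    - apply: emeasurable_funM => //; apply/measurable_EFinP.
      by apply: measurable_funM => //; exact: cwgt.
    - move=> x _; rewrite -integral_wgt -ge0_integralZl//=; first last.
      + by rewrite lee_fin mulr_ge0.
      + by move=> t _; rewrite lee_fin.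
      + exact: cwgtE.
      apply: ge0_le_integral => //=.
      + apply/measurable_EFinP; apply: measurableT_comp => //.
        apply: (continuous_measurable_rv (f := fun y => F (rv_of_tuple x, y))).
        move=> y; apply: (continuous_comp (f := fun y => (rv_of_tuple x, y)) (g := F)); last exact: cF.
        exact: continuous_pairr.
      + by apply: emeasurable_funM => //; exact: cwgtE.
      + by move=> t _; rewrite -EFinM lee_fin.
  rewrite ge0_integralZr//; first last.
  - by rewrite lee_fin exprn_ge0// pi_ge0.
  - by move=> t _; rewrite lee_fin mulr_ge0.
  - by apply/measurable_EFinP; apply: measurable_funM => //; exact: cwgt.
  under eq_integral do rewrite EFinM.
  rewrite ge0_integralZl//; first last.
  - by move=> t _; rewrite lee_fin.
  - exact: cwgtE.
  by rewrite integral_wgt -!EFinM ltry.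
have fin1 x : (\int[lebesgue_tuple R m]_y f (x, y))%E =
    (rint (fun y => F (rv_of_tuple x, y)))%:E.
  rewrite /rint /Rintegral fineK//; apply: integrable_fin_num => //.
  apply: (@dominated_integrable _ (C * wgt (rv_of_tuple x)) (fun y => F (rv_of_tuple x, y))).
  split => [y|y]; last exact: FC.
  apply: (continuous_comp (f := fun y => (rv_of_tuple x, y)) (g := F)); last exact: cF.
  exact: continuous_pairr.
have fin2 y : (\int[lebesgue_tuple R n]_x f (x, y))%E =
    (rint (fun x => F (x, rv_of_tuple y)))%:E.
  rewrite /rint /Rintegral fineK//; apply: integrable_fin_num => //.
  apply: (@dominated_integrable _ (C * wgt (rv_of_tuple y)) (fun x => F (x, rv_of_tuple y))).
  split => [x|x]; last by rewrite mulrAC; exact: FC.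
  apply: (continuous_comp (f := fun x => (x, rv_of_tuple y)) (g := F)); last exact: cF.
  exact: continuous_pairl.
rewrite {1}/rint [RHS]/rint /Rintegral.
congr fine; under eq_integral do rewrite -fin1; under [RHS]eq_integral do rewrite -fin2.
exact: Fubini.
Qed.

End real_integral.

(** * Complex-valued functions *)

Section complex_calculus.
Context {R : realType}.
Local Notation Re := (@complex.Re R).
Local Notation Im := (@complex.Im R).
Local Notation C := R[i].
Local Notation bas := (@Defs.basis R _).

Lemma ReD (z w : C) : Re (z + w) = Re z + Re w. Proof. by case: z w => ? ? []. Qed.
Lemma ImD (z w : C) : Im (z + w) = Im z + Im w. Proof. by case: z w => ? ? []. Qed.
Lemma ReN (z : C) : Re (- z) = - Re z. Proof. by case: z. Qed.
Lemma ImN (z : C) : Im (- z) = - Im z. Proof. by case: z. Qed.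
Lemma ReM (z w : C) : Re (z * w) = Re z * Re w - Im z * Im w.
Proof. by case: z w => ? ? []. Qed.
Lemma ImM (z w : C) : Im (z * w) = Re z * Im w + Im z * Re w.
Proof. by case: z w => ? ? []. Qed.
Lemma ReIm_eq (z w : C) : Re z = Re w -> Im z = Im w -> z = w.
Proof. by case: z w => ? ? [? ?] /= -> ->. Qed.
Lemma ReR (x : R) : Re x%:C = x. Proof. by []. Qed.
Lemma ImR (x : R) : Im x%:C = 0. Proof. by []. Qed.

Lemma normc_ge0 (z : C) : 0 <= normc z.
Proof. by case: z => a b; rewrite /normc sqrtr_ge0. Qed.

Lemma Re_le_normc (z : C) : `|Re z| <= normc z.
Proof.
case: z => a b /=; rewrite -sqrtr_sqr ler_wsqrtr//.
by rewrite lerDl sqr_ge0.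
Qed.

Lemma Im_le_normc (z : C) : `|Im z| <= normc z.
Proof.
case: z => a b /=; rewrite -sqrtr_sqr ler_wsqrtr//.
by rewrite lerDr sqr_ge0.
Qed.

Lemma normc_le_ReIm (z : C) : normc z <= `|Re z| + `|Im z|.
Proof.
case: z => a b /=; rewrite -[leRHS]ger0_norm ?addr_ge0//.
rewrite -sqrtr_sqr ler_wsqrtr// sqrrD !real_normK ?num_real//.
by rewrite addrAC lerDl mulrn_wge0// mulr_ge0.
Qed.

Lemma normcD (z w : C) : normc (z + w) <= normc z + normc w.
Proof. exact: le_normcD. Qed.

Lemma normcR (x : R) : normc x%:C = `|x|.
Proof. by rewrite /= expr0n/= addr0 sqrtr_sqr. Qed.

Lemma normcN (z : C) : normc (- z) = normc z.
Proof. by case: z => a b /=; rewrite !sqrrN. Qed.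

Lemma normc_sum (I : Type) (r : seq I) (P : pred I) (F : I -> C) :
  normc (\sum_(i <- r | P i) F i) <= \sum_(i <- r | P i) normc (F i).
Proof.
elim/big_ind2 : _ => [|z x w y zx wy|//]; first by rewrite /= expr0n/= addr0 sqrtr0.
by rewrite (le_trans (normcD _ _))// lerD.
Qed.

Definition ccont (T : topologicalType) (f : T -> C) (x : T) :=
  {for x, continuous (fun y => Re (f y))} /\
  {for x, continuous (fun y => Im (f y))}.

Section ccont_lemmas.
Variables (T : topologicalType) (x : T).
Implicit Types f g : T -> C.

Lemma ccont_cst (c : C) : ccont (fun _ : T => c) x.
Proof. by split; exact: continuous_for_cst. Qed.

Lemma eq_ccont f g : f =1 g -> ccont f x -> ccont g x.
Proof. by move=> /funext ->. Qed.

Lemma ccontR (f : T -> R) : {for x, continuous f} -> ccont (fun y => (f y)%:C) x.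
Proof. by move=> cf; split => //; exact: continuous_for_cst. Qed.

Lemma ccontD f g : ccont f x -> ccont g x -> ccont (fun y => f y + g y) x.
Proof.
move=> [f1 f2] [g1 g2]; split.
- by apply: eq_continuous_at (continuousD f1 g1) => y; rewrite ReD.
- by apply: eq_continuous_at (continuousD f2 g2) => y; rewrite ImD.
Qed.

Lemma ccontN f : ccont f x -> ccont (fun y => - f y) x.
Proof.
move=> [f1 f2]; split.
- by apply: eq_continuous_at (continuousN f1) => y; rewrite ReN.
- by apply: eq_continuous_at (continuousN f2) => y; rewrite ImN.
Qed.

Lemma ccontB f g : ccont f x -> ccont g x -> ccont (fun y => f y - g y) x.
Proof. by move=> cf cg; apply: ccontD => //; exact: ccontN. Qed.

Lemma ccontM f g : ccont f x -> ccont g x -> ccont (fun y => f y * g y) x.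
Proof.
move=> [f1 f2] [g1 g2]; split.
- apply: eq_continuous_at (continuousB (continuousM f1 g1) (continuousM f2 g2)) => y.
  by rewrite ReM.
- apply: eq_continuous_at (continuousD (continuousM f1 g2) (continuousM f2 g1)) => y.
  by rewrite ImM.
Qed.

Lemma ccont_sum (I : Type) (r : seq I) (F : I -> T -> C) :
  (forall i, ccont (F i) x) -> ccont (fun y => \sum_(i <- r) F i y) x.
Proof.
move=> cF; elim: r => [|i r IH].
  by apply: eq_ccont (ccont_cst 0) => y; rewrite big_nil.
by apply: eq_ccont (ccontD (cF i) IH) => y; rewrite big_cons.
Qed.

Lemma ccont_comp (U : topologicalType) (h : U -> C) (g : T -> U) :
  {for x, continuous g} -> ccont h (g x) -> ccont (fun y => h (g y)) x.
Proof.
move=> cg [h1 h2]; split.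
- exact: (continuous_for_comp cg h1).
- exact: (continuous_for_comp cg h2).
Qed.

End ccont_lemmas.

Section is_cder.
Variables (V : normedModType R).
Implicit Types (f g : V -> C) (x v : V) (c d : C).

(** A relation rather than the total function [cderive], so that it carries existence together with
    the value. *)
Definition is_cder v f x d :=
  is_derive x v (fun y => Re (f y)) (Re d) /\
  is_derive x v (fun y => Im (f y)) (Im d).

Lemma is_cder_cderive v f x d : is_cder v f x d -> cderive v f x = d.
Proof. by move=> [[_ h1] [_ h2]]; rewrite /cderive h1 h2; case: d {h1 h2}. Qed.

Lemma is_cderP v f x :
  derivable (fun y => Re (f y)) x v -> derivable (fun y => Im (f y)) x v ->
  is_cder v f x (cderive v f x).
Proof. by move=> h1 h2; split; exact: DeriveDef. Qed.

Lemma is_cder_derivable v f x d : is_cder v f x d ->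
  derivable (fun y => Re (f y)) x v /\ derivable (fun y => Im (f y)) x v.
Proof. by move=> [[? _] [? _]]. Qed.

Lemma eq_is_cder v f g x d e : f =1 g -> d = e -> is_cder v f x d -> is_cder v g x e.
Proof. by move=> /funext -> ->. Qed.

Lemma is_cder_cst v c x : is_cder v (fun=> c) x 0.
Proof. by split; exact: is_derive_cst. Qed.

Lemma is_cderD v f g x d e : is_cder v f x d -> is_cder v g x e ->
  is_cder v (fun y => f y + g y) x (d + e).
Proof.
move=> [f1 f2] [g1 g2]; split; rewrite ?ReD ?ImD.
- under eq_fun do rewrite ReD; exact: is_deriveD.
- under eq_fun do rewrite ImD; exact: is_deriveD.
Qed.

Lemma is_cderN v f x d : is_cder v f x d -> is_cder v (fun y => - f y) x (- d).
Proof.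
move=> [f1 f2]; split; rewrite ?ReN ?ImN.
- under eq_fun do rewrite ReN; exact: is_deriveN.
- under eq_fun do rewrite ImN; exact: is_deriveN.
Qed.

Lemma is_cderB v f g x d e : is_cder v f x d -> is_cder v g x e ->
  is_cder v (fun y => f y - g y) x (d - e).
Proof. by move=> h1 h2; apply: is_cderD => //; exact: is_cderN. Qed.

Lemma is_cderM v f g x d e : is_cder v f x d -> is_cder v g x e ->
  is_cder v (fun y => f y * g y) x (d * g x + f x * e).
Proof.
move=> [f1 f2] [g1 g2]; split; rewrite ?ReD ?ImD ?ReM ?ImM.
- under eq_fun do rewrite ReM.
  apply: is_derive_eq; rewrite /GRing.scale/=; ring.
- under eq_fun do rewrite ImM.
  apply: is_derive_eq; rewrite /GRing.scale/=; ring.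
Qed.

Lemma is_cderZ v c f x d : is_cder v f x d -> is_cder v (fun y => c * f y) x (c * d).
Proof.
move=> h; apply: eq_is_cder (is_cderM (is_cder_cst v c x) h) => //.
by rewrite mul0r add0r.
Qed.

Lemma is_cder_sum v (I : Type) (r : seq I) (F : I -> V -> C) (D : I -> C) x :
  (forall i, is_cder v (F i) x (D i)) ->
  is_cder v (fun y => \sum_(i <- r) F i y) x (\sum_(i <- r) D i).
Proof.
move=> H; elim: r => [|i r IH].
  rewrite big_nil; apply: eq_is_cder (is_cder_cst v 0 x) => // y.
  by rewrite big_nil.
rewrite big_cons; apply: eq_is_cder (is_cderD (H i) IH) => // y.
by rewrite big_cons.
Qed.

(** Reduces directional derivatives to functions of one real variable, where the chain rule, the
    mean value theorem and differentiation under the integral sign apply. *)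
Lemma is_derive_line (f : V -> R) x v (d : R) :
  is_derive (0 : R) (1 : R) (fun s : R => f (x + s *: v)) d <-> is_derive x v f d.
Proof.
have E : (fun h : R => h^-1 *: (((fun s : R => f (x + s *: v)) \o shift (0 : R)) (h *: (1 : R))
     - f (x + 0 *: v))) =
   (fun h : R => h^-1 *: ((f \o shift x) (h *: v) - f x)).
  apply/funext => h /=; rewrite scaler1 addr0 scale0r addr0.
  by rewrite [h *: v + x]addrC.
split => -[h1 h2]; split.
- by move: h1; rewrite /derivable E.
- by rewrite -h2 /derive E.
- by rewrite /derivable E.
- by rewrite -h2 /derive E.
Qed.

End is_cder.

Lemma is_cder_line (V : normedModType R) (v : V) f x d :
  is_cder (1 : R) (fun s : R => f (x + s *: v)) (0 : R) d <-> is_cder v f x d.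
Proof. by split => -[h1 h2]; split; apply/is_derive_line. Qed.

Lemma is_cder_line_at (V : normedModType R) (v : V) f x (s : R) d :
  is_cder v f (x + s *: v) d -> is_cder (1 : R) (fun s : R => f (x + s *: v)) s d.
Proof.
move=> /is_cder_line H; apply/is_cder_line; apply: eq_is_cder H => // u.
by rewrite -addrA -scalerDl scaler1.
Qed.

Lemma is_cder_comp (f : R -> C) (g : R -> R) (s : R) d (e : R) :
  is_cder (1 : R) f (g s) d -> is_derive s (1 : R) g e ->
  is_cder (1 : R) (fun u => f (g u)) s (d * e%:C).
Proof.
move=> [h1 h2] hg; split.
- rewrite ReM ReR ImR mulr0 subr0.
  exact: (@is_derive1_comp _ (fun y => Re (f y)) g s _ _ h1 hg).
- rewrite ImM ReR ImR mulr0 add0r.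
  exact: (@is_derive1_comp _ (fun y => Im (f y)) g s _ _ h2 hg).
Qed.

Lemma is_cderR (V : normedModType R) (v x : V) (f : V -> R) (d : R) :
  is_derive x v f d -> is_cder v (fun y => (f y)%:C) x d%:C.
Proof. by move=> h; split => //=; exact: is_derive_cst. Qed.

Definition expi (x : R) : C := cos x +i* sin x.

Lemma expiD x y : expi (x + y) = expi x * expi y.
Proof.
by apply: ReIm_eq; rewrite ?ReM ?ImM/= ?cosD ?sinD// addrC.
Qed.

Lemma expi0 : expi 0 = 1.
Proof. by rewrite /expi cos0 sin0. Qed.

Lemma normc_expi x : normc (expi x) = 1.
Proof. by rewrite /normc/= cos2Dsin2 sqrtr1. Qed.

Lemma is_cder_expi (s : R) : is_cder (1 : R) expi s ('i * expi s).
Proof.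
split; rewrite ?ReM ?ImM/= !mul0r !mul1r ?sub0r ?addr0 ?add0r.
- exact: is_derive_cos.
- exact: is_derive_sin.
Qed.

Lemma ccont_expi (s : R) : ccont expi s.
Proof. by split; [exact: continuous_cos|exact: continuous_sin]. Qed.

Lemma ccont_for_comp_fst (S T : topologicalType) (f : S -> C) (p : S * T) :
  ccont f p.1 -> ccont (fun q : S * T => f q.1) p.
Proof. by apply: ccont_comp; exact: cvg_fst. Qed.

Lemma ccont_for_comp_snd (S T : topologicalType) (f : T -> C) (p : S * T) :
  ccont f p.2 -> ccont (fun q : S * T => f q.2) p.
Proof. by apply: ccont_comp; exact: cvg_snd. Qed.

Section cint.
Variable n : nat.
Implicit Types (f g : 'rV[R]_n -> C) (K : R).

Definition cint f : C := rint (fun x => Re (f x)) +i* rint (fun x => Im (f x)).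

Lemma integral_RnT f : integral_Rn setT f = cint f.
Proof. by rewrite /integral_Rn preimage_setT. Qed.

Definition cdom K f := (forall x, ccont f x) /\ forall x, normc (f x) <= K * wgt x.

Lemma eq_cint f g : f =1 g -> cint f = cint g.
Proof. by move=> /funext ->. Qed.

Lemma cdom_Re K f : cdom K f -> dominated K (fun x => Re (f x)).
Proof.
move=> [cf fK]; split => x; first by case: (cf x).
exact: le_trans (Re_le_normc _) (fK x).
Qed.

Lemma cdom_Im K f : cdom K f -> dominated K (fun x => Im (f x)).
Proof.
move=> [cf fK]; split => x; first by case: (cf x).
exact: le_trans (Im_le_normc _) (fK x).
Qed.

Lemma cdom_ge0 K f : cdom K f -> 0 <= K.
Proof.
move=> [_ /(_ 0)] /(le_trans (normc_ge0 _)).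
by rewrite pmulr_lge0// wgt_gt0.
Qed.

Lemma cdomW K K' f : K <= K' -> cdom K f -> cdom K' f.
Proof.
move=> KK' [cf fK]; split => // x; rewrite (le_trans (fK x))//.
by rewrite ler_wpM2r// ltW// wgt_gt0.
Qed.

Lemma cdomD K L f g : cdom K f -> cdom L g -> cdom (K + L) (fun x => f x + g x).
Proof.
move=> [cf fK] [cg gL]; split => x; first exact: ccontD.
by rewrite mulrDl (le_trans (normcD _ _))// lerD.
Qed.

Lemma cdomZ K c f : cdom K f -> cdom (normc c * K) (fun x => c * f x).
Proof.
move=> [cf fK]; split => x; first by apply: ccontM => //; exact: ccont_cst.
by rewrite normcM -mulrA ler_wpM2l// normc_ge0.
Qed.

Lemma cdom0 : cdom 0 (fun=> 0).
Proof.
by split=> x; [exact: ccont_cst|rewrite mul0r /= expr0n/= addr0 sqrtr0].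
Qed.

Lemma cintD K L f g : cdom K f -> cdom L g ->
  cint (fun x => f x + g x) = cint f + cint g.
Proof.
move=> df dg; apply: ReIm_eq; rewrite ?ReD ?ImD /=.
- by under eq_fun do rewrite ReD; exact: rintD (cdom_Re df) (cdom_Re dg).
- by under eq_fun do rewrite ImD; exact: rintD (cdom_Im df) (cdom_Im dg).
Qed.

Lemma dominatedZ K k (f : 'rV[R]_n -> R) : dominated K f ->
  dominated (`|k| * K) (fun x => k * f x).
Proof.
move=> [cf fK]; split => x; last by rewrite normrM -mulrA ler_wpM2l.
by apply: (continuousM (@continuous_for_cst _ _ k x)); exact: cf.
Qed.

Lemma cintZ K c f : cdom K f -> cint (fun x => c * f x) = c * cint f.
Proof.
move=> df; have dr := cdom_Re df; have di := cdom_Im df.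
apply: ReIm_eq; rewrite ?ReM ?ImM /=.
- under eq_fun do rewrite ReM.
  rewrite (rintB (dominatedZ _ dr) (dominatedZ _ di)).
  by rewrite (rintZ _ dr) (rintZ _ di).
- under eq_fun do rewrite ImM.
  rewrite (rintD (dominatedZ _ di) (dominatedZ _ dr)).
  by rewrite (rintZ _ dr) (rintZ _ di).
Qed.

Lemma cint0 : cint (fun=> 0) = 0.
Proof.
rewrite -[RHS](mul0r (cint (fun=> 0))) -(cintZ 0 cdom0).
by apply: eq_cint => x; rewrite mul0r.
Qed.

Lemma cdom_sum (I : Type) (r : seq I) (F : I -> 'rV[R]_n -> C) (K : I -> R) :
  (forall i, cdom (K i) (F i)) ->
  cdom (\sum_(i <- r) K i) (fun x => \sum_(i <- r) F i x).
Proof.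
move=> H; elim: r => [|i r IH].
  rewrite big_nil; under eq_fun do rewrite big_nil; exact: cdom0.
rewrite big_cons (_ : (fun x => _) = fun x => F i x + \sum_(i <- r) F i x).
  exact: cdomD.
by apply/funext => x; rewrite big_cons.
Qed.

Lemma cint_sum (I : Type) (r : seq I) (F : I -> 'rV[R]_n -> C) (K : I -> R) :
  (forall i, cdom (K i) (F i)) ->
  cint (fun x => \sum_(i <- r) F i x) = \sum_(i <- r) cint (F i).
Proof.
move=> H; elim: r => [|i r IH].
  by rewrite big_nil; under eq_cint do rewrite big_nil; exact: cint0.
rewrite big_cons -IH -(cintD (H i) (cdom_sum r H)).
by apply: eq_cint => x; rewrite big_cons.
Qed.

(** The factor 2 comes from bounding real and imaginary parts separately. *)
Lemma cint_le K f : cdom K f -> normc (cint f) <= 2 * (K * pi ^+ n).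
Proof.
move=> df; rewrite (le_trans (normc_le_ReIm _))// mulr_natl mulr2n lerD//.
- exact: rint_le (cdom_Re df).
- exact: rint_le (cdom_Im df).
Qed.

Lemma cint_shift v f : (forall x, ccont f x) -> cint (fun x => f (x + v)) = cint f.
Proof.
move=> cf; rewrite /cint; congr (_ +i* _).
- by apply: (@rint_shift _ _ v (fun x => Re (f x))) => x; case: (cf x).
- by apply: (@rint_shift _ _ v (fun x => Im (f x))) => x; case: (cf x).
Qed.

Lemma cint_scale K (e : R) f : 0 < e -> cdom K (fun x => f (e *: x)) ->
  (forall x, ccont f x) -> (e ^+ n)%:C * cint (fun x => f (e *: x)) = cint f.
Proof.
move=> e0 df cf; apply: ReIm_eq; rewrite ?ReM ?ImM ReR ImR mul0r ?subr0 ?addr0 /=.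
- by apply: (rint_scale (f := fun x => Re (f x)) e0 (cdom_Re df)) => x; case: (cf x).
- by apply: (rint_scale (f := fun x => Im (f x)) e0 (cdom_Im df)) => x; case: (cf x).
Qed.

Lemma cint_tmap f : (forall x, ccont f x) ->
  integral_G (fun x => f (tmap x)) = cint f.
Proof.
move=> cf; rewrite /integral_G /integral_Rn /cint; congr (_ +i* _).
- rewrite -(rint_tmap (f := fun x => Re (f x))); last by move=> x; case: (cf x).
  apply: eq_Rintegral => t _; set P := \prod_(j < n) _.
  by rewrite -fmorphV /= ReM ReR ImR mulr0 subr0.
- rewrite -(rint_tmap (f := fun x => Im (f x))); last by move=> x; case: (cf x).
  apply: eq_Rintegral => t _; set P := \prod_(j < n) _.
  by rewrite -fmorphV /= ImM ReR ImR mulr0 add0r.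
Qed.

Lemma cint_continuous (T : pseudoMetricType R) (F : T -> 'rV[R]_n -> C) (p : T) K :
  (\forall q \near p, cdom K (F q)) -> (forall x, ccont (F^~ x) p) ->
  ccont (fun q => cint (F q)) p.
Proof.
move=> dF cF; split.
- apply: (rint_continuous (F := fun q x => Re (F q x)) (C := K)).
    by apply: filterS dF => q /cdom_Re.
  by move=> x; case: (cF x).
- apply: (rint_continuous (F := fun q x => Im (F q x)) (C := K)).
    by apply: filterS dF => q /cdom_Im.
  by move=> x; case: (cF x).
Qed.

Lemma cint_derive (F F' : R -> 'rV[R]_n -> C) K :
  (forall s, `|s| < 1 -> cdom K (F s)) ->
  (forall (s : R) x, `|s| < 1 -> is_cder (1 : R) (F^~ x) s (F' s x)) ->
  (forall s x, `|s| < 1 -> normc (F' s x) <= K * wgt x) ->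
  is_cder (1 : R) (fun s => cint (F s)) (0 : R) (cint (F' 0)).
Proof.
move=> dF derF F'K; split.
- apply: (rint_derive (F := fun q x => Re (F q x)) (F' := fun q x => Re (F' q x)) (C := K)).
  + by move=> s /dF/cdom_Re.
  + by move=> s x s1; case: (derF s x s1).
  + by move=> s x s1; exact: le_trans (Re_le_normc _) (F'K s x s1).
- apply: (rint_derive (F := fun q x => Im (F q x)) (F' := fun q x => Im (F' q x)) (C := K)).
  + by move=> s /dF/cdom_Im.
  + by move=> s x s1; case: (derF s x s1).
  + by move=> s x s1; exact: le_trans (Im_le_normc _) (F'K s x s1).
Qed.

End cint.

Lemma cint_fubini n m (K : R) (F : 'rV[R]_n * 'rV[R]_m -> C) :
  (forall p, ccont F p) ->
  (forall x y, normc (F (x, y)) <= K * wgt x * wgt y) ->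
  cint (fun x => cint (fun y => F (x, y))) = cint (fun y => cint (fun x => F (x, y))).
Proof.
move=> cF FK; rewrite /cint /=; congr (_ +i* _).
- apply: (rint_fubini (F := fun p => Re (F p)) (C := K)).
    by move=> p; case: (cF p).
  by move=> x y; exact: le_trans (Re_le_normc _) (FK x y).
- apply: (rint_fubini (F := fun p => Im (F p)) (C := K)).
    by move=> p; case: (cF p).
  by move=> x y; exact: le_trans (Im_le_normc _) (FK x y).
Qed.

(** Peetre's inequality in each coordinate: [1 + x^2 <= 2 (1 + v^2) (1 + (x + v)^2)]. *)
Lemma wgt_shift n (x v : 'rV[R]_n) :
  wgt (x + v) <= \prod_(j < n) (2 * (1 + v 0 j ^+ 2)) * wgt x.
Proof.
rewrite /wgt -big_split/=; apply: ler_prod => j _.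
rewrite invr_ge0 addr_ge0 ?sqr_ge0//= mxE.
rewrite -(ler_pM2r (_ : 0 < 1 + x 0 j ^+ 2)); last by rewrite ltr_pwDl// sqr_ge0.
rewrite mulfVK; last by rewrite gt_eqF// ltr_pwDl// sqr_ge0.
rewrite mulrC ler_pdivrMr; last by rewrite ltr_pwDl// sqr_ge0.
(* The difference of the two sides is [1 + (x + 2 v)^2 + 2 v^2 (x + v)^2]. *)
have := sqr_ge0 (x 0 j + 2 * v 0 j); have := sqr_ge0 (v 0 j).
have : 0 <= v 0 j ^+ 2 * (x 0 j + v 0 j) ^+ 2 by rewrite mulr_ge0// sqr_ge0.
by nra.
Qed.

(** By translation invariance the integral of [x |-> f (x + s e_j)] does not depend on s, and its
    derivative at s = 0 is the integral of [f']. *)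
Lemma cint_ibp n (j : 'I_n) (K : R) (f f' : 'rV[R]_n -> C) :
  cdom K f -> cdom K f' -> (forall x, is_cder (bas j) f x (f' x)) ->
  cint f' = 0.
Proof.
move=> df df' der.
have K0 := cdom_ge0 df.
(* Each of the n factors [2 * (1 + v_j ^+ 2)] of [wgt_shift] is at most 4 when [|s| < 1]. *)
have wE s (x : 'rV[R]_n) : `|s| < 1 -> wgt (x + s *: bas j) <= 4 ^+ n * wgt x.
  move=> s1; rewrite (le_trans (wgt_shift _ _))// ler_wpM2r ?(ltW (wgt_gt0 _))//.
  rewrite -[X in 4 ^+ X]card_ord -prodr_const; apply: ler_prod => i _.
  rewrite mulr_ge0 ?addr_ge0 ?sqr_ge0//= !mxE eqxx/=.
  have : s ^+ 2 <= 1 by rewrite -(ler_sqrt _ _)// sqrtr1 sqrtr_sqr ltW.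
  by case: (i == j); rewrite ?mulr1 ?mulr0 ?expr0n/=; lra.
have cs (g : 'rV[R]_n -> C) s : (forall x, ccont g x) ->
    forall x, ccont (fun x : 'rV[R]_n => g (x + s *: bas j)) x.
  move=> cg x; apply: (ccont_comp (h := g) (g := fun x : 'rV[R]_n => x + s *: bas j)); last exact: cg.
  exact: (continuousD (@continuous_for_id _ x) (@continuous_for_cst _ _ _ x)).
have H := @cint_derive n (fun s x => f (x + s *: bas j))
  (fun s x => f' (x + s *: bas j)) (K * 4 ^+ n).
have {}H : is_cder (1 : R) (fun s => cint (fun x => f (x + s *: bas j))) (0 : R)
    (cint (fun x => f' (x + 0 *: bas j))).
  apply: H.
  - move=> s s1; split; first by apply: cs; case: df.
    move=> x; rewrite (le_trans (df.2 _))// -mulrA ler_wpM2l//; exact: wE.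
  - by move=> s x _; apply: is_cder_line_at; exact: der.
  - move=> s x s1; rewrite (le_trans (df'.2 _))// -mulrA ler_wpM2l//; exact: wE.
rewrite (_ : cint f' = cint (fun x => f' (x + 0 *: bas j))); last first.
  by apply: eq_cint => x; rewrite scale0r addr0.
rewrite -(is_cder_cderive H); apply: is_cder_cderive.
apply: (eq_is_cder (f := fun=> cint f)) (is_cder_cst _ _ _) => // s.
by rewrite (cint_shift (s *: bas j))//; case: df.
Qed.

Definition dot n (x y : 'rV[R]_n) : R := \sum_(j < n) x 0 j * y 0 j.

Lemma dotDl n (x y z : 'rV[R]_n) : dot (x + y) z = dot x z + dot y z.
Proof.
by rewrite /dot -big_split; apply: eq_bigr => j _; rewrite mxE mulrDl.
Qed.

Lemma dotDr n (x y z : 'rV[R]_n) : dot x (y + z) = dot x y + dot x z.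
Proof.
by rewrite /dot -big_split; apply: eq_bigr => j _; rewrite mxE mulrDr.
Qed.

Lemma dotZr n a (x y : 'rV[R]_n) : dot x (a *: y) = a * dot x y.
Proof. by rewrite /dot mulr_sumr; apply: eq_bigr => j _; rewrite mxE mulrCA. Qed.

Lemma dotC n (x y : 'rV[R]_n) : dot x y = dot y x.
Proof. by apply: eq_bigr => j _; rewrite mulrC. Qed.

Lemma dotZl n a (x y : 'rV[R]_n) : dot (a *: x) y = a * dot x y.
Proof. by rewrite dotC dotZr dotC. Qed.

Lemma dot_basis n (x : 'rV[R]_n) j : dot x (bas j) = x 0 j.
Proof.
rewrite /dot (bigD1 j)//= !mxE !eqxx/= mulr1 big1 ?addr0// => i ij.
by rewrite !mxE (negbTE ij) andbF mulr0.
Qed.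

Lemma dot0l n (x : 'rV[R]_n) : dot 0 x = 0.
Proof. by rewrite /dot big1// => j _; rewrite mxE mul0r. Qed.

Lemma continuous_sum (T : topologicalType) (I : Type) (r : seq I)
    (F : I -> T -> R) (x : T) : (forall i, {for x, continuous (F i)}) ->
  {for x, continuous (fun y => \sum_(i <- r) F i y)}.
Proof.
move=> cF; elim: r => [|i r IH].
  by apply: eq_continuous_at (@continuous_for_cst _ _ (0 : R) x) => y; rewrite big_nil.
by apply: eq_continuous_at (continuousD (cF i) IH) => y; rewrite big_cons.
Qed.

Lemma continuous_coord (T : topologicalType) n (f : T -> 'rV[R]_n) j x :
  {for x, continuous f} -> {for x, continuous (fun y => f y 0 j)}.
Proof.
move=> cf; apply: (continuous_for_comp (f := fun u : 'rV[R]_n => u 0 j)) => //.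
exact: coord_continuous.
Qed.

Lemma continuous_dot (T : topologicalType) n (f g : T -> 'rV[R]_n) x :
  {for x, continuous f} -> {for x, continuous g} ->
  {for x, continuous (fun y => dot (f y) (g y))}.
Proof.
move=> cf cg; apply: continuous_sum => j.
by apply: (@continuousM _ _ (fun y => f y 0 j) (fun y => g y 0 j));
  exact: continuous_coord.
Qed.

(** The parameter [k] allows for both signs of the Fourier kernel, [2 * pi] and [m2pi]; the value 0
    gives the trivial character. *)
Definition chr (k : R) n (x y : 'rV[R]_n) : C := expi (k * dot x y).

Lemma normc_chr k n (x y : 'rV[R]_n) : normc (chr k x y) = 1.
Proof. exact: normc_expi. Qed.

Lemma chrC k n (x y : 'rV[R]_n) : chr k x y = chr k y x.
Proof. by rewrite /chr dotC. Qed.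

Lemma chrDl k n (x y z : 'rV[R]_n) : chr k (x + y) z = chr k x z * chr k y z.
Proof. by rewrite /chr dotDl mulrDr expiD. Qed.

Lemma chrDr k n (x y z : 'rV[R]_n) : chr k x (y + z) = chr k x y * chr k x z.
Proof. by rewrite /chr dotDr mulrDr expiD. Qed.

Lemma ccont_chr (T : topologicalType) k n (f g : T -> 'rV[R]_n) x :
  {for x, continuous f} -> {for x, continuous g} ->
  ccont (fun y => chr k (f y) (g y)) x.
Proof.
move=> cf cg; apply: (ccont_comp (h := @expi) (g := fun y => k * dot (f y) (g y))); last exact: ccont_expi.
apply: (@continuousM _ _ (fun=> k) (fun y => dot (f y) (g y))).
  exact: continuous_for_cst.
exact: continuous_dot.
Qed.

Lemma is_cder_chr k n (x y : 'rV[R]_n) (j : 'I_n) :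
  is_cder (bas j) (chr k x) y ((k * x 0 j)%:C * 'i * chr k x y).
Proof.
apply/is_cder_line.
have H : is_derive (0 : R) (1 : R) (fun s : R => k * dot x (y + s *: bas j)) (k * x 0 j).
  have E : (fun s : R => k * dot x (y + s *: bas j)) =
      (fun s : R => (k * dot x y) + s * (k * x 0 j)).
    by apply/funext => s; rewrite dotDr dotZr dot_basis; ring.
  rewrite E; apply: is_derive_eq; rewrite /GRing.scale/=; ring.
apply: eq_is_cder (is_cder_comp (f := expi) (is_cder_expi _) H) => //.
by rewrite scale0r addr0 -/(chr k x y); ring.
Qed.

End complex_calculus.

(** * Graded classes of smooth functions *)

Section graded_smoothness.
Context {R : realType}.
Local Notation Re := (@complex.Re R).
Local Notation Im := (@complex.Im R).
Local Notation C := R[i].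
Variables (V : normedModType R) (I : Type) (e : I -> V) (wt : I -> R) (D : set V).
Hypothesis oD : open D.
Variable Q : R -> (V -> C) -> Prop.
Hypothesis eqQ : forall m F G, (forall x, D x -> F x = G x) -> Q m F -> Q m G.
Hypothesis QD : forall m F G, Q m F -> Q m G -> Q m (fun x => F x + G x).
Hypothesis QM : forall m1 m2 F G, Q m1 F -> Q m2 G -> Q (m1 + m2) (fun x => F x * G x).

(* [Q] is a size condition: a power of a weight gives symbol classes, the trivial
   condition gives smoothness on [D]. *)
Fixpoint cb (N : nat) (m : R) (F : V -> C) : Prop :=
  [/\ forall x, D x -> ccont F x, Q m F &
    match N with
    | 0 => True
    | N'.+1 => forall k, (forall x, D x -> is_cder (e k) F x (cderive (e k) F x)) /\
        cb N' (m + wt k) (cderive (e k) F)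
    end].

Lemma cb_cont N m F : cb N m F -> forall x, D x -> ccont F x.
Proof. by case: N => [|N] []. Qed.

Lemma cb_Q N m F : cb N m F -> Q m F.
Proof. by case: N => [|N] []. Qed.

Lemma cb_der N m F k : cb N.+1 m F ->
  (forall x, D x -> is_cder (e k) F x (cderive (e k) F x)) /\
  cb N (m + wt k) (cderive (e k) F).
Proof. by case=> _ _ /(_ k). Qed.

Lemma cbS N m F : cb N.+1 m F -> cb N m F.
Proof.
elim: N m F => [|N IH] m F [cF QF dF]; first by split.
split => // k; have [d1 d2] := dF k; split => //; exact: IH.
Qed.

Lemma eq_ccont_near (T : topologicalType) (F G : T -> C) (x : T) :
  (\forall y \near x, F y = G y) -> ccont F x -> ccont G x.
Proof.
move=> FG [c1 c2].
have E : F x = G x by exact: (nbhs_singleton FG).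
split.
- rewrite /prop_for /continuous_at -E; apply: cvg_trans c1; apply: near_eq_cvg.
  by apply: filterS FG => y /= ->.
- rewrite /prop_for /continuous_at -E; apply: cvg_trans c2; apply: near_eq_cvg.
  by apply: filterS FG => y /= ->.
Qed.

Lemma near_is_cder (F G : V -> C) (v x : V) (d : C) : v != 0 ->
  (\forall y \near x, F y = G y) -> is_cder v F x d -> is_cder v G x d.
Proof.
move=> v0 FG [h1 h2]; split.
- by apply: near_eq_is_derive h1 => //; apply: filterS FG => y /= ->.
- by apply: near_eq_is_derive h2 => //; apply: filterS FG => y /= ->.
Qed.

Hypothesis e0 : forall k, e k != 0.

Lemma nearD (P : V -> Prop) x : (forall y, D y -> P y) -> D x -> \forall y \near x, P y.
Proof.
move=> H Dx; have : nbhs x D by exact: open_nbhs_nbhs.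
exact: filterS.
Qed.

(** Values outside [D] are free: [D] is open, so the functions agree near each of its points, and
    continuity and derivatives are local. *)
Lemma eq_cb N m F G : (forall x, D x -> F x = G x) -> cb N m F -> cb N m G.
Proof.
elim: N m F G => [|N IH] m F G FG [cF QF dF]; split => //.
- by move=> x Dx; apply: eq_ccont_near (cF x Dx); exact: nearD.
- exact: eqQ FG QF.
- by move=> x Dx; apply: eq_ccont_near (cF x Dx); exact: nearD.
- exact: eqQ FG QF.
move=> k; have [d1 d2] := dF k.
have deriv_G x : D x -> is_cder (e k) G x (cderive (e k) F x).
  by move=> Dx; apply: near_is_cder (d1 x Dx) => //; exact: nearD.
have E x : D x -> cderive (e k) F x = cderive (e k) G x.
  by move=> Dx; rewrite (is_cder_cderive (deriv_G x Dx)).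
by split; [move=> x Dx; rewrite -E//; exact: deriv_G|exact: IH E d2].
Qed.

Lemma cb_intro N m F (F' : I -> V -> C) : (forall x, D x -> ccont F x) -> Q m F ->
  (forall k x, D x -> is_cder (e k) F x (F' k x)) ->
  (forall k, cb N (m + wt k) (F' k)) -> cb N.+1 m F.
Proof.
move=> cF QF dF cF'; split => // k.
have E x : D x -> F' k x = cderive (e k) F x.
  by move=> Dx; rewrite (is_cder_cderive (dF k x Dx)).
by split; [move=> x Dx; rewrite -E//; exact: dF|exact: eq_cb E (cF' k)].
Qed.

Lemma cbD N m F G : cb N m F -> cb N m G -> cb N m (fun x => F x + G x).
Proof.
elim: N m F G => [|N IH] m F G [cF QF dF] [cG QG deriv_G].
  by split => [x Dx||//]; [apply: ccontD; auto|exact: QD].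
apply: (cb_intro (F' := fun k x => cderive (e k) F x + cderive (e k) G x)).
- by move=> x Dx; apply: ccontD; auto.
- exact: QD.
- by move=> k x Dx; have [f1 _] := dF k; have [g1 _] := deriv_G k; apply: is_cderD; auto.
- by move=> k; have [_ f1] := dF k; have [_ g1] := deriv_G k; exact: IH.
Qed.

Lemma cbM N m1 m2 F G : cb N m1 F -> cb N m2 G -> cb N (m1 + m2) (fun x => F x * G x).
Proof.
elim: N m1 m2 F G => [|N IH] m1 m2 F G hF hG;
    have [cF QF dF] := hF; have [cG QG deriv_G] := hG.
  by split => [x Dx||//]; [apply: ccontM; auto|exact: QM].
apply: (cb_intro (F' := fun k x => cderive (e k) F x * G x + F x * cderive (e k) G x)).
- by move=> x Dx; apply: ccontM; auto.
- exact: QM.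
- by move=> k x Dx; have [f1 _] := dF k; have [g1 _] := deriv_G k; apply: is_cderM; auto.
- move=> k; have [_ f1] := dF k; have [_ g1] := deriv_G k; apply: cbD.
  + by rewrite addrAC; apply: IH => //; exact: cbS.
  + by rewrite -addrA; apply: IH => //; exact: cbS.
Qed.

End graded_smoothness.

(** * Symmetry of second derivatives *)

Section clairaut.
Context {R : realType}.
Variable V : normedModType R.

Lemma MVT_line (g g' : R -> R) (h : R) : 0 < h ->
  (forall s, is_derive s (1 : R) g (g' s)) ->
  exists2 s, 0 < s < h & g h - g 0 = g' s * h.
Proof.
move=> h0 dg; have [] := @MVT _ g g' 0 h h0 (fun s _ => dg s).
  apply: derivable_within_continuous => s _; exact: (@ex_derive _ _ _ _ _ _ _ (dg s)).
by move=> s; rewrite in_itv/= subr0 => sh ->; exists s.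
Qed.

(** The second difference [Delta h] is, by two applications of the mean value theorem in either
    order, [h * h] times a value of [fuv] and also of [fvu] at points tending to [x]. *)
Lemma clairaut (f fu fv fuv fvu : V -> R) (u v x : V) :
  (forall y, is_derive y u f (fu y)) -> (forall y, is_derive y v f (fv y)) ->
  (forall y, is_derive y v fu (fuv y)) -> (forall y, is_derive y u fv (fvu y)) ->
  {for x, continuous fuv} -> {for x, continuous fvu} -> fuv x = fvu x.
Proof.
move=> du dv duv dvu cuv cvu.
have line (g : V -> R) (g' : V -> R) w y : (forall z, is_derive z w g (g' z)) ->
    forall s : R, is_derive s (1 : R) (fun s : R => g (y + s *: w)) (g' (y + s *: w)).
  move=> dg s; apply/is_derive_line.
  have := (is_derive_line g (y + s *: w) w (g' (y + s *: w))).2 (dg _).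
  have -> // : (fun s0 : R => g (y + s *: w + s0 *: w)) =
    (fun s0 : R => g (y + (s + s0 *: (1 : R)) *: w)).
  by apply/funext => s0; rewrite -addrA -scalerDl scaler1.
pose Delta h := f (x + h *: u + h *: v) - f (x + h *: u) - f (x + h *: v) + f x.
have D1 h : 0 < h -> exists s t, [/\ 0 < s < h, 0 < t < h &
    Delta h = fuv (x + s *: u + t *: v) * h * h].
  move=> h0.
  have H s : is_derive s (1 : R) (fun s : R => f ((x + h *: v) + s *: u) - f (x + s *: u))
     (fu ((x + h *: v) + s *: u) - fu (x + s *: u)).
    by apply: is_deriveB; exact: line.
  have [s sh Hs] := MVT_line h0 H.
  have [t th Ht] := MVT_line h0 (line fu fuv v (x + s *: u) duv).
  exists s, t; split => //; rewrite -Ht scale0r addr0 (addrAC x) -Hs.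
  rewrite !scale0r !addr0 /Delta (addrAC x (h *: v)); ring.
have D2 h : 0 < h -> exists s t, [/\ 0 < s < h, 0 < t < h &
    Delta h = fvu (x + s *: u + t *: v) * h * h].
  move=> h0.
  have H t : is_derive t (1 : R) (fun t : R => f ((x + h *: u) + t *: v) - f (x + t *: v))
     (fv ((x + h *: u) + t *: v) - fv (x + t *: v)).
    by apply: is_deriveB; exact: line.
  have [t th Ht] := MVT_line h0 H.
  have [s sh Hs] := MVT_line h0 (line fv fvu u (x + t *: v) dvu).
  exists s, t; split => //; rewrite (addrAC x) -Hs scale0r addr0 (addrAC x) -Ht.
  rewrite !scale0r !addr0 /Delta; ring.
have small (g : V -> R) : {for x, continuous g} -> forall eps, 0 < eps ->
    exists2 d, 0 < d & forall s t, 0 < s < d -> 0 < t < d ->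
      `|g x - g (x + s *: u + t *: v)| < eps.
  move=> cg eps eps0; move/cvgrPdist_lt : cg => /(_ _ eps0) /nbhs_ballP[r /= r0 rg].
  (* Chosen so that [s * |u| + t * |v| < r] whenever s and t are below d; the summand 1 covers u = v
     = 0. *)
  pose d := r / (1 + `|u| + `|v|).
  have n0 : 0 < 1 + `|u| + `|v| by rewrite -addrA ltr_pwDl ?addr_ge0.
  exists d; first exact: divr_gt0.
  move=> s t /andP[s0 sd] /andP[t0 td]; apply: rg; rewrite -ball_normE /=.
  rewrite opprD addrA opprD addrA subrr add0r -opprD normrN.
  rewrite (le_lt_trans (ler_normD _ _))// !normrZ !gtr0_norm//.
  have dE : d * (1 + `|u| + `|v|) = r by rewrite /d divfK// gt_eqF.
  have := normr_ge0 u; have := normr_ge0 v; nra.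
apply: contrapT => /eqP neq.
pose eps := `|fuv x - fvu x| / 2.
have eps0 : 0 < eps by rewrite divr_gt0// normr_gt0 subr_eq0.
have [d1 d10 H1] := small _ cuv _ eps0; have [d2 d20 H2] := small _ cvu _ eps0.
pose h := Num.min d1 d2.
have h0 : 0 < h by rewrite lt_min d10.
have [s1 [t1 [/andP[a1 a2] /andP[b1 b2] E1]]] := D1 _ h0.
have [s2 [t2 [/andP[c1 c2] /andP[e1 e2] E2]]] := D2 _ h0.
have E : fuv (x + s1 *: u + t1 *: v) = fvu (x + s2 *: u + t2 *: v).
  by apply: (mulIf (lt0r_neq0 h0)); apply: (mulIf (lt0r_neq0 h0)); rewrite -E1 E2.
have hd1 : h <= d1 by rewrite ge_min lexx.
have hd2 : h <= d2 by rewrite ge_min lexx orbT.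
have := H1 s1 t1; rewrite a1 b1 (lt_le_trans a2)// (lt_le_trans b2)// => /(_ erefl erefl).
have := H2 s2 t2; rewrite c1 e1 (lt_le_trans c2)// (lt_le_trans e2)// => /(_ erefl erefl).
rewrite E; move: (fvu (x + _ + _)) => z.
have : `|fuv x - fvu x| <= `|fuv x - z| + `|fvu x - z|.
  by rewrite [`|fvu x - _|]distrC ler_distD.
have : `|fuv x - fvu x| = eps * 2 by rewrite /eps divfK.
move: eps {H1 H2 eps0} => eps; lra.
Qed.
Lemma clairaut_complex (f fu fv fuv fvu : V -> R[i]) (u v x : V) :
  (forall y, is_cder u f y (fu y)) -> (forall y, is_cder v f y (fv y)) ->
  (forall y, is_cder v fu y (fuv y)) -> (forall y, is_cder u fv y (fvu y)) ->
  ccont fuv x -> ccont fvu x -> fuv x = fvu x.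
Proof.
move=> du dv duv dvu [cuv1 cuv2] [cvu1 cvu2]; apply: ReIm_eq.
- exact: (clairaut (fun y => (du y).1) (fun y => (dv y).1)
    (fun y => (duv y).1) (fun y => (dvu y).1) cuv1 cvu1).
- exact: (clairaut (fun y => (du y).2) (fun y => (dv y).2)
    (fun y => (duv y).2) (fun y => (dvu y).2) cuv2 cvu2).
Qed.

End clairaut.

(** * Classes defined by powers of a positive weight *)

Section bounded_classes.
Context {R : realType}.
Local Notation Re := (@complex.Re R).
Local Notation Im := (@complex.Im R).
Local Notation C := R[i].
Variables (V : normedModType R) (I : Type) (e : I -> V) (wt : I -> R) (J : V -> R).
Hypothesis e0 : forall k, e k != 0.
Hypothesis J0 : forall x, 0 < J x.

Definition bounded_by m (F : V -> C) := exists K, forall x, normc (F x) <= K * J x `^ m.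

Lemma bounded_by_ge0 m F : bounded_by m F ->
  exists2 K, 0 <= K & forall x, normc (F x) <= K * J x `^ m.
Proof.
move=> [K FK]; exists `|K| => // x; rewrite (le_trans (FK x))//.
by rewrite ler_wpM2r ?powR_ge0// ler_norm.
Qed.

Lemma eq_bounded_by m F G : (forall x, setT x -> F x = G x) ->
  bounded_by m F -> bounded_by m G.
Proof. by move=> FG [K FK]; exists K => x; rewrite -FG. Qed.

Lemma bounded_byD m F G : bounded_by m F -> bounded_by m G ->
  bounded_by m (fun x => F x + G x).
Proof.
move=> [K FK] [L GL]; exists (K + L) => x.
by rewrite mulrDl (le_trans (normcD _ _))// lerD.
Qed.

Lemma bounded_byM m1 m2 F G : bounded_by m1 F -> bounded_by m2 G ->
  bounded_by (m1 + m2) (fun x => F x * G x).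
Proof.
move=> /bounded_by_ge0[K K0 FK] [L GL]; exists (K * L) => x.
rewrite normcM powRD; last by rewrite (gt_eqF (J0 x)) implybT.
by rewrite mulrACA ler_pM// normc_ge0.
Qed.

Lemma bounded_by0 m : bounded_by m (fun=> 0).
Proof. by exists 0 => x; rewrite /= expr0n/= addr0 sqrtr0 mul0r. Qed.

Definition bclass N m F := cb e wt setT bounded_by N m F.

Lemma bclassD N m F G : bclass N m F -> bclass N m G -> bclass N m (fun x => F x + G x).
Proof. apply: (cbD openT eq_bounded_by bounded_byD e0). Qed.

Lemma bclassM N m1 m2 F G : bclass N m1 F -> bclass N m2 G ->
  bclass N (m1 + m2) (fun x => F x * G x).
Proof. apply: (cbM openT eq_bounded_by bounded_byD bounded_byM e0). Qed.

Lemma bclass_intro N m F (F' : I -> V -> C) : (forall x, ccont F x) -> bounded_by m F ->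
  (forall k x, is_cder (e k) F x (F' k x)) ->
  (forall k, bclass N (m + wt k) (F' k)) -> bclass N.+1 m F.
Proof.
move=> cF QF dF cF'; apply: (cb_intro openT eq_bounded_by e0 (F' := F')) => //.
Qed.

Lemma eq_bclass N m F G : F =1 G -> bclass N m F -> bclass N m G.
Proof. by move=> /funext ->. Qed.

Lemma bclass_zero N m : bclass N m (fun=> 0).
Proof.
elim: N m => [|N IH] m.
  by split => // [x _|]; [exact: ccont_cst|exact: bounded_by0].
apply: (bclass_intro (F' := fun _ _ => 0)) => //.
- by move=> x; exact: ccont_cst.
- exact: bounded_by0.
- by move=> k x; exact: is_cder_cst.
Qed.

Lemma bclass_cst N c : bclass N 0 (fun=> c).
Proof.
have H : bounded_by 0 (fun=> c) by exists (normc c) => x; rewrite powRr0 mulr1.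
case: N => [|N]; first by split => // x _; exact: ccont_cst.
apply: (bclass_intro (F' := fun _ _ => 0)) => //.
- by move=> x; exact: ccont_cst.
- by move=> k x; exact: is_cder_cst.
- by move=> k; exact: bclass_zero.
Qed.

Lemma bclassZ N m c F : bclass N m F -> bclass N m (fun x => c * F x).
Proof. by move=> hF; rewrite -[m]add0r; apply: bclassM => //; exact: bclass_cst. Qed.

Lemma bclassN N m F : bclass N m F -> bclass N m (fun x => - F x).
Proof. by move=> /(bclassZ (-1)); apply: eq_bclass => x; rewrite mulN1r. Qed.

Lemma bclassB N m F G : bclass N m F -> bclass N m G -> bclass N m (fun x => F x - G x).
Proof. by move=> hF hG; apply: bclassD => //; exact: bclassN. Qed.

Lemma bclass_sum N m (A : Type) (r : seq A) (P : pred A) (F : A -> V -> C) :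
  (forall i, P i -> bclass N m (F i)) -> bclass N m (fun x => \sum_(i <- r | P i) F i x).
Proof.
move=> H; elim: r => [|i r IH].
  by apply: eq_bclass (bclass_zero N m) => x; rewrite big_nil.
have [Pi|Pi] := boolP (P i).
  by apply: eq_bclass (bclassD (H i Pi) IH) => x; rewrite big_cons Pi.
by apply: eq_bclass IH => x; rewrite big_cons (negbTE Pi).
Qed.

Lemma bclass_der N m F k : bclass N.+1 m F -> bclass N (m + wt k) (cderive (e k) F).
Proof. by move=> H; case: (cb_der k H). Qed.

Lemma bclass_is_cder N m F k x : bclass N.+1 m F ->
  is_cder (e k) F x (cderive (e k) F x).
Proof. by move=> H; case: (cb_der k H) => + _; exact. Qed.

Lemma bclass_cont N m F x : bclass N m F -> ccont F x.
Proof. by move=> H; exact: (cb_cont H). Qed.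

Lemma bclass_bound N m F : bclass N m F ->
  exists2 K, 0 <= K & forall x, normc (F x) <= K * J x `^ m.
Proof. by move=> /cb_Q/bounded_by_ge0. Qed.

Definition sclass m F := forall N, bclass N m F.

Lemma sclassD m F G : sclass m F -> sclass m G -> sclass m (fun x => F x + G x).
Proof. by move=> f g N; exact: bclassD. Qed.

Lemma sclassB m F G : sclass m F -> sclass m G -> sclass m (fun x => F x - G x).
Proof. by move=> f g N; exact: bclassB. Qed.

Lemma sclassM m1 m2 F G : sclass m1 F -> sclass m2 G -> sclass (m1 + m2) (fun x => F x * G x).
Proof. by move=> f g N; exact: bclassM. Qed.

Lemma sclassZ m c F : sclass m F -> sclass m (fun x => c * F x).
Proof. by move=> f N; exact: bclassZ. Qed.

Lemma sclass_cst c : sclass 0 (fun=> c).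
Proof. by move=> N; exact: bclass_cst. Qed.

Lemma sclass_sum m (A : Type) (r : seq A) (P : pred A) (F : A -> V -> C) :
  (forall i, P i -> sclass m (F i)) -> sclass m (fun x => \sum_(i <- r | P i) F i x).
Proof. by move=> H N; apply: bclass_sum => i Pi; exact: H. Qed.

Lemma eq_sclass m F G : F =1 G -> sclass m F -> sclass m G.
Proof. by move=> /funext ->. Qed.

Lemma sclass_der m F k : sclass m F -> sclass (m + wt k) (cderive (e k) F).
Proof. by move=> f N; exact: bclass_der. Qed.

Lemma sclass_is_cder m F k x : sclass m F -> is_cder (e k) F x (cderive (e k) F x).
Proof. by move=> f; exact: bclass_is_cder (f 1%N). Qed.

Lemma sclass_cont m F x : sclass m F -> ccont F x.
Proof. by move=> f; exact: bclass_cont (f 0%N). Qed.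

Lemma sclass_bound m F : sclass m F ->
  exists2 K, 0 <= K & forall x, normc (F x) <= K * J x `^ m.
Proof. by move=> f; exact: bclass_bound (f 0%N). Qed.

Lemma sclass_clairaut m F i j : sclass m F ->
  cderive (e i) (cderive (e j) F) = cderive (e j) (cderive (e i) F).
Proof.
move=> f; apply/funext => x.
have fi := sclass_der i f; have fj := sclass_der j f.
exact/esym/(clairaut_complex (fun y => sclass_is_cder i y f)
  (fun y => sclass_is_cder j y f) (fun y => sclass_is_cder j y fi)
  (fun y => sclass_is_cder i y fj) (sclass_cont x (sclass_der j fi))
  (sclass_cont x (sclass_der i fj))).
Qed.

End bounded_classes.

(** * Symbols and Schwartz functions *)

Section japanese_bracket.
Context {R : realType}.

(** Comparability in both directions makes the bound independent of the sign of [m]: the first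
    inequality serves m >= 0, the second one m < 0. *)
Lemma powR_compare (k x y m : R) : 1 <= k -> 0 < x -> 0 < y ->
  y <= k * x -> x <= k * y -> y `^ m <= k `^ `|m| * x `^ m.
Proof.
move=> k1 x0 y0 yx xy; have k0 : 0 < k by lra.
have [m0|m0] := leP 0 m.
  rewrite (ger0_norm m0) -(powRM _ (ltW k0) (ltW x0)).
  by apply: ge0_ler_powR; rewrite ?nnegrE// ltW// mulr_gt0.
have E (z : R) : z `^ m = (z `^ (- m))^-1 by rewrite -powRN opprK.
rewrite (ltr0_norm m0) !E ler_pdivlMr ?powR_gt0// mulrC ler_pdivrMr ?powR_gt0//.
rewrite -(powRM _ (ltW k0) (ltW y0)).
by apply: ge0_ler_powR; rewrite ?nnegrE ?oppr_ge0// ltW// mulr_gt0.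
Qed.

Variable n : nat.
Implicit Types x y : 'rV[R]_n.

(** The sup norm stands in for the Euclidean norm of the symbol classes; the two weights are
    comparable by [enorm_jap], hence define the same classes. *)
Definition jap x : R := 1 + `|x|.

Lemma jap_ge1 x : 1 <= jap x. Proof. by rewrite /jap lerDl. Qed.

Lemma jap_gt0 x : 0 < jap x. Proof. exact: lt_le_trans (jap_ge1 x). Qed.

Lemma japN x : jap (- x) = jap x. Proof. by rewrite /jap normrN. Qed.

Lemma japD x y : jap (x + y) <= jap x * jap y.
Proof.
have := ler_normD x y; rewrite /jap; have := normr_ge0 x; have := normr_ge0 y; nra.
Qed.

Lemma continuous_jap : continuous jap.
Proof.
move=> x; exact: (continuousD (@continuous_for_cst _ _ (1 : R) x) (@norm_continuous _ _ x)).
Qed.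

Lemma jap_powR_mono x (m m' : R) : m <= m' -> jap x `^ m <= jap x `^ m'.
Proof. by move=> mm; apply: ler_powR => //; exact: jap_ge1. Qed.

Lemma peetre x y (m : R) : jap (x + y) `^ m <= jap y `^ `|m| * jap x `^ m.
Proof.
apply: powR_compare; rewrite ?jap_ge1 ?jap_gt0//; first by rewrite mulrC japD.
by rewrite -{1}[x](addrK y) mulrC -(japN y) japD.
Qed.

Lemma coord_le_norm x j : `|x 0 j| <= `|x|.
Proof.
rewrite [leRHS]mx_normrE; exact: (le_bigmax _ (fun i => `|x i.1 i.2|) (0, j)).
Qed.

Lemma norm_coord x : x = 0 \/ exists j, `|x| = `|x 0 j|.
Proof.
have [->|x0] := eqVneq x 0; [by left|right].
have : mx_norm x != 0 by apply: contra_neq x0; exact: mx_norm_eq0.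
by move=> /mx_norm_neq0[[i j]]; rewrite /= ord1 => H; exists j.
Qed.

(** Decay in [jap] may thus be checked against powers of one coordinate, which is what integration
    by parts in one variable delivers. *)
Lemma jap_pow_le x (L : nat) : jap x ^+ L <= 2 ^+ L * (1 + \sum_j `|x 0 j| ^+ L).
Proof.
have s0 : 0 <= \sum_j `|x 0 j| ^+ L by apply: sumr_ge0 => j _; exact: exprn_ge0.
have [x1|x1] := leP `|x| 1.
  apply: (@le_trans _ _ (2 ^+ L)).
    by rewrite lerXn2r ?nnegrE//; [exact: ltW (jap_gt0 x)|rewrite /jap; lra].
  by rewrite ler_peMr ?exprn_ge0// lerDl.
apply: (@le_trans _ _ ((2 * `|x|) ^+ L)).
  by rewrite lerXn2r ?nnegrE ?mulr_ge0//; [exact: ltW (jap_gt0 x)|rewrite /jap; lra].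
rewrite exprMn ler_wpM2l ?exprn_ge0//.
have [x0|[j ->]] := norm_coord x; first by move: x1; rewrite x0 normr0 ltr10.
rewrite (bigD1 j)//= addrCA lerDl addr_ge0//.
by apply: sumr_ge0 => i _; exact: exprn_ge0.
Qed.

Lemma wgt_le1 x : wgt x <= 1.
Proof.
apply: (@le_trans _ _ (\prod_(j < n) (1 : R))); last by rewrite big1.
apply: ler_prod => j _; rewrite invr_ge0 addr_ge0 ?sqr_ge0//=.
by rewrite invf_le1 ?ltr_pwDl ?sqr_ge0// lerDl sqr_ge0.
Qed.

(** The source of the exponent 2n in the estimates: decay of this order in the sup norm is dominated
    by [wgt]. *)
Lemma jap_le_wgt x : jap x `^ (- (2 * n%:R)) <= wgt x.
Proof.
rewrite powRN -natrM powR_mulrn; last exact: ltW (jap_gt0 x).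
rewrite exprM -exprVn -[X in _ ^+ X <= _]card_ord -prodr_const.
apply: ler_prod => j _.
have j0 := jap_gt0 x; have w0 : 0 < 1 + x 0 j ^+ 2 by rewrite ltr_pwDl// sqr_ge0.
rewrite invr_ge0 exprn_ge0 ?(ltW j0)//= -exprVn exprVn lef_pV2 ?posrE ?exprn_gt0//.
have := coord_le_norm x j; have : x 0 j ^+ 2 = `|x 0 j| ^+ 2 by rewrite real_normK ?num_real.
rewrite /jap => ->; have := normr_ge0 (x 0 j); nra.
Qed.

Lemma wgt_shift_jap x y : wgt (x + y) <= 2 ^+ n * jap y `^ (2 * n%:R) * wgt x.
Proof.
apply: le_trans (wgt_shift _ _) _; rewrite ler_wpM2r ?(ltW (wgt_gt0 _))//.
rewrite -natrM powR_mulrn; last exact: ltW (jap_gt0 y).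
rewrite exprM -exprMn -[X in _ <= _ ^+ X]card_ord -prodr_const.
apply: ler_prod => j _; rewrite mulr_ge0 ?addr_ge0 ?sqr_ge0//= ler_wpM2l//.
have := coord_le_norm y j; have : y 0 j ^+ 2 = `|y 0 j| ^+ 2 by rewrite real_normK ?num_real.
rewrite /jap => ->; have := normr_ge0 (y 0 j); nra.
Qed.

End japanese_bracket.

Section symbols.
Context {R : realType}.
Local Notation Re := (@complex.Re R).
Local Notation Im := (@complex.Im R).
Local Notation C := R[i].
Local Notation bas := (@Defs.basis R _).
Variable n : nat.
Local Notation Ph := ('rV[R]_n * 'rV[R]_n)%type.
Implicit Types (F H : Ph -> C) (p : Ph).

Definition pb (k : 'I_n + 'I_n) : Ph := phase_basis k.

Lemma bas_neq0 (j : 'I_n) : bas j != 0.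
Proof.
apply/eqP => /matrixP/(_ 0 j); rewrite !mxE !eqxx/= => /eqP.
by rewrite oner_eq0.
Qed.

Lemma pb_neq0 k : pb k != 0.
Proof.
case: k => j; apply/eqP => -[] /=; first by move/eqP; rewrite (negbTE (bas_neq0 j)).
by move/eqP; rewrite (negbTE (bas_neq0 j)).
Qed.

Definition japp p := jap p.2.
Lemma japp_gt0 p : 0 < japp p. Proof. exact: jap_gt0. Qed.

Definition pwt (rho delta : R) (k : 'I_n + 'I_n) : R :=
  match k with inl _ => delta | inr _ => - rho end.

(** The classes S^m of type rho, delta on R^n x R^n, a phase point being the pair (t, xi). In
    contrast with [symbol_class], derivatives are taken in any order and all of them are controlled
    by [jap]. *)
Definition symb rho delta m F := sclass pb (pwt rho delta) japp m F.

Section fixed_type.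
Variables rho delta : R.
Local Notation symb := (symb rho delta).

Lemma symbD m F H : symb m F -> symb m H -> symb m (fun p => F p + H p).
Proof. exact: (sclassD pb_neq0). Qed.

Lemma symbB m F H : symb m F -> symb m H -> symb m (fun p => F p - H p).
Proof. exact: (sclassB pb_neq0 japp_gt0). Qed.

Lemma symbM m1 m2 F H : symb m1 F -> symb m2 H -> symb (m1 + m2) (fun p => F p * H p).
Proof. exact: (sclassM pb_neq0 japp_gt0). Qed.

Lemma symbZ m c F : symb m F -> symb m (fun p => c * F p).
Proof. exact: (sclassZ pb_neq0 japp_gt0). Qed.

Lemma symb_cst c : symb 0 (fun=> c).
Proof. by apply: sclass_cst; exact: pb_neq0. Qed.

Lemma symb_sum m (A : Type) (r : seq A) (P : pred A) (F : A -> Ph -> C) :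
  (forall i, P i -> symb m (F i)) -> symb m (fun x => \sum_(i <- r | P i) F i x).
Proof. exact: (sclass_sum pb_neq0). Qed.

Lemma eq_symb m F H : F =1 H -> symb m F -> symb m H.
Proof. by move=> /funext ->. Qed.

Lemma symb_der m F k : symb m F -> symb (m + pwt rho delta k) (cderive (pb k) F).
Proof. exact: sclass_der. Qed.

Lemma symb_is_cder m F k p : symb m F -> is_cder (pb k) F p (cderive (pb k) F p).
Proof. exact: sclass_is_cder. Qed.

Lemma symb_cont m F p : symb m F -> ccont F p.
Proof. exact: sclass_cont. Qed.

Lemma symb_bound m F : symb m F ->
  exists2 K, 0 <= K & forall p, normc (F p) <= K * jap p.2 `^ m.
Proof. exact: sclass_bound. Qed.

Lemma symb_clairaut m F i j : symb m F ->
  cderive (pb i) (cderive (pb j) F) = cderive (pb j) (cderive (pb i) F).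
Proof. exact: sclass_clairaut. Qed.

Lemma symb_intro m F (F' : 'I_n + 'I_n -> Ph -> C) : (forall p, ccont F p) ->
  (exists K, forall p, normc (F p) <= K * jap p.2 `^ m) ->
  (forall k p, is_cder (pb k) F p (F' k p)) ->
  (forall k, symb (m + pwt rho delta k) (F' k)) -> symb m F.
Proof.
move=> cF bF dF cF' [|N].
  by split => // p _; exact: cF.
by apply: (bclass_intro pb_neq0 (F' := F')) => // k; exact: cF'.
Qed.

End fixed_type.

Lemma symb_weaken rho delta rho' delta' m m' F : rho' <= rho -> delta <= delta' ->
  m <= m' -> symb rho delta m F -> symb rho' delta' m' F.
Proof.
move=> hr hd mm sF N; elim: N m m' F mm sF => [|N IH] m m' F mm sF.
  split=> [p _||//]; first exact: symb_cont sF.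
  have [K K0 FK] := symb_bound sF; exists K => p.
  by rewrite (le_trans (FK p))// ler_wpM2l// jap_powR_mono.
apply: (bclass_intro pb_neq0 (F' := fun k => cderive (pb k) F)).
- by move=> p; exact: symb_cont sF.
- have [K K0 FK] := symb_bound sF; exists K => p.
  by rewrite (le_trans (FK p))// ler_wpM2l// jap_powR_mono.
- by move=> k p; exact: symb_is_cder sF.
- move=> k; apply: IH (symb_der k sF); apply: lerD => //.
  by case: k => j //=; rewrite lerN2.
Qed.

(** Rapid decay of all derivatives in the second variable, uniformly in the first, which acts as a
    parameter. As the order is arbitrary the type is immaterial; 0, 1 is chosen because
    [symb_weaken] carries symbols of type rho, delta with rho >= 0 and delta <= 1 into it. *)
Definition sch F := forall m, symb 0 1 m F.

Lemma is_cder_snd (j : 'I_n) (f : 'rV[R]_n -> C) p d : is_cder (bas j) f p.2 d ->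
  is_cder (pb (inr j)) (fun q => f q.2) p d.
Proof. by move=> /is_cder_line H; apply/is_cder_line. Qed.

Lemma is_cder_snd0 (j : 'I_n) (f : 'rV[R]_n -> C) p :
  is_cder (pb (inl j)) (fun q => f q.2) p 0.
Proof.
apply/is_cder_line; apply: eq_is_cder (is_cder_cst _ (f p.2) _) => // s.
by rewrite /= scaler0 addr0.
Qed.

Lemma is_cder_slice (j : 'I_n) F (t x : 'rV[R]_n) d : is_cder (pb (inr j)) F (t, x) d ->
  is_cder (bas j) (fun y => F (t, y)) x d.
Proof.
move=> /is_cder_line H; apply/is_cder_line; apply: eq_is_cder H => // s.
by congr F; congr pair; rewrite /= scaler0 addr0.
Qed.

Lemma ccont_slice F (t x : 'rV[R]_n) : ccont F (t, x) -> ccont (fun y => F (t, y)) x.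
Proof. by move=> cF; apply: (ccont_comp (h := F)) cF; exact: continuous_pairr. Qed.

Lemma symb_coord j : symb 0 1 1 (fun p => (p.2 0 j)%:C).
Proof.
have der k p : is_cder (pb k) (fun p : Ph => (p.2 0 j)%:C) p
   (match k with inl _ => 0 | inr i => (i == j)%:R end).
  case: k => i; first exact: (is_cder_snd0 i (fun x => (x 0 j)%:C)).
  apply: (is_cder_snd (f := fun x => (x 0 j)%:C)); apply/is_cder_line.
  rewrite (_ : (i == j)%:R = ((i == j)%:R : R)%:C); last by case: (i == j).
  apply: is_cderR.
  rewrite (_ : (fun s : R => _) = (fun s : R => p.2 0 j + s * (i == j)%:R)); last first.
    by apply/funext => s; rewrite !mxE eqxx/= eq_sym.
  move: (p.2 0 j) ((i == j)%:R : R) => u v.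
  by apply: is_derive_eq; rewrite /GRing.scale/=; ring.
apply: (symb_intro _ _ der).
- move=> p; apply: ccontR; apply: (continuous_coord (f := fun p : Ph => p.2)).
  exact: cvg_snd.
- exists 1 => p; rewrite normcR mul1r powRr1; last exact: ltW (jap_gt0 _).
  by rewrite (le_trans (coord_le_norm _ _))// /jap lerDr.
- case=> i /=; last by rewrite oppr0 addr0; apply: symb_weaken (symb_cst 0 1 _) => //.
  by apply: symb_weaken (symb_cst 0 1 _) => //; rewrite addr_ge0.
Qed.

Lemma schM_symb m F H : symb 0 1 m F -> sch H -> sch (fun p => F p * H p).
Proof. by move=> sF sH k; rewrite -[k](subrKC m); apply: symbM. Qed.

Lemma schD F H : sch F -> sch H -> sch (fun p => F p + H p).
Proof. by move=> f h m; exact: symbD. Qed.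

Lemma sch_der F k : sch F -> sch (cderive (pb k) F).
Proof.
by move=> f m; rewrite -[m](subrK (pwt 0 1 k)); exact: symb_der.
Qed.

Lemma sch_wgt F : sch F -> exists2 K, 0 <= K & forall p, normc (F p) <= K * wgt p.2.
Proof.
move=> f; have [K K0 FK] := symb_bound (f (- (2 * n%:R))); exists K => // p.
by rewrite (le_trans (FK p))// ler_wpM2l// jap_le_wgt.
Qed.

End symbols.

(** * Oscillatory integrals with rapidly decreasing amplitude *)

Section oscillatory.
Context {R : realType}.
Local Notation Re := (@complex.Re R).
Local Notation Im := (@complex.Im R).
Local Notation C := R[i].
Local Notation bas := (@Defs.basis R _).
Variable n : nat.
Local Notation Ph := ('rV[R]_n * 'rV[R]_n)%type.
Implicit Types (q : Ph -> C) (s t x : 'rV[R]_n).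

Lemma is_cder_slicel (j : 'I_n) (F : Ph -> C) t x d : is_cder (pb (inl j)) F (t, x) d ->
  is_cder (bas j) (fun y => F (y, x)) t d.
Proof.
move=> /is_cder_line H; apply/is_cder_line; apply: eq_is_cder H => // s.
by congr F; congr pair; rewrite /= scaler0 addr0.
Qed.

Lemma ccont_slicel (F : Ph -> C) t x : ccont F (t, x) -> ccont (fun y => F (y, x)) t.
Proof. by move=> cF; apply: (ccont_comp (h := F)) cF; exact: continuous_pairl. Qed.

Lemma cint_continuous_loc (T : pseudoMetricType R) (F : T -> 'rV[R]_n -> C)
    (p : T) (K : T -> R) : {for p, continuous K} -> (forall r, cdom (K r) (F r)) ->
  (forall x, ccont (F^~ x) p) -> ccont (fun r => cint (F r)) p.
Proof.
move=> cK dF; apply: (cint_continuous (K := K p + 1)).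
have : \forall r \near p, K r < K p + 1.
  by apply: (cvgr_lt (K p)); [exact: cK|rewrite ltrDl].
by apply: filterS => r /ltW Kr; exact: cdomW Kr (dF r).
Qed.

Lemma ccont_chrr k s x : ccont (chr k s) x.
Proof.
exact: (@ccont_chr R _ k n (fun=> s) id x (@continuous_for_cst _ _ s x)
  (@continuous_for_id _ x)).
Qed.

Lemma ccont_chrl k s x : ccont (fun s => chr k s x) s.
Proof.
exact: (@ccont_chr R _ k n id (fun=> x) s (@continuous_for_id _ s)
  (@continuous_for_cst _ _ x s)).
Qed.

Lemma is_cder_eq (V : normedModType R) (v : V) (f : V -> C) (x : V) d e :
  is_cder v f x d -> d = e -> is_cder v f x e.
Proof. by move=> h <-. Qed.

Lemma is_cder_chrl k s x (j : 'I_n) :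
  is_cder (bas j) (fun s => chr k s x) s ((k * x 0 j)%:C * 'i * chr k s x).
Proof. by rewrite chrC; under eq_fun do rewrite chrC; exact: is_cder_chr. Qed.

(** The point [s] is both the frequency and the parameter of the amplitude. An amplitude independent
    of [s] gives the Fourier transform, and [b (s, x) * g x] with [k = 2 * pi] gives a
    pseudo-differential operator; the two mapping properties thus have one proof. *)
Definition osc (k : R) q s : C := cint (fun x => chr k s x * q (s, x)).

Lemma osc_cdom k q : sch q -> exists K, forall s, cdom K (fun x => chr k s x * q (s, x)).
Proof.
move=> sq; have [K K0 qK] := sch_wgt sq; exists K => s; split => x.
  apply: ccontM; last exact: ccont_slice (symb_cont _ (sq 0)).
  exact: ccont_chrr.
by rewrite normcM normc_chr mul1r; exact: qK (s, x).
Qed.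

Lemma osc_bounded k q : sch q -> exists K, forall s, normc (osc k q s) <= K.
Proof.
by move=> /(osc_cdom k)[K dK]; exists (2 * (K * pi ^+ n)) => s; exact: cint_le.
Qed.

Lemma osc_cont k q s : sch q -> ccont (osc k q) s.
Proof.
move=> sq; have [K dK] := osc_cdom k sq.
apply: (cint_continuous_loc (K := fun=> K)) => //; first exact: continuous_for_cst.
move=> x; apply: ccontM; last exact: ccont_slicel (symb_cont _ (sq 0)).
exact: ccont_chrl.
Qed.

Lemma sch_phase k j q : sch q -> sch (fun p => (k * p.2 0 j)%:C * 'i * q p).
Proof.
move=> sq; have : sch (fun p => ((k%:C * 'i) * (p.2 0 j)%:C) * q p).
  by apply: (schM_symb (m := 1)) sq; apply: symbZ; exact: symb_coord.
by move=> H m; apply: eq_symb (H m) => p; rewrite rmorphM/=; ring.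
Qed.

Lemma osc_der k j q s : sch q -> is_cder (bas j) (osc k q) s
  (osc k (fun p => (k * p.2 0 j)%:C * 'i * q p + cderive (pb (inl j)) q p) s).
Proof.
move=> sq; set q' := (fun p : Ph => _).
have sq' : sch q' by apply: schD; [exact: sch_phase|exact: sch_der].
have [K dK] := osc_cdom k sq; have [K' dK'] := osc_cdom k sq'.
apply/is_cder_line.
have := @cint_derive _ n (fun u x => chr k (s + u *: bas j) x * q (s + u *: bas j, x))
  (fun u x => chr k (s + u *: bas j) x * q' (s + u *: bas j, x)) (`|K| + `|K'|).
rewrite /= scale0r addr0; apply.
- by move=> u _; apply: cdomW (dK _); rewrite (le_trans (ler_norm _))// lerDl.
- move=> u x _.
  have h1 := is_cder_line_at (is_cder_chrl k (s + u *: bas j) x j).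
  have h2 := is_cder_line_at (is_cder_slicel (symb_is_cder (inl j) (s + u *: bas j, x) (sq 0))).
  by apply: is_cder_eq (is_cderM h1 h2) _; rewrite /q'/=; ring.
- move=> u x _; apply: le_trans ((dK' _).2 x) _.
  by rewrite ler_wpM2r ?(ltW (wgt_gt0 _))// (le_trans (ler_norm _))// lerDr.
Qed.

Lemma osc_ibp k j q s : sch q ->
  (k * s 0 j)%:C * 'i * osc k q s = - osc k (cderive (pb (inr j)) q) s.
Proof.
move=> sq; have sq' := sch_der (inr j) sq.
have [K dK] := osc_cdom k sq; have [K' dK'] := osc_cdom k sq'.
have d1 := cdomZ ((k * s 0 j)%:C * 'i) (dK s).
have := cint_ibp (j := j) (K := `|K| + `|normc ((k * s 0 j)%:C * 'i) * K + K'|)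
  (f := fun x => chr k s x * q (s, x))
  (f' := fun x => ((k * s 0 j)%:C * 'i) * (chr k s x * q (s, x)) +
     chr k s x * cderive (pb (inr j)) q (s, x)).
rewrite (cintD d1 (dK' s)) (cintZ _ (dK s)) => H.
apply/eqP; rewrite -addr_eq0; apply/eqP; apply: H.
- by apply: cdomW (dK s); rewrite (le_trans (ler_norm _))// lerDl.
- by apply: cdomW (cdomD d1 (dK' s)); rewrite (le_trans (ler_norm _))// lerDr.
- move=> x; apply: eq_is_cder (is_cderM (is_cder_chr k s x j)
    (is_cder_slice (symb_is_cder (inr j) (s, x) (sq 0)))) => //.
  by ring.
Qed.

Lemma osc_decay k q j (L : nat) : k != 0 -> sch q ->
  exists K, forall s, `|s 0 j| ^+ L * normc (osc k q s) <= K.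
Proof.
move=> k0; elim: L q => [|L IH] q sq.
  have [K bK] := osc_bounded k sq; exists K => s.
  by rewrite expr0 mul1r.
have [K bK] := IH _ (sch_der (inr j) sq); exists (`|k|^-1 * K) => s.
have -> : `|s 0 j| ^+ L.+1 * normc (osc k q s) =
    `|k|^-1 * (`|s 0 j| ^+ L * normc ((k * s 0 j)%:C * 'i * osc k q s)).
  rewrite !normcM normcR normrM -[normc 'i]/(Num.sqrt (0 ^+ 2 + 1 ^+ 2)).
  rewrite expr0n expr1n add0r sqrtr1 mulr1 exprS.
  by field; rewrite normr_eq0.
by rewrite osc_ibp// normcN ler_wpM2l// invr_ge0.
Qed.

Lemma osc_bounded_by k q m : k != 0 -> sch q ->
  exists K, forall s, normc (osc k q s) <= K * jap s `^ m.
Proof.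
move=> k0 sq; pose L := Num.bound `|m|.
have mL : - m <= L%:R.
  by rewrite (le_trans (ler_norm _))// normrN ltW// archi_boundP.
have [K0 bK0] := osc_bounded k sq.
have /choice[K bK] : forall j, exists K, forall s, `|s 0 j| ^+ L * normc (osc k q s) <= K.
  by move=> j; exact: osc_decay.
exists (2 ^+ L * (K0 + \sum_j K j)) => s.
have jL : jap s ^+ L * normc (osc k q s) <= 2 ^+ L * (K0 + \sum_j K j).
  apply: le_trans (ler_wpM2r (normc_ge0 _) (jap_pow_le s L)) _.
  rewrite -mulrA ler_wpM2l ?exprn_ge0// mulrDl mul1r mulr_suml lerD//.
  by apply: ler_sum => j _.
apply: (@le_trans _ _ (2 ^+ L * (K0 + \sum_j K j) * jap s `^ (- L%:R))).
  rewrite powRN powR_mulrn ?(ltW (jap_gt0 _))// ler_pdivlMr ?exprn_gt0 ?jap_gt0//.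
  by rewrite mulrC.
rewrite ler_wpM2l//; last by apply: jap_powR_mono; rewrite lerNl.
by apply: le_trans jL; rewrite mulr_ge0 ?normc_ge0// exprn_ge0// ltW// jap_gt0.
Qed.

(** A derivative of [osc] is [osc] of another rapidly decreasing amplitude, so decay of the integral
    itself suffices. Both the invariance of the Schwartz space under Fourier transform and its
    preservation by [pdo] follow. *)
Lemma osc_sch k q : k != 0 -> sch q -> sch (fun p : Ph => osc k q p.2).
Proof.
move=> k0 sq m N; elim: N m q sq => [|N IH] m q sq.
  split => // [p _|].
    by apply: (ccont_for_comp_snd (f := osc k q)); exact: osc_cont.
  by have [K bK] := osc_bounded_by m k0 sq; exists K => p; exact: bK.
apply: (bclass_intro (@pb_neq0 R n) (F' := fun i (p : Ph) => match i with
  | inl _ => 0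
  | inr j => osc k (fun p => (k * p.2 0 j)%:C * 'i * q p + cderive (pb (inl j)) q p) p.2
  end)).
- by move=> p; apply: (ccont_for_comp_snd (f := osc k q)); exact: osc_cont.
- by have [K bK] := osc_bounded_by m k0 sq; exists K => p; exact: bK.
- case=> j p; first exact: is_cder_snd0.
  by apply: is_cder_snd; exact: osc_der.
- case=> j; first by apply: bclass_zero; exact: pb_neq0.
  by apply: IH; apply: schD; [exact: sch_phase|exact: sch_der].
Qed.

End oscillatory.

(** * Weights in the variable y *)

Section weights.
Context {R : realType}.
Local Notation C := R[i].
Local Notation bas := (@Defs.basis R _).
Variable n : nat.
Implicit Types (y : 'rV[R]_n) (v : 'rV[R]_n -> C).

(** Here a larger [m] means more decay. Derivatives keep the same order, since differentiating [wgt]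
    only multiplies it by bounded functions. *)
Definition wcl m v := sclass bas (fun _ : 'I_n => 0) (@wgt R n) m v.

Lemma wclM m1 m2 v w : wcl m1 v -> wcl m2 w -> wcl (m1 + m2) (fun y => v y * w y).
Proof. exact: (sclassM (@bas_neq0 R n) (@wgt_gt0 R n)). Qed.

Lemma wcl_der m v j : wcl m v -> wcl m (cderive (bas j) v).
Proof. by move=> /(sclass_der j); rewrite addr0. Qed.

Lemma wcl_is_cder m v j y : wcl m v -> is_cder (bas j) v y (cderive (bas j) v y).
Proof. exact: sclass_is_cder. Qed.

Lemma wcl_cont m v y : wcl m v -> ccont v y.
Proof. exact: sclass_cont. Qed.

Lemma wcl_bound v : wcl 1 v -> exists2 K, 0 <= K & forall y, normc (v y) <= K * wgt y.
Proof.
move=> /sclass_bound[K K0 vK]; exists K => // y.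
by rewrite (le_trans (vK y))// powRr1// ltW// wgt_gt0.
Qed.

Lemma wcl_weaken m m' v : m' <= m -> wcl m v -> wcl m' v.
Proof.
move=> mm sv N; elim: N v sv => [|N IH] v sv.
  split=> [y _||//]; first exact: wcl_cont sv.
  have [K K0 vK] := sclass_bound sv; exists K => y.
  by rewrite (le_trans (vK y))// ler_wpM2l// ger_powR// wgt_gt0 wgt_le1.
apply: (bclass_intro (@bas_neq0 R n) (F' := fun j => cderive (bas j) v)).
- by move=> y; exact: wcl_cont sv.
- have [K K0 vK] := sclass_bound sv; exists K => y.
  by rewrite (le_trans (vK y))// ler_wpM2l// ger_powR// wgt_gt0 wgt_le1.
- by move=> j y; exact: wcl_is_cder sv.
- by move=> j; rewrite addr0; apply: IH; exact: wcl_der.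
Qed.

(** [sfac] and [rfac] are bounded, and their derivatives are polynomials in the two, which closes
    the simultaneous induction of [bclass_fac]. The logarithmic derivative of [wgt] is
    [- 2 * rfac]. *)
Definition sfac (j : 'I_n) y : R := (1 + y 0 j ^+ 2)^-1.
Definition rfac (j : 'I_n) y : R := y 0 j * sfac j y.

Lemma sfac_gt0 j y : 0 < sfac j y.
Proof. by rewrite invr_gt0 ltr_pwDl// sqr_ge0. Qed.

Lemma coord_line (i j : 'I_n) y (s : R) :
  (y + s *: bas i) 0 j = y 0 j + s * (j == i)%:R.
Proof. by rewrite !mxE eqxx. Qed.

Lemma is_derive_sfac i j y :
  is_derive y (bas i) (sfac j) ((j == i)%:R * (- 2 * rfac j y * sfac j y)).
Proof.
apply/is_derive_line.
rewrite (_ : (fun s : R => _) = fun s : R => (1 + (y 0 j + s * (j == i)%:R) ^+ 2)^-1); last first.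
  by apply/funext => s; rewrite /sfac coord_line.
rewrite /rfac /sfac; move: (y 0 j) ((j == i)%:R : R) => u v.
have u0 (s : R) : 1 + (u + s * v) ^+ 2 != 0 by rewrite gt_eqF// ltr_pwDl// sqr_ge0.
have H0 := u0 0; have : 1 + u ^+ 2 != 0 by rewrite gt_eqF// ltr_pwDl// sqr_ge0.
move=> u1; apply: is_derive_eq; rewrite /GRing.scale/= mul0r addr0.
by field.
Qed.

Lemma is_derive_rfac i j y :
  is_derive y (bas i) (rfac j) ((j == i)%:R * (sfac j y + - 2 * rfac j y * rfac j y)).
Proof.
have Hc : is_derive y (bas i) (fun y : 'rV[R]_n => y 0 j) ((j == i)%:R).
  apply/is_derive_line; under eq_fun do rewrite coord_line.
  move: (y 0 j) ((j == i)%:R : R) => u v.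
  by apply: is_derive_eq; rewrite /GRing.scale/=; ring.
have H : is_derive y (bas i) (rfac j) _ := is_deriveM Hc (is_derive_sfac i j y).
apply: is_derive_eq H _.
by rewrite /GRing.scale/= /rfac; ring.
Qed.

Lemma is_derive_wgt i y : is_derive y (bas i) (@wgt R n) (- 2 * rfac i y * wgt y).
Proof.
apply/is_derive_line.
pose P := \prod_(j < n | j != i) sfac j y.
rewrite (_ : (fun s : R => _) = fun s : R => P * (1 + (y 0 i + s * 1) ^+ 2)^-1); last first.
  apply/funext => s; rewrite /wgt (bigD1 i)//= mulrC coord_line eqxx.
  by congr (_ * _); apply: eq_bigr => j ji; rewrite /sfac coord_line (negbTE ji) mulr0 addr0.
rewrite (_ : wgt y = P * sfac i y); last first.
  by rewrite /wgt (bigD1 i)//= mulrC.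
rewrite /rfac /sfac; move: (y 0 i) P => u P.
have u0 (s : R) : 1 + (u + s * 1) ^+ 2 != 0 by rewrite gt_eqF// ltr_pwDl// sqr_ge0.
have H0 := u0 0; have : 1 + u ^+ 2 != 0 by rewrite gt_eqF// ltr_pwDl// sqr_ge0.
move=> u1; apply: is_derive_eq; rewrite /GRing.scale/= mul0r addr0.
by field.
Qed.

Lemma continuous_sfac j : continuous (sfac j).
Proof.
move=> y; apply: (continuous_for_comp (f := fun u : R => (1 + u ^+ 2)^-1) (g := fun y : 'rV[R]_n => y 0 j)).
  exact: coord_continuous.
exact: continuous_oneDsqrV.
Qed.

Lemma continuous_rfac j : continuous (rfac j).
Proof.
by move=> y; apply: (@continuousM _ _ (fun y : 'rV[R]_n => y 0 j) (sfac j));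
  [exact: coord_continuous|exact: continuous_sfac].
Qed.

Lemma sfac_le1 j y : sfac j y <= 1.
Proof. by rewrite invf_le1 ?ltr_pwDl ?sqr_ge0// lerDl sqr_ge0. Qed.

Lemma rfac_le1 j y : `|rfac j y| <= 1.
Proof.
rewrite normrM (ger0_norm (ltW (sfac_gt0 _ _))) ler_pdivrMr ?ltr_pwDl ?sqr_ge0// mul1r.
have : y 0 j ^+ 2 = `|y 0 j| ^+ 2 by rewrite real_normK ?num_real.
by move=> ->; have := sqr_ge0 (`|y 0 j| - 1); nra.
Qed.

Lemma bclass_fac N j :
  bclass (fun i : 'I_n => bas i) (fun=> 0) (@wgt R n) N 0 (fun y => (sfac j y)%:C) /\
  bclass (fun i : 'I_n => bas i) (fun=> 0) (@wgt R n) N 0 (fun y => (rfac j y)%:C).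
Proof.
have b1 (f : 'rV[R]_n -> R) : (forall y, `|f y| <= 1) ->
    bounded_by (@wgt R n) 0 (fun y => (f y)%:C).
  by move=> f1; exists 1 => y; rewrite powRr0 mulr1 normcR.
have s1 : bounded_by (@wgt R n) 0 (fun y => (sfac j y)%:C).
  by apply: b1 => y; rewrite ger0_norm ?sfac_le1// ltW// sfac_gt0.
have r1 := b1 _ (rfac_le1 j).
have cs y : ccont (fun y => (sfac j y)%:C) y by apply: ccontR; exact: continuous_sfac.
have cr y : ccont (fun y => (rfac j y)%:C) y by apply: ccontR; exact: continuous_rfac.
have b0 := @bas_neq0 R n; have w0 := @wgt_gt0 R n.
elim: N => [|N [IHs IHr]]; first by split; split.
have rs : bclass (fun i : 'I_n => bas i) (fun=> 0) (@wgt R n) N 0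
    (fun y => (rfac j y)%:C * (sfac j y)%:C).
  by rewrite -[0 in X in bclass _ _ _ _ X _]addr0; exact: bclassM.
have rr : bclass (fun i : 'I_n => bas i) (fun=> 0) (@wgt R n) N 0
    (fun y => (rfac j y)%:C * (rfac j y)%:C).
  by rewrite -[0 in X in bclass _ _ _ _ X _]addr0; exact: bclassM.
split.
- apply: (bclass_intro b0 (F' := fun i y =>
      ((j == i)%:R * -2)%:C * ((rfac j y)%:C * (sfac j y)%:C))) => //.
  + move=> i y; apply: is_cder_eq (is_cderR (is_derive_sfac i j y)) _.
    by rewrite -!rmorphM; congr (_%:C); ring.
  + by move=> i; rewrite addr0; exact: bclassZ.
- apply: (bclass_intro b0 (F' := fun i y =>
      ((j == i)%:R)%:C * ((sfac j y)%:C + (-2)%:C * ((rfac j y)%:C * (rfac j y)%:C)))) => //.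
  + move=> i y; apply: is_cder_eq (is_cderR (is_derive_rfac i j y)) _.
    by rewrite -!rmorphM -rmorphD -rmorphM; congr (_%:C); ring.
  + move=> i; rewrite addr0; apply: bclassZ => //; apply: bclassD => //.
    exact: bclassZ.
Qed.

Lemma bclass_wgt N :
  bclass (fun i : 'I_n => bas i) (fun=> 0) (@wgt R n) N 1 (fun y => (wgt y)%:C).
Proof.
have b0 := @bas_neq0 R n; have w0 := @wgt_gt0 R n.
have cw y : ccont (fun y : 'rV[R]_n => (wgt y)%:C) y by apply: ccontR; exact: continuous_wgt.
have bw : bounded_by (@wgt R n) 1 (fun y => (wgt y)%:C).
  by exists 1 => y; rewrite mul1r normcR powRr1 ?(ltW (w0 y))// ger0_norm// (ltW (w0 y)).
elim: N => [|N IH]; first by split.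
apply: (bclass_intro b0 (F' := fun i y => (-2)%:C * ((rfac i y)%:C * (wgt y)%:C))) => //.
- move=> i y; apply: is_cder_eq (is_cderR (is_derive_wgt i y)) _.
  by rewrite -!rmorphM; congr (_%:C); ring.
- move=> i; rewrite addr0; apply: bclassZ => //.
  by rewrite -[1]add0r; apply: bclassM => //; case: (bclass_fac N i).
Qed.

Lemma wcl_wgt : wcl 1 (fun y => (wgt y)%:C).
Proof. by move=> N; exact: bclass_wgt. Qed.

(** The function w of the overview. Multiplied by a coordinate of y it still belongs to [wcl 1],
    which is needed to differentiate [amp] in th and eta. *)
Definition sqwgt y : C := (wgt y ^+ 2)%:C.

Lemma sqwgtE y : sqwgt y = (wgt y ^+ 2)%:C. Proof. by []. Qed.

Lemma wcl_sqwgt : wcl 1 sqwgt.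
Proof.
apply: (@wcl_weaken (1 + 1)); first by rewrite lerDl.
have := wclM wcl_wgt wcl_wgt; apply: eq_sclass => y.
by rewrite /sqwgt -rmorphM expr2.
Qed.

Lemma wcl_coord_wgt j : wcl 0 (fun y => (y 0 j * wgt y)%:C).
Proof.
have b0 := @bas_neq0 R n; have w0 := @wgt_gt0 R n.
have le1 y : `|y 0 j * wgt y| <= 1.
  rewrite /wgt (bigD1 j)//= mulrA -/(sfac j y) -/(rfac j y) normrM.
  rewrite mulr_ile1 ?rfac_le1// ger0_norm; last by apply: prodr_ge0 => i _; exact: ltW (sfac_gt0 i y).
  apply: (@le_trans _ _ (\prod_(i < n | i != j) (1 : R))); last by rewrite big1.
  by apply: ler_prod => i _; rewrite (ltW (sfac_gt0 i y)) sfac_le1.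
move=> N; elim: N => [|N IH].
  split => // [y _|].
    by apply: ccontR; apply: continuousM; [exact: coord_continuous|exact: continuous_wgt].
  by exists 1 => y; rewrite powRr0 mulr1 normcR.
apply: (bclass_intro b0 (F' := fun i y => ((j == i)%:R)%:C * (wgt y)%:C +
  (-2)%:C * ((rfac i y)%:C * (y 0 j * wgt y)%:C))).
- move=> y; apply: ccontR.
  by apply: continuousM; [exact: coord_continuous|exact: continuous_wgt].
- by exists 1 => y; rewrite powRr0 mulr1 normcR.
- move=> i y.
  have Hc : is_derive y (bas i) (fun y : 'rV[R]_n => y 0 j) ((j == i)%:R).
    apply/is_derive_line; under eq_fun do rewrite coord_line.
    move: (y 0 j) ((j == i)%:R : R) => u v.
    by apply: is_derive_eq; rewrite /GRing.scale/=; ring.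
  apply: is_cder_eq (is_cderR (f := fun y : 'rV[R]_n => y 0 j * wgt y)
    (is_deriveM Hc (is_derive_wgt i y))) _.
  by rewrite -!rmorphM -rmorphD; congr (_%:C); rewrite /GRing.scale/=; ring.
- move=> i; rewrite addr0; apply: bclassD => //; apply: bclassZ => //.
    by apply: (@wcl_weaken 1 0 _ _ wcl_wgt) => //.
  by rewrite -[0 in X in bclass _ _ _ _ X _]addr0; apply: bclassM => //; case: (bclass_fac N i).
Qed.

Lemma wcl_coord_sqwgt j : wcl 1 (fun y => (y 0 j)%:C * sqwgt y).
Proof.
rewrite -[1]add0r; have := wclM (wcl_coord_wgt j) wcl_wgt; apply: eq_sclass => y.
by rewrite /sqwgt -!rmorphM; congr (_%:C); ring.
Qed.
End weights.

(** * The family c_th *)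

Section directional.
Context {R : realType}.
Local Notation Re := (@complex.Re R).
Local Notation Im := (@complex.Im R).
Local Notation C := R[i].
Variable V : normedModType R.

(** Directional derivatives alone need not be additive. The increment along u, taken at x + h v, is
    a value of [h * fu] by the mean value theorem, and continuity of [fu] at x brings the limit back
    to x. *)
Lemma is_derive_add (f fu : V -> R) (u v x : V) (dv : R) :
  (forall y, is_derive y u f (fu y)) -> is_derive x v f dv ->
  {for x, continuous fu} -> is_derive x (u + v) f (fu x + dv).
Proof.
move=> du [dv1 dv2] cfu.
have /choice[s sP] : forall h : R, exists s : R, 0 < s < 1 /\
    f (x + h *: v + h *: u) - f (x + h *: v) = h * fu (x + h *: v + (s * h) *: u).
  move=> h.
  have H (s : R) : is_derive s (1 : R) (fun s : R => f ((x + h *: v) + s *: (h *: u)))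
      (h * fu (x + h *: v + (s * h) *: u)).
    have K1 : is_derive (s * h) (1 : R) (fun s : R => f ((x + h *: v) + s *: u))
        (fu (x + h *: v + (s * h) *: u)).
      apply/is_derive_line.
      have := (is_derive_line f (x + h *: v + (s * h) *: u) u (fu (x + h *: v + (s * h) *: u))).2 (du _).
      have -> // : (fun s0 : R => f (x + h *: v + (s * h) *: u + s0 *: u)) =
        (fun s0 : R => f (x + h *: v + (s * h + s0 *: (1 : R)) *: u)).
      by apply/funext => s0; rewrite -addrA -scalerDl scaler1.
    have K2 : is_derive s (1 : R) (fun s : R => s * h) h.
      by apply: is_derive_eq; rewrite /GRing.scale/=; ring.
    have K3 := @is_derive1_comp _ (fun s : R => f ((x + h *: v) + s *: u)) (fun s : R => s * h) s _ _ K1 K2.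
    rewrite mulrC (_ : (fun s0 : R => f (x + h *: v + s0 *: (h *: u))) =
      (fun s : R => f ((x + h *: v) + s *: u)) \o (fun s : R => s * h))//.
    by apply/funext => z /=; rewrite scalerA.
  have [s s01] := MVT_line ltr01 H.
  by rewrite scale0r addr0 scale1r mulr1 => E; exists s.
have L : h^-1 *: ((f \o shift x) (h *: (u + v)) - f x) @[h --> (0 : R)^'] --> fu x + dv.
  have E : \forall h \near (0 : R)^', fu (x + h *: v + (s h * h) *: u) +
      h^-1 *: ((f \o shift x) (h *: v) - f x) = h^-1 *: ((f \o shift x) (h *: (u + v)) - f x).
    near=> h; have h0 : h != 0 by near: h; exact: nbhs_dnbhs_neq.
    have [_ /(congr1 (fun z => h^-1 * z))] := sP h; rewrite mulKf// => <-.
    rewrite -[X in X + _ = _]/(h^-1 *: (f (x + h *: v + h *: u) - f (x + h *: v) : R)).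
    rewrite -scalerDr; congr (_ *: _).
    rewrite /= scalerDr (addrC (h *: u)) (addrC (h *: v) x) [h *: v + _ + x]addrC.
    by rewrite addrA subrK addrA.
  apply: cvg_trans (near_eq_cvg E) _.
  apply: cvgD; last first.
    by rewrite -dv2; move: dv1 => /cvg_ex[l Hl]; rewrite /derive (cvg_lim _ Hl).
  apply/cvgrPdist_lt => eps eps0.
  move/cvgrPdist_lt : cfu => /(_ _ eps0) /nbhs_ballP[r /= r0 rg].
  have n0 : 0 < 1 + `|u| + `|v| by rewrite -addrA ltr_pwDl ?addr_ge0.
  have d0 : 0 < r / (1 + `|u| + `|v|) by exact: divr_gt0.
  near=> h; apply: rg; rewrite -ball_normE /=.
  rewrite -addrA opprD addrA subrr add0r normrN.
  rewrite (le_lt_trans (ler_normD _ _))//.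
  rewrite !normrZ.
  have [/andP[s0 s1] _] := sP h; rewrite (gtr0_norm s0).
  have hd : `|h| < r / (1 + `|u| + `|v|).
    by near: h; apply: dnbhs0_lt.
  have : `|h| * (1 + `|u| + `|v|) < r by rewrite -ltr_pdivlMr.
  have : s h * (`|h| * `|u|) <= `|h| * `|u| by rewrite ler_piMl ?mulr_ge0// ltW.
  have := normr_ge0 u; have := normr_ge0 v; have := normr_ge0 h; nra.
split; first by apply/cvg_ex; exists (fu x + dv).
exact: cvg_lim L.
Unshelve. all: by end_near. Qed.

Lemma is_cder_add (f fu : V -> C) (u v x : V) (dv : C) :
  (forall y, is_cder u f y (fu y)) -> is_cder v f x dv ->
  ccont fu x -> is_cder (u + v) f x (fu x + dv).
Proof.
move=> du [dv1 dv2] [c1 c2]; split; rewrite ?ReD ?ImD.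
- exact: (@is_derive_add (fun y => Re (f y)) (fun y => Re (fu y)) u v x _ (fun y => (du y).1) dv1 c1).
- exact: (@is_derive_add (fun y => Im (f y)) (fun y => Im (fu y)) u v x _ (fun y => (du y).2) dv2 c2).
Qed.

Lemma is_cder_scale (f : V -> C) (c : R) (u x : V) (d : C) :
  is_cder u f x d -> is_cder (c *: u) f x (c%:C * d).
Proof.
move=> /is_cder_line H; apply/is_cder_line.
have K2 : is_derive (0 : R) (1 : R) (fun s : R => s * c) c.
  by apply: is_derive_eq; rewrite /GRing.scale/=; ring.
have H' : is_cder (1 : R) (fun s : R => f (x + s *: u)) (0 * c) d by rewrite mul0r.
rewrite mulrC (_ : (fun s : R => f (x + s *: (c *: u))) = (fun s : R => f (x + (s * c) *: u))).
  exact: (@is_cder_comp R (fun s => f (x + s *: u)) (fun s => s * c) 0 d c H' K2).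
by apply/funext => s; rewrite scalerA.
Qed.

(** Provides derivatives along an arbitrary vector, such as that of [th |-> b (t + th y, xi)], from
    continuous partial derivatives. *)
Lemma is_cder_lincomb (I : Type) (r : seq I) (e : I -> V) (c : I -> R) (f : V -> C)
    (fe : I -> V -> C) x : (forall i y, is_cder (e i) f y (fe i y)) ->
  (forall i, ccont (fe i) x) ->
  is_cder (\sum_(i <- r) c i *: e i) f x (\sum_(i <- r) (c i)%:C * fe i x).
Proof.
move=> df cf; elim: r => [|i r IH].
  rewrite !big_nil; apply/is_cder_line.
  apply: eq_is_cder (is_cder_cst _ (f x) _) => // s.
  by rewrite scaler0 addr0.
rewrite !big_cons; apply: (is_cder_add (fu := fun y => (c i)%:C * fe i y)) => //.
- by move=> y; exact: is_cder_scale.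
- by apply: ccontM => //; exact: ccont_cst.
Qed.

End directional.

Section symbol_calculus.
Context {R : realType}.
Local Notation Re := (@complex.Re R).
Local Notation Im := (@complex.Im R).
Local Notation C := R[i].
Local Notation bas := (@Defs.basis R _).
Variable n : nat.
Local Notation Ph := ('rV[R]_n * 'rV[R]_n)%type.
Variables rho delta : R.
Hypothesis rho0 : 0 <= rho.
Hypothesis delta0 : 0 <= delta.
Hypothesis delta1 : delta < 1.
Local Notation symb := (@symb R n rho delta).
Implicit Types (a b : Ph -> C) (t x eta y : 'rV[R]_n) (p : Ph) (th : R).

(* Under the Fourier transform, [elliptic1 j] is multiplication by 1 + y_j^2. *)
Definition elliptic1 (j : 'I_n) a p : C :=
  a p - ((2 * pi) ^- 2)%:C * cderive (pb (inr j)) (cderive (pb (inr j)) a) p.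

(** Each factor occurs twice, to undo the square in [sqwgt]. *)
Definition elliptic a : Ph -> C := foldr (fun j a => elliptic1 j (elliptic1 j a)) a (enum 'I_n).

Lemma symb_elliptic1 m j a : symb m a -> symb m (elliptic1 j a).
Proof.
move=> sa; apply: symbB => //; apply: symbZ.
apply: (@symb_weaken _ n rho delta _ _ (m - rho - rho)) => //.
  by rewrite -addrA gerDl -opprD oppr_le0 addr_ge0.
exact: (symb_der (inr j) (symb_der (inr j) sa)).
Qed.

Lemma der_elliptic1 m j k a : symb m a -> cderive (pb k) (elliptic1 j a) = elliptic1 j (cderive (pb k) a).
Proof.
move=> sa; have s1 := symb_der (inr j) sa; have s2 := symb_der (inr j) s1.
have E : cderive (pb k) (cderive (pb (inr j)) (cderive (pb (inr j)) a)) =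
    cderive (pb (inr j)) (cderive (pb (inr j)) (cderive (pb k) a)).
  by rewrite (symb_clairaut k (inr j) s1) (symb_clairaut k (inr j) sa).
apply/funext => p; apply: is_cder_cderive.
have H := is_cderB (symb_is_cder k p sa)
  (is_cderZ (((2 * pi) ^- 2)%:C) (symb_is_cder k p s2)).
by move: H; rewrite E.
Qed.

Lemma symb_elliptic m a : symb m a -> symb m (elliptic a).
Proof.
move=> sa; rewrite /elliptic; elim: (enum _) => //= j r IH.
by do 2 apply: symb_elliptic1.
Qed.

Lemma der_elliptic m k a : symb m a -> cderive (pb k) (elliptic a) = elliptic (cderive (pb k) a).
Proof.
move=> sa; rewrite /elliptic; elim: (enum _) => //= j r IH.
have sr : symb m (foldr (fun j a => elliptic1 j (elliptic1 j a)) a r).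
  by elim: (r) => //= i s H; do 2 apply: symb_elliptic1.
by rewrite (der_elliptic1 _ _ (symb_elliptic1 j sr)) (der_elliptic1 _ _ sr) IH.
Qed.

Definition m2pi : R := - (2 * pi).
Lemma m2piE : m2pi = - (2 * pi). Proof. by []. Qed.

Lemma m2pi_neq0 : m2pi != 0.
Proof. by rewrite oppr_eq0 mulf_neq0// gt_eqF// pi_gt0. Qed.

(* [amp v b th p] is the Fourier transform of y |-> v y * b (p.1 + th y, p.2). *)
Definition amp_integrand v b th p eta y : C := chr m2pi eta y * v y * b (p.1 + th *: y, p.2).
Definition amp v b th p eta : C := cint (amp_integrand v b th p eta).

Lemma ccont_shift1 b th p y : (forall p, ccont b p) ->
  ccont (fun y => b (p.1 + th *: y, p.2)) y.
Proof.
move=> cb; apply: (ccont_comp (h := b) (g := fun y => (p.1 + th *: y, p.2))) (cb _).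
apply: continuous_pair; last exact: continuous_for_cst.
apply: (@continuousD _ _ _ (fun=> p.1) (fun y => th *: y)); first exact: continuous_for_cst.
exact: (@scaler_continuous _ _ th).
Qed.

Lemma amp_integrand_cdom v b m : wcl 1 v -> symb m b -> exists2 K, 0 <= K &
  forall th p eta, cdom (K * jap p.2 `^ m) (amp_integrand v b th p eta).
Proof.
move=> wv sb; have [Kv Kv0 vK] := wcl_bound wv; have [Kb Kb0 bK] := symb_bound sb.
exists (Kv * Kb); first exact: mulr_ge0.
move=> th p eta; split => y.
  apply: ccontM; first by apply: ccontM; [exact: ccont_chrr|exact: wcl_cont wv].
  by apply: ccont_shift1 => q; exact: symb_cont sb.
rewrite /amp_integrand !normcM normc_chr mul1r [leRHS](_ : _ = (Kv * wgt y) * (Kb * jap p.2 `^ m)); last by ring.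
by apply: ler_pM; rewrite ?normc_ge0//; exact: (bK (_, p.2)).
Qed.

Lemma amp_bound v b m : wcl 1 v -> symb m b -> exists2 K, 0 <= K &
  forall th p eta, normc (amp v b th p eta) <= K * jap p.2 `^ m.
Proof.
move=> wv sb; have [K K0 dK] := amp_integrand_cdom wv sb.
exists (2 * (K * pi ^+ n)); first by rewrite !mulr_ge0// exprn_ge0// pi_ge0.
move=> th p eta; apply: le_trans (cint_le (dK th p eta)) _.
by rewrite le_eqVlt; apply/orP; left; apply/eqP; ring.
Qed.

Lemma continuous_jap_powR m (p : Ph) : {for p, continuous (fun p : Ph => jap p.2 `^ m)}.
Proof.
rewrite (_ : (fun p : Ph => jap p.2 `^ m) = (fun p : Ph => expR (m * ln (jap p.2)))); last first.
  by apply/funext => q; rewrite /powR gt_eqF// jap_gt0.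
apply: (continuous_for_comp (f := @expR R) (g := fun p : Ph => m * ln (jap p.2))); last exact: continuous_expR.
apply: (@continuousM _ _ (fun=> m) (fun p : Ph => ln (jap p.2))); first exact: continuous_for_cst.
apply: (continuous_for_comp (f := @ln R) (g := fun p : Ph => jap p.2)); last by apply: continuous_ln; exact: jap_gt0.
apply: (continuous_for_comp (f := @jap R n) (g := fun p : Ph => p.2)); last exact: continuous_jap.
exact: cvg_snd.
Qed.

(** Joint continuity in th, the phase point and eta, from which the later continuity claims follow
    by substitution. *)
Lemma amp_cont v b m (q : R * Ph * 'rV[R]_n) : wcl 1 v -> symb m b ->
  ccont (fun q : R * Ph * 'rV[R]_n => amp v b q.1.1 q.1.2 q.2) q.
Proof.
move=> wv sb; have [K K0 dK] := amp_integrand_cdom wv sb.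
have c11 : {for q, continuous (fun q : R * Ph * 'rV[R]_n => q.1.1)}.
  exact: (continuous_for_comp (f := fst) (g := fst) cvg_fst cvg_fst).
have c12 : {for q, continuous (fun q : R * Ph * 'rV[R]_n => q.1.2)}.
  exact: (continuous_for_comp (f := snd) (g := fst) cvg_fst cvg_snd).
have c2 : {for q, continuous (fun q : R * Ph * 'rV[R]_n => q.2)} by exact: cvg_snd.
apply: (cint_continuous_loc (K := fun q => K * jap q.1.2.2 `^ m)
  (F := fun q => amp_integrand v b q.1.1 q.1.2 q.2)).
- apply: (@continuousM _ _ (fun=> K) (fun q => jap q.1.2.2 `^ m)); first exact: continuous_for_cst.
  apply: (continuous_for_comp (f := fun p : Ph => jap p.2 `^ m)
    (g := fun q : R * Ph * 'rV[R]_n => q.1.2)) c12 _.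
  exact: continuous_jap_powR.
- by move=> r; exact: dK.
- move=> y; rewrite /amp_integrand; apply: ccontM; first apply: ccontM.
  + by apply: ccont_chr => //; exact: continuous_for_cst.
  + exact: ccont_cst.
  + apply: (ccont_comp (h := b) (g := fun q : R * Ph * 'rV[R]_n => (q.1.2.1 + q.1.1 *: y, q.1.2.2))); last exact: symb_cont sb.
    apply: continuous_pair; last exact: (continuous_for_comp (f := snd) c12 cvg_snd).
    have cA : {for q, continuous (fun q : R * Ph * 'rV[R]_n => q.1.2.1)}.
      exact: (continuous_for_comp (f := fst) c12 cvg_fst).
    have cB : {for q, continuous (fun q : R * Ph * 'rV[R]_n => q.1.1 *: y)}.
      apply: (continuous_for_comp (f := fun s : R => s *: y) c11).
      exact: scalel_continuous.
    exact: (continuousD cA cB).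
Qed.

Lemma jap_line t j (s : R) : `|s| < 1 -> jap (t + s *: bas j) <= 2 * jap t.
Proof.
move=> s1; have b1 : `|s *: bas j : 'rV[R]_n| <= `|s|.
  rewrite normrZ ler_piMr// [leLHS]mx_normrE; apply/bigmax_leP; split => // -[a i] _ /=.
  by rewrite /Defs.basis !mxE; case: (_ && _); rewrite ?normr1 ?normr0.
have := ler_normD t (s *: bas j); rewrite /jap; have := normr_ge0 t; lra.
Qed.

Lemma jap_line_powR p k (s m : R) : `|s| < 1 ->
  jap (p + s *: pb k).2 `^ m <= 2 `^ `|m| * jap p.2 `^ m.
Proof.
move=> s1; case: k => j /=.
  rewrite scaler0 addr0 ler_peMl ?powR_ge0//.
  by rewrite -[leLHS](powRr0 2) ler_powR// ler1n.
apply: powR_compare; rewrite ?jap_gt0 ?ler1n//; first exact: jap_line.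
rewrite -{1}[p.2](addrK (s *: bas j)) -scaleNr; apply: jap_line.
by rewrite normrN.
Qed.

Lemma amp_der v b m k th p eta : wcl 1 v -> symb m b ->
  is_cder (pb k) (fun p => amp v b th p eta) p (amp v (cderive (pb k) b) th p eta).
Proof.
move=> wv sb; have sb' := symb_der k sb.
have [K K0 dK] := amp_integrand_cdom wv sb; have [K' K'0 dK'] := amp_integrand_cdom wv sb'.
pose m' := m + pwt rho delta k.
(* A common majorant of function and derivative along the whole segment: for [|u| < 1] the weight
   [jap] changes by a factor of at most 2. *)
pose M := K * (2 `^ `|m| * jap p.2 `^ m) + K' * (2 `^ `|m'| * jap p.2 `^ m').
have M1 : K * (2 `^ `|m| * jap p.2 `^ m) <= M by rewrite lerDl !mulr_ge0 ?powR_ge0.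
have M2 : K' * (2 `^ `|m'| * jap p.2 `^ m') <= M by rewrite lerDr !mulr_ge0 ?powR_ge0.
apply/is_cder_line.
have := @cint_derive _ n (fun u => amp_integrand v b th (p + u *: pb k) eta)
  (fun u => amp_integrand v (cderive (pb k) b) th (p + u *: pb k) eta) M.
rewrite /= scale0r addr0; apply.
- move=> u u1; apply: cdomW (dK _ _ _); apply: le_trans M1; rewrite ler_wpM2l//.
  exact: jap_line_powR.
- move=> u y _; rewrite /amp_integrand.
  have H : is_cder (1 : R) (fun u : R => b ((p + u *: pb k).1 + th *: y, (p + u *: pb k).2)) u
     (cderive (pb k) b ((p + u *: pb k).1 + th *: y, (p + u *: pb k).2)).
    have E (u' : R) : ((p + u' *: pb k).1 + th *: y, (p + u' *: pb k).2) =
      (p.1 + th *: y, p.2) + u' *: pb k.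
      by congr (_, _); rewrite /= addrAC.
    under eq_fun do rewrite E; rewrite E.
    by apply: is_cder_line_at; exact: symb_is_cder sb.
  exact: is_cderZ.
- move=> u y u1; apply: le_trans ((dK' _ _ _).2 _) _.
  rewrite ler_wpM2r ?(ltW (wgt_gt0 _))//; apply: le_trans M2; rewrite ler_wpM2l//.
  exact: jap_line_powR.
Qed.

Lemma amp_der_eta v b m j th p eta : wcl 1 v -> wcl 1 (fun y => (y 0 j)%:C * v y) ->
  symb m b ->
  is_cder (bas j) (amp v b th p) eta
    (m2pi%:C * 'i * amp (fun y => (y 0 j)%:C * v y) b th p eta).
Proof.
move=> wv wv' sb.
have [K K0 dK] := amp_integrand_cdom wv sb; have [K' K'0 dK'] := amp_integrand_cdom wv' sb.
have dZ eta' := cdomZ (m2pi%:C * 'i) (dK' th p eta').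
rewrite -(cintZ _ (dK' th p eta)).
pose M1 := K * jap p.2 `^ m; pose M2 := normc (m2pi%:C * 'i) * (K' * jap p.2 `^ m).
have M10 : 0 <= M1 by rewrite mulr_ge0 ?powR_ge0.
have M20 : 0 <= M2 by rewrite !mulr_ge0 ?powR_ge0 ?normc_ge0.
apply/is_cder_line.
have := @cint_derive _ n (fun u => amp_integrand v b th p (eta + u *: bas j))
  (fun u y => m2pi%:C * 'i * amp_integrand (fun y => (y 0 j)%:C * v y) b th p (eta + u *: bas j) y) (M1 + M2).
rewrite /= scale0r addr0; apply.
- by move=> u u1; apply: cdomW (dK _ _ _); rewrite lerDl.
- move=> u y _; rewrite /amp_integrand.
  have h1 := is_cder_line_at (is_cder_chrl m2pi (eta + u *: bas j) y j).
  have h2 := is_cderM (is_cderM h1 (is_cder_cst _ (v y) _)) (is_cder_cst _ (b (p.1 + th *: y, p.2)) _).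
  by apply: is_cder_eq h2 _; rewrite rmorphM/=; ring.
- move=> u y u1; apply: le_trans ((dZ _).2 _) _.
  by rewrite ler_wpM2r ?(ltW (wgt_gt0 _))// lerDr.
Qed.

Lemma amp_der_th v b m th p eta : wcl 1 v ->
  (forall j, wcl 1 (fun y => (y 0 j)%:C * v y)) -> symb m b ->
  is_cder (1 : R) (fun th => amp v b th p eta) th
    (\sum_(j < n) amp (fun y => (y 0 j)%:C * v y) (cderive (pb (inl j)) b) th p eta).
Proof.
move=> wv wv' sb.
have [K K0 dK] := amp_integrand_cdom wv sb.
have /choice[K' dK'] : forall j, exists K, forall th p eta, cdom (K * jap p.2 `^ (m + delta))
    (amp_integrand (fun y => (y 0 j)%:C * v y) (cderive (pb (inl j)) b) th p eta).
  by move=> j; have [K' _ dK'] := amp_integrand_cdom (wv' j) (symb_der (inl j) sb); exists K'.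
rewrite -(cint_sum (index_enum 'I_n) (fun j => dK' j th p eta)).
have dS th' := cdom_sum (index_enum 'I_n) (fun j => dK' j th' p eta).
set S := \sum_(j <- index_enum 'I_n) _ in dS.
have S0 := cdom_ge0 (dS 0).
pose M1 := K * jap p.2 `^ m.
have M10 : 0 <= M1 by rewrite mulr_ge0 ?powR_ge0.
apply/is_cder_line.
have := @cint_derive _ n (fun u => amp_integrand v b (th + u *: (1 : R)) p eta)
  (fun u y => \sum_(j <- index_enum 'I_n) amp_integrand (fun y => (y 0 j)%:C * v y) (cderive (pb (inl j)) b)
     (th + u *: (1 : R)) p eta y) (M1 + S).
rewrite /= scale0r addr0; apply.
- by move=> u u1; apply: cdomW (dK _ _ _); rewrite lerDl.
- move=> u y _; rewrite /amp_integrand.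
  (* Moving th moves [t + th y] in the direction (y, 0), which is expanded in the basis so that only
     partial derivatives of [b] occur. *)
  have sE : \sum_(j <- index_enum 'I_n) y 0 j *: pb (inl j) = (y, 0) :> Ph.
    rewrite [y in RHS]row_sum_delta; apply/eqP; rewrite -pair_eqE /pair_eq/=.
    rewrite (big_morph fst (fun _ _ => erefl) erefl) (big_morph snd (fun _ _ => erefl) erefl)/=.
    by rewrite eqxx/= big1// => j _; rewrite scaler0.
  have H := @is_cder_lincomb R Ph 'I_n (index_enum 'I_n) (fun j => pb (inl j)) (fun j => y 0 j)
    b (fun j => cderive (pb (inl j)) b) (p.1 + (th + u *: (1 : R)) *: y, p.2)
    (fun i q => symb_is_cder (inl i) q sb) (fun i => symb_cont _ (symb_der (inl i) sb)).
  rewrite sE in H.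
  have H2 : is_cder (1 : R) (fun u : R => b (p.1 + (th + u *: (1 : R)) *: y, p.2)) u
     (\sum_(j <- index_enum 'I_n) (y 0 j)%:C * cderive (pb (inl j)) b (p.1 + (th + u *: (1 : R)) *: y, p.2)).
    have E (u' : R) : (p.1 + (th + u' *: (1 : R)) *: y, p.2) = (p.1 + th *: y, p.2) + u' *: (y, 0) :> Ph.
      by congr (_, _); rewrite /= ?scaler0 ?addr0// scalerDl scaler1 addrA.
    under eq_fun do rewrite E.
    by apply: is_cder_line_at; rewrite -E.
  apply: is_cder_eq (is_cderZ (chr m2pi eta y * v y) H2) _.
  by rewrite mulr_sumr; apply: eq_bigr => j _; ring.
- move=> u y u1; apply: le_trans ((dS _).2 _) _.
  by rewrite ler_wpM2r ?(ltW (wgt_gt0 _))// lerDr.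
Qed.

(** A factor eta_j is traded for a derivative in y. On [v] it is harmless; on [b] it brings out th
    and raises the order by delta. *)
Lemma amp_ibp v b m j th p eta : wcl 1 v -> symb m b ->
  (m2pi * eta 0 j)%:C * 'i * amp v b th p eta =
  - (amp (cderive (bas j) v) b th p eta + th%:C * amp v (cderive (pb (inl j)) b) th p eta).
Proof.
move=> wv sb; have wv' := wcl_der j wv; have sb' := symb_der (inl j) sb.
have [K1 _ /(_ th p eta) d1] := amp_integrand_cdom wv sb.
have [K2 _ /(_ th p eta) d2] := amp_integrand_cdom wv' sb.
have [K3 _ /(_ th p eta) d3] := amp_integrand_cdom wv sb'.
have d1' := cdomZ ((m2pi * eta 0 j)%:C * 'i) d1.
have d3' := cdomZ th%:C d3; have d23 := cdomD d2 d3'; have d123 := cdomD d1' d23.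
have H := @cint_ibp _ n j (`|K1 * jap p.2 `^ m| + `|normc ((m2pi * eta 0 j)%:C * 'i) * (K1 * jap p.2 `^ m) +
  (K2 * jap p.2 `^ m + normc th%:C * (K3 * jap p.2 `^ (m + pwt rho delta (inl j))))|)
  (amp_integrand v b th p eta) (fun y => ((m2pi * eta 0 j)%:C * 'i) * amp_integrand v b th p eta y +
  (amp_integrand (cderive (bas j) v) b th p eta y +
   th%:C * amp_integrand v (cderive (pb (inl j)) b) th p eta y)).
move: H; rewrite (cintD d1' d23) (cintD d2 d3') (cintZ _ d1) (cintZ _ d3) => H.
apply/eqP; rewrite -addr_eq0; apply/eqP; apply: H.
- by apply: cdomW d1; rewrite (le_trans (ler_norm _))// lerDl.
- by apply: cdomW d123; rewrite (le_trans (ler_norm _))// lerDr.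
- move=> y; rewrite /amp_integrand.
  have db' : is_cder (bas j) (fun y => b (p.1 + th *: y, p.2)) y
      (th%:C * cderive (pb (inl j)) b (p.1 + th *: y, p.2)).
    apply/is_cder_line.
    have h := is_cder_scale th (symb_is_cder (inl j) (p.1 + th *: y, p.2) sb).
    move/is_cder_line : h; apply: eq_is_cder => // s; congr b; congr (_, _).
      by rewrite /= scalerDr addrA !scalerA mulrC.
    by rewrite /= !scaler0 addr0.
  have h2 := is_cderM (is_cderM (is_cder_chr m2pi eta y j) (wcl_is_cder j y wv)) db'.
  by apply: is_cder_eq h2 _; ring.
Qed.

Lemma normc_iM (r : R) (z : C) : normc (r%:C * 'i * z) = `|r| * normc z.
Proof.
rewrite !normcM normcR -[normc 'i]/(Num.sqrt (0 ^+ 2 + 1 ^+ 2)).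
by rewrite expr0n expr1n add0r sqrtr1 mulr1.
Qed.

(** Each power of eta_j costs at most delta in the order of [b]. The chain rule factor th has to be
    bounded; the bound 2 leaves room for the points [th + u] with [|th| <= 1] and [|u| < 1] met when
    differentiating in th. *)
Lemma amp_decay (L : nat) v b m j : wcl 1 v -> symb m b -> exists2 K, 0 <= K &
  forall th p eta, `|th| <= 2 ->
    `|eta 0 j| ^+ L * normc (amp v b th p eta) <= K * jap p.2 `^ (m + delta * L%:R).
Proof.
elim: L v b m => [|L IH] v b m wv sb.
  have [K K0 bK] := amp_bound wv sb; exists K => // th p eta _.
  by rewrite expr0 mul1r mulr0 addr0.
have [K1 K10 bK1] := IH _ _ _ (wcl_der j wv) sb.
have [K2 K20 bK2] := IH _ _ _ wv (symb_der (inl j) sb).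
exists (`|m2pi|^-1 * (K1 + 2 * K2)); first by rewrite mulr_ge0 ?invr_ge0// addr_ge0// mulr_ge0.
move=> th p eta th2.
have -> : `|eta 0 j| ^+ L.+1 * normc (amp v b th p eta) =
    `|m2pi|^-1 * (`|eta 0 j| ^+ L * normc ((m2pi * eta 0 j)%:C * 'i * amp v b th p eta)).
  rewrite normc_iM normrM exprS.
  by field; rewrite normr_eq0 m2pi_neq0.
rewrite (amp_ibp _ _ _ _ wv sb) normcN -[leRHS]mulrA ler_wpM2l ?invr_ge0//.
apply: le_trans (ler_wpM2l (exprn_ge0 _ (normr_ge0 _)) (normcD _ _)) _.
rewrite mulrDr mulrDl lerD//.
  apply: le_trans (bK1 th p eta th2) _; rewrite ler_wpM2l// jap_powR_mono//.
  by rewrite lerD2l ler_wpM2l// ler_nat.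
rewrite normcM normcR mulrCA -mulrA ler_pM ?mulr_ge0 ?exprn_ge0 ?normc_ge0//.
apply: le_trans (bK2 th p eta th2) _; rewrite ler_wpM2l// jap_powR_mono//=.
by rewrite -addrA lerD2l -natr1; lra.
Qed.

Lemma amp_decay_jap (L : nat) v b m : wcl 1 v -> symb m b -> exists2 K, 0 <= K &
  forall th p eta, `|th| <= 2 ->
    jap eta ^+ L * normc (amp v b th p eta) <= K * jap p.2 `^ (m + delta * L%:R).
Proof.
move=> wv sb; have [K0 K00 bK0] := amp_bound wv sb.
have /choice[K KP] : forall j, exists K, 0 <= K /\ forall th p eta, `|th| <= 2 ->
    `|eta 0 j| ^+ L * normc (amp v b th p eta) <= K * jap p.2 `^ (m + delta * L%:R).
  by move=> j; have [K ? ?] := amp_decay L j wv sb; exists K.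
exists (2 ^+ L * (K0 + \sum_j K j)).
  rewrite mulr_ge0 ?exprn_ge0// addr_ge0// sumr_ge0// => j _.
  by have [] := KP j.
move=> th p eta th2; apply: le_trans (ler_wpM2r (normc_ge0 _) (jap_pow_le eta L)) _.
rewrite -!mulrA ler_wpM2l ?exprn_ge0// !mulrDl mul1r lerD//.
  apply: le_trans (bK0 th p eta) _; rewrite ler_wpM2l// jap_powR_mono//.
  by rewrite lerDl mulr_ge0.
rewrite !mulr_suml; apply: ler_sum => j _.
by have [_] := KP j; exact.
Qed.

Lemma normr_powR_ge (x y c : R) : 0 < x -> 0 < y -> x <= 2 * y -> 0 <= c ->
  y `^ (- c) <= 2 `^ c * x `^ (- c).
Proof.
move=> x0 y0 xy c0; rewrite !powRN ler_pdivlMr ?powR_gt0// mulrC ler_pdivrMr ?powR_gt0//.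
rewrite -(powRM _ (ltW (_ : 0 < 2)) (ltW y0))//.
by apply: ge0_ler_powR; rewrite ?nnegrE ?mulr_ge0// ltW.
Qed.

(* Near the diagonal [|eta| <= jap x / 2] the symbol [a] is comparable with its value
   at [x] and only the volume factor is lost; far from it, the decay of [amp] in [eta]
   beats its growth in [x] because [delta < 1]. *)
Lemma main_bound a b v m1 m2 : symb m1 a -> symb m2 b -> wcl 1 v ->
  exists2 K, 0 <= K & forall th t x eta, `|th| <= 2 ->
    normc (a (t, x + eta)) * normc (amp v b th (t, x) eta) <=
    K * jap x `^ (m1 + m2 + 2 * n%:R) * wgt eta.
Proof.
move=> sa sb wv; have [Ka Ka0 aK] := symb_bound sa; have [K0 K00 bK0] := amp_bound wv sb.
pose N : R := 2 * n%:R; have N0 : 0 <= N by rewrite mulr_ge0.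
(* Far from the diagonal the exponent of [jap x] becomes m2 + delta L - (L - |m1| - N), and 2 |m1|
   <= (1 - delta) L keeps it below m1 + m2 + N. The summands |m1| + N make L - |m1| - N
   nonnegative. *)
pose L := Num.bound (2 * `|m1| / (1 - delta) + `|m1| + N).
have d1 : 0 < 1 - delta by rewrite subr_gt0.
have LP : 2 * `|m1| / (1 - delta) + `|m1| + N <= L%:R.
  rewrite ltW// archi_boundP// !addr_ge0// mulr_ge0 ?mulr_ge0//.
  by rewrite invr_ge0 ltW.
have q0 : 0 <= 2 * `|m1| / (1 - delta) by rewrite !mulr_ge0// invr_ge0 ltW.
have L1 : 2 * `|m1| <= (1 - delta) * L%:R.
  have -> : 2 * `|m1| = (1 - delta) * (2 * `|m1| / (1 - delta)).
    by field; rewrite gt_eqF.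
  rewrite ler_wpM2l ?(ltW d1)// (le_trans _ LP)//.
  by have := normr_ge0 m1; lra.
have L2 : 0 <= L%:R - `|m1| - N by lra.
have [K1 K10 bK1] := amp_decay_jap L wv sb.
pose c1 := Ka * 2 `^ `|m1| * K0 * 2 `^ N.
pose c2 := Ka * 3 `^ `|m1| * K1 * 2 `^ (L%:R - `|m1| - N).
have c10 : 0 <= c1 by rewrite !mulr_ge0 ?powR_ge0.
have c20 : 0 <= c2 by rewrite !mulr_ge0 ?powR_ge0.
exists (c1 + c2); first exact: addr_ge0.
move=> th t x eta th2.
have jx := jap_gt0 x; have je := jap_gt0 eta.
have X0 := powR_ge0 (jap x) (m1 + m2 + N).
have wj := jap_le_wgt eta; rewrite -/N in wj.
have [near_|far] := leP (`|eta|) (jap x / 2).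
  apply: (@le_trans _ _ (c1 * jap x `^ (m1 + m2 + N) * wgt eta)); last first.
    by rewrite !ler_wpM2r ?(ltW (wgt_gt0 _))// lerDl.
  have ha : normc (a (t, x + eta)) <= Ka * (2 `^ `|m1| * jap x `^ m1).
    apply: le_trans (aK _) _; rewrite ler_wpM2l//; apply: powR_compare; rewrite ?jap_gt0//.
    - by rewrite ler1n.
    - have := ler_normD x eta; have := normr_ge0 x; move: near_; rewrite /jap /=; lra.
    - have := ler_normB (x + eta) eta; rewrite addrK.
      move: near_; rewrite /jap /=; lra.
  (* Near the diagonal [jap eta <= 2 * jap x], so a factor [wgt eta] may be inserted at the price of
     [jap x ^ N]. *)
  have hw : 1 <= 2 `^ N * jap x `^ N * wgt eta.
    rewrite -(powRM _ (ler0n _ 2) (ltW jx)).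
    apply: le_trans (ler_wpM2l (powR_ge0 _ _) wj).
    rewrite powRN ler_pdivlMr ?powR_gt0// mul1r.
    apply: ge0_ler_powR; rewrite ?nnegrE ?mulr_ge0 ?(ltW je) ?(ltW jx)//.
    by move: near_; have := jap_ge1 x; rewrite /jap; lra.
  apply: le_trans (ler_pM (normc_ge0 _) (normc_ge0 _) ha (bK0 th (t, x) eta)) _.
  rewrite [leRHS](_ : _ = (Ka * (2 `^ `|m1| * jap x `^ m1) * (K0 * jap x `^ m2)) *
      (2 `^ N * jap x `^ N * wgt eta)); last first.
    rewrite /c1 !powRD; [ring|..]; by rewrite (gt_eqF jx) implybT.
  by rewrite ler_peMr// !mulr_ge0 ?powR_ge0.
apply: (@le_trans _ _ (c2 * jap x `^ (m1 + m2 + N) * wgt eta)); last first.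
  by rewrite !ler_wpM2r ?(ltW (wgt_gt0 _))// lerDr.
have x2e : jap x <= 2 * jap eta by move: far; rewrite /jap; lra.
have ha : normc (a (t, x + eta)) <= Ka * (3 `^ `|m1| * jap eta `^ `|m1|).
  apply: le_trans (aK _) _; rewrite ler_wpM2l//=.
  apply: le_trans (jap_powR_mono _ (ler_norm m1)) _.
  rewrite -(powRM _ (ler0n _ 3) (ltW je)).
  apply: ge0_ler_powR; rewrite ?nnegrE ?mulr_ge0 ?(ltW je) ?(ltW (jap_gt0 _))//.
  have := ler_normD x eta; move: x2e; rewrite /jap; lra.
have hh : normc (amp v b th (t, x) eta) <= K1 * jap x `^ (m2 + delta * L%:R) * jap eta `^ (- L%:R).
  rewrite powRN powR_mulrn ?(ltW je)// ler_pdivlMr ?exprn_gt0// mulrC.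
  exact: bK1.
apply: le_trans (ler_pM (normc_ge0 _) (normc_ge0 _) ha hh) _.
(* The power of [jap eta] is split: the part - N is dominated by [wgt eta], the rest becomes decay
   in x through [jap x <= 2 * jap eta]. *)
have e1 : jap eta `^ `|m1| * jap eta `^ (- L%:R) =
    jap eta `^ (- (L%:R - `|m1| - N)) * jap eta `^ (- N).
  rewrite -!powRD; [|by rewrite (gt_eqF je) implybT..]; by congr (_ `^ _); ring.
rewrite [leLHS](_ : _ = Ka * 3 `^ `|m1| * K1 * jap x `^ (m2 + delta * L%:R) *
   (jap eta `^ `|m1| * jap eta `^ (- L%:R))); last by ring.
rewrite e1.
have e2 := normr_powR_ge jx je x2e L2.
apply: (@le_trans _ _ (Ka * 3 `^ `|m1| * K1 * jap x `^ (m2 + delta * L%:R) *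
   (2 `^ (L%:R - `|m1| - N) * jap x `^ (- (L%:R - `|m1| - N)) * wgt eta))).
  rewrite ler_wpM2l ?mulr_ge0 ?powR_ge0//.
  by apply: ler_pM; rewrite ?powR_ge0.
rewrite [leLHS](_ : _ = c2 * (jap x `^ (m2 + delta * L%:R) * jap x `^ (- (L%:R - `|m1| - N))) *
   wgt eta); last by rewrite /c2; ring.
rewrite ler_wpM2r ?(ltW (wgt_gt0 _))// ler_wpM2l//.
rewrite -powRD; last by rewrite (gt_eqF jx) implybT.
apply: jap_powR_mono.
have := ler_norm (- m1); rewrite normrN; move: L1; set l := L%:R; lra.
Qed.

(* c_th of the header. *)
Definition comp_integrand a b th p eta : C := elliptic a (p.1, p.2 + eta) * amp (@sqwgt R n) b th p eta.
Definition comp_symb a b th p : C := cint (comp_integrand a b th p).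

Section comp_symb_estimates.
Variables (a b : Ph -> C) (m1 m2 : R).
Hypotheses (sa : symb m1 a) (sb : symb m2 b).

(** For general [v], since [sqwgt] and its products with coordinates both occur. *)
Lemma mul_amp_cdom a' v : symb m1 a' -> wcl 1 v -> exists2 K, 0 <= K & forall th p, `|th| <= 2 ->
  cdom (K * jap p.2 `^ (m1 + m2 + 2 * n%:R))
    (fun eta => a' (p.1, p.2 + eta) * amp v b th p eta).
Proof.
move=> sa' wv; have [K K0 bK] := main_bound sa' sb wv; exists K => // th p th2.
split => eta; last by rewrite normcM; case: p => t x; exact: bK.
apply: ccontM.
  apply: (ccont_comp (h := a') (g := fun eta => (p.1, p.2 + eta))) (symb_cont _ sa').
  apply: continuous_pair; first exact: continuous_for_cst.
  exact: (continuousD (@continuous_for_cst _ _ p.2 eta) (@continuous_for_id _ eta)).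
apply: (ccont_comp (h := fun q : R * Ph * 'rV[R]_n => amp v b q.1.1 q.1.2 q.2)
  (g := fun eta => (th, p, eta))); last exact: (amp_cont _ wv sb).
exact: continuous_pairr.
Qed.

Lemma comp_integrand_cdom : exists2 K, 0 <= K & forall th p, `|th| <= 2 ->
  cdom (K * jap p.2 `^ (m1 + m2 + 2 * n%:R)) (comp_integrand a b th p).
Proof. exact: (mul_amp_cdom (symb_elliptic sa) (wcl_sqwgt n)). Qed.

Lemma comp_symb_bound : exists2 K, 0 <= K & forall th p, `|th| <= 2 ->
  normc (comp_symb a b th p) <= K * jap p.2 `^ (m1 + m2 + 2 * n%:R).
Proof.
have [K K0 dK] := comp_integrand_cdom; exists (2 * (K * pi ^+ n)).
  by rewrite !mulr_ge0// exprn_ge0// pi_ge0.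
move=> th p th2; apply: le_trans (cint_le (dK th p th2)) _.
by rewrite le_eqVlt; apply/orP; left; apply/eqP; ring.
Qed.

Lemma comp_symb_cont th p : `|th| <= 2 -> ccont (comp_symb a b th) p.
Proof.
move=> th2; have [K K0 dK] := comp_integrand_cdom; have sP := symb_elliptic sa.
apply: (cint_continuous_loc (K := fun p => K * jap p.2 `^ (m1 + m2 + 2 * n%:R))).
- apply: (@continuousM _ _ (fun=> K) (fun p : Ph => jap p.2 `^ _)); first exact: continuous_for_cst.
  exact: continuous_jap_powR.
- by move=> r; exact: dK.
- move=> eta; apply: ccontM.
    apply: (ccont_comp (h := elliptic a) (g := fun p : Ph => (p.1, p.2 + eta))) (symb_cont _ sP).
    apply: continuous_pair; first exact: cvg_fst.
    apply: (@continuousD _ _ _ (fun p : Ph => p.2) (fun=> eta)); first exact: cvg_snd.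
    exact: continuous_for_cst.
  apply: (ccont_comp (h := fun q : R * Ph * 'rV[R]_n => amp (@sqwgt R n) b q.1.1 q.1.2 q.2)
    (g := fun p => (th, p, eta))); last exact: (amp_cont _ (wcl_sqwgt n) sb).
  apply: continuous_pair; last exact: continuous_for_cst.
  exact: continuous_pairr.
Qed.

End comp_symb_estimates.

Lemma comp_symb_der a b m1 m2 k th p : symb m1 a -> symb m2 b -> `|th| <= 2 ->
  is_cder (pb k) (comp_symb a b th) p
    (comp_symb (cderive (pb k) a) b th p + comp_symb a (cderive (pb k) b) th p).
Proof.
move=> sa sb th2; have sP := symb_elliptic sa.
have sa' := symb_der k sa; have sb' := symb_der k sb.
have [K K0 dK] := comp_integrand_cdom sa sb.
have [K1 K10 dK1] := comp_integrand_cdom sa' sb; have [K2 K20 dK2] := comp_integrand_cdom sa sb'.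
rewrite -(cintD (dK1 th p th2) (dK2 th p th2)).
set M := m1 + m2 + 2 * n%:R in dK.
set M1 := _ + _ + _ in dK1; set M2 := _ + _ + _ in dK2.
pose B := K * (2 `^ `|M| * jap p.2 `^ M) + (K1 * (2 `^ `|M1| * jap p.2 `^ M1) +
   K2 * (2 `^ `|M2| * jap p.2 `^ M2)).
apply/is_cder_line.
have := @cint_derive _ n (fun u => comp_integrand a b th (p + u *: pb k))
  (fun u eta => comp_integrand (cderive (pb k) a) b th (p + u *: pb k) eta +
     comp_integrand a (cderive (pb k) b) th (p + u *: pb k) eta) B.
rewrite /= scale0r addr0; apply.
- move=> u u1; apply: cdomW (dK _ _ th2); rewrite (@le_trans _ _ (K * (2 `^ `|M| * jap p.2 `^ M)))//.
    by rewrite ler_wpM2l//; exact: jap_line_powR.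
  by rewrite lerDl addr_ge0// !mulr_ge0 ?powR_ge0.
- move=> u eta _; rewrite /comp_integrand.
  have h1 : is_cder (1 : R) (fun u : R => elliptic a ((p + u *: pb k).1, (p + u *: pb k).2 + eta)) u
     (elliptic (cderive (pb k) a) ((p + u *: pb k).1, (p + u *: pb k).2 + eta)).
    have E (u' : R) : ((p + u' *: pb k).1, (p + u' *: pb k).2 + eta) =
      (p.1, p.2 + eta) + u' *: pb k.
      by congr (_, _); rewrite /= addrAC.
    under eq_fun do rewrite E; rewrite E -(der_elliptic k sa).
    by apply: is_cder_line_at; exact: symb_is_cder sP.
  have h2 : is_cder (1 : R) (fun u : R => amp (@sqwgt R n) b th (p + u *: pb k) eta) u
      (amp (@sqwgt R n) (cderive (pb k) b) th (p + u *: pb k) eta).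
    apply: (is_cder_line_at (f := fun p => amp (@sqwgt R n) b th p eta)).
    exact: (amp_der _ _ _ _ (wcl_sqwgt n) sb).
  exact: is_cderM.
- move=> u eta u1; apply: le_trans (normcD _ _) _.
  apply: le_trans (lerD ((dK1 _ _ th2).2 eta) ((dK2 _ _ th2).2 eta)) _.
  rewrite -mulrDl ler_wpM2r ?(ltW (wgt_gt0 _))//.
  apply: (@le_trans _ _ (K1 * (2 `^ `|M1| * jap p.2 `^ M1) + K2 * (2 `^ `|M2| * jap p.2 `^ M2))).
    by rewrite lerD// ler_wpM2l//; exact: jap_line_powR.
  by rewrite lerDr !mulr_ge0 ?powR_ge0.
Qed.

End symbol_calculus.

(** * Fourier inversion *)

Section inversion.
Context {R : realType}.
Local Notation Re := (@complex.Re R).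
Local Notation Im := (@complex.Im R).
Local Notation C := R[i].
Local Notation bas := (@Defs.basis R _).
Variable n : nat.
Local Notation Ph := ('rV[R]_n * 'rV[R]_n)%type.
Variables rho delta : R.
Hypothesis rho0 : 0 <= rho.
Hypothesis delta0 : 0 <= delta.
Hypothesis delta1 : delta < 1.
Local Notation symb := (@symb R n rho delta).
Local Notation m2pi := (@m2pi R).
Local Notation sqwgt := (@sqwgt R n).
Implicit Types (a b : Ph -> C) (t x eta y : 'rV[R]_n) (p : Ph) (th : R) (v : 'rV[R]_n -> C).

(** A Schwartz function is encoded as an amplitude that ignores its parameter, so the results on
    [sch] and [osc] apply as they stand. *)
Definition schv v := sch (fun p : Ph => v p.2).
Definition fourier v eta : C := osc m2pi (fun p : Ph => v p.2) eta.

Lemma fourierE v eta : fourier v eta = cint (fun y => chr m2pi eta y * v y).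
Proof. by []. Qed.

Lemma eq_fourier v w : v =1 w -> fourier v = fourier w.
Proof. by move=> /funext ->. Qed.

Lemma schv_coord v j : schv v -> schv (fun y => (y 0 j)%:C * v y).
Proof. by move=> sv; apply: (schM_symb (m := 1)) sv; exact: symb_coord. Qed.

Lemma schvD v w : schv v -> schv w -> schv (fun y => v y + w y).
Proof. by move=> sv sw; exact: schD. Qed.

Lemma eq_schv v w : v =1 w -> schv v -> schv w.
Proof. by move=> /funext ->. Qed.

Lemma fourier_sch v : schv v -> schv (fourier v).
Proof. by move=> sv; apply: osc_sch => //; exact: m2pi_neq0. Qed.

Lemma fourier_der v j eta : schv v ->
  is_cder (bas j) (fourier v) eta (m2pi%:C * 'i * fourier (fun y => (y 0 j)%:C * v y) eta).
Proof.
move=> sv; have sv' := schv_coord j sv.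
apply: is_cder_eq (osc_der m2pi j eta sv) _.
have [K dK] := osc_cdom m2pi sv'; rewrite /fourier /osc -(cintZ _ (dK eta)).
apply: eq_cint => y.
rewrite (is_cder_cderive (is_cder_snd0 j v (eta, y))) addr0/= rmorphM/=; ring.
Qed.

Lemma fourier_ibp v (v' : 'rV[R]_n -> C) j eta : schv v ->
  (forall y, is_cder (bas j) v y (v' y)) ->
  (m2pi * eta 0 j)%:C * 'i * fourier v eta = - fourier v' eta.
Proof.
move=> sv dv; rewrite /fourier osc_ibp//; congr (- osc _ _ _).
apply/funext => p; apply: is_cder_cderive; exact: is_cder_snd.
Qed.

Lemma shift_cdom a m x t v : symb m a -> schv v ->
  exists K, cdom K (fun eta => a (t, x + eta) * v eta).
Proof.
move=> sa sv; have [K K0 aK] := symb_bound sa.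
(* The part [- m] of the exponent cancels the growth of [a] in eta, and [- 2 * n%:R] makes the
   product dominated by [wgt]. *)
have [L L0 vL] := symb_bound (sv (- m - 2 * n%:R)).
exists (K * jap x `^ `|m| * L); split => eta.
  apply: ccontM; last exact: (ccont_slice (t := 0) (symb_cont _ (sv 0))).
  apply: (ccont_comp (h := a) (g := fun eta => (t, x + eta))) (symb_cont _ sa).
  apply: continuous_pair; first exact: continuous_for_cst.
  exact: (continuousD (@continuous_for_cst _ _ x eta) (@continuous_for_id _ eta)).
have je := jap_gt0 eta.
have h1 : normc (a (t, x + eta)) <= K * (jap x `^ `|m| * jap eta `^ m).
  apply: le_trans (aK _) _; rewrite ler_wpM2l//= addrC; exact: peetre.
have h2 := vL (0, eta); rewrite /= in h2.
rewrite normcM; apply: le_trans (ler_pM (normc_ge0 _) (normc_ge0 _) h1 h2) _.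
rewrite [leLHS](_ : _ = K * jap x `^ `|m| * L * (jap eta `^ m * jap eta `^ (- m - 2 * n%:R))); last by ring.
rewrite ler_wpM2l ?mulr_ge0 ?powR_ge0// -powRD; last by rewrite (gt_eqF je) implybT.
by rewrite addrA subrr add0r jap_le_wgt.
Qed.

Lemma is_cder_shift a m j x t eta : symb m a ->
  is_cder (bas j) (fun eta => a (t, x + eta)) eta (cderive (pb (inr j)) a (t, x + eta)).
Proof.
move=> sa; apply/is_cder_line.
have /is_cder_line H := symb_is_cder (inr j) (t, x + eta) sa.
apply: eq_is_cder H => // s; congr a; congr (_, _) => /=.
  by rewrite scaler0 addr0.
by rewrite addrA.
Qed.

Lemma shift_ibp a m j x t v : symb m a -> schv v ->
  cint (fun eta => cderive (pb (inr j)) a (t, x + eta) * fourier v eta) =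
  - (m2pi%:C * 'i * cint (fun eta => a (t, x + eta) * fourier (fun y => (y 0 j)%:C * v y) eta)).
Proof.
move=> sa sv; have sa' := symb_der (inr j) sa; have sv' := schv_coord j sv.
have [K d1] := shift_cdom x t sa (fourier_sch sv).
have [K' d2] := shift_cdom x t sa' (fourier_sch sv).
have [K'' d3] := shift_cdom x t sa (fourier_sch sv').
have d4 := cdomZ (m2pi%:C * 'i) d3; have d5 := cdomD d2 d4.
have := cint_ibp (j := j) (K := `|K| + `|K' + normc (m2pi%:C * 'i) * K''|)
  (f := fun eta => a (t, x + eta) * fourier v eta)
  (f' := fun eta => cderive (pb (inr j)) a (t, x + eta) * fourier v eta +
     m2pi%:C * 'i * (a (t, x + eta) * fourier (fun y => (y 0 j)%:C * v y) eta)).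
rewrite (cintD d2 d4) (cintZ _ d3) => H.
apply/eqP; rewrite -addr_eq0; apply/eqP; apply: H.
- by apply: cdomW d1; rewrite (le_trans (ler_norm _))// lerDl.
- by apply: cdomW d5; rewrite (le_trans (ler_norm _))// lerDr.
- move=> eta; apply: is_cder_eq (is_cderM (is_cder_shift j x t eta sa) (fourier_der j eta sv)) _.
  by ring.
Qed.

Lemma m2pi_sqr : (m2pi%:C * 'i) ^+ 2 = - ((2 * pi) ^+ 2)%:C.
Proof.
rewrite exprMn (_ : 'i ^+ 2 = -1); last by rewrite sqr_i.
by rewrite -rmorphXn /= m2piE sqrrN mulrN1.
Qed.

(** Two integrations by parts bring out [(m2pi%:C * 'i) ^+ 2], that is - (2 pi)^2, which the
    coefficient - (2 pi)^-2 in [elliptic1] turns into 1. *)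
Lemma fourier_elliptic1 a m j x t v : symb m a -> schv v ->
  cint (fun eta => elliptic1 j a (t, x + eta) * fourier v eta) =
  cint (fun eta => a (t, x + eta) * fourier (fun y => (1 + y 0 j ^+ 2)%:C * v y) eta).
Proof.
move=> sa sv; have sa1 := symb_der (inr j) sa; have sa2 := symb_der (inr j) sa1.
have sv1 := schv_coord j sv; have sv2 := schv_coord j sv1.
have [K0 d0] := shift_cdom x t sa (fourier_sch sv).
have [K2 d2] := shift_cdom x t sa2 (fourier_sch sv).
have [K3 d3] := shift_cdom x t sa (fourier_sch sv2).
pose c := ((2 * pi) ^- 2 : R)%:C.
have -> : cint (fun eta => elliptic1 j a (t, x + eta) * fourier v eta) =
    cint (fun eta => a (t, x + eta) * fourier v eta) +
    (- c) * cint (fun eta => cderive (pb (inr j)) (cderive (pb (inr j)) a) (t, x + eta) * fourier v eta).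
  rewrite -(cintZ _ d2) -(cintD d0 (cdomZ (- c) d2)); apply: eq_cint => eta.
  by rewrite /elliptic1 -/c; ring.
rewrite (shift_ibp j x t sa1 sv) (shift_ibp j x t sa sv1).
set J := cint _; set J2 := cint _.
have cE : - c * - (m2pi%:C * 'i * - (m2pi%:C * 'i * J2)) = J2.
  transitivity (- c * (m2pi%:C * 'i) ^+ 2 * J2); first by ring.
  rewrite m2pi_sqr mulrNN /c -rmorphM/= mulVf ?mul1r// expf_neq0// mulf_neq0// gt_eqF//.
  exact: pi_gt0.
rewrite cE /J /J2 -(cintD d0 d3); apply: eq_cint => eta.
rewrite -mulrDr; congr (_ * _); rewrite !fourierE.
have [L0 dL0] := osc_cdom m2pi sv; have [L2 dL2] := osc_cdom m2pi sv2.
rewrite -(cintD (dL0 eta) (dL2 eta)); apply: eq_cint => y /=.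
by rewrite rmorphD rmorph1 rmorphXn/= expr2; ring.
Qed.

Lemma schv_sqr v j : schv v -> schv (fun y => (1 + y 0 j ^+ 2)%:C * v y).
Proof.
move=> sv; have := schvD sv (schv_coord j (schv_coord j sv)).
by apply: eq_schv => y; rewrite rmorphD rmorph1 rmorphXn/= expr2; ring.
Qed.

Lemma foldr_ibp (r : seq 'I_n) a m x t v : symb m a -> schv v ->
  cint (fun eta => foldr (fun j a => elliptic1 j (elliptic1 j a)) a r (t, x + eta) * fourier v eta) =
  cint (fun eta => a (t, x + eta) *
    fourier (fun y => (\prod_(j <- r) (1 + y 0 j ^+ 2) ^+ 2)%:C * v y) eta).
Proof.
move=> sa; elim: r v => [|j r IH] v sv /=.
  by apply: eq_cint => eta; congr (_ * _); rewrite (@eq_fourier _ v)// => y; rewrite big_nil mul1r.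
have sr : symb m (foldr (fun j a => elliptic1 j (elliptic1 j a)) a r).
  by elim: (r) => //= i s H; do 2 apply: symb_elliptic1 => //.
rewrite (fourier_elliptic1 j x t (symb_elliptic1 rho0 j sr) sv) (fourier_elliptic1 j x t sr (schv_sqr j sv)).
rewrite (IH _ (schv_sqr j (schv_sqr j sv))); apply: eq_cint => eta; congr (_ * _).
rewrite (@eq_fourier _ (fun y => (\prod_(i <- j :: r) (1 + y 0 i ^+ 2) ^+ 2)%:C * v y))// => y.
by rewrite big_cons !rmorphM/=; ring.
Qed.

Lemma wcl_symb v : wcl 0 v -> forall N, bclass (@pb R n) (pwt 0 1) (@japp R n) N 0 (fun p => v p.2).
Proof.
move=> wv N; elim: N v wv => [|N IH] v wv.
  split => // [p _|]; first exact: (ccont_for_comp_snd (wcl_cont p.2 wv)).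
  by have [K K0 vK] := sclass_bound wv; exists K => p; have := vK p.2; rewrite !powRr0.
apply: (bclass_intro (@pb_neq0 R n) (F' := fun i (p : Ph) =>
  match i with inl _ => 0 | inr j => cderive (bas j) v p.2 end)).
- by move=> p; exact: (ccont_for_comp_snd (wcl_cont p.2 wv)).
- by have [K K0 vK] := sclass_bound wv; exists K => p; have := vK p.2; rewrite !powRr0.
- case=> j p; first exact: is_cder_snd0.
  by apply: is_cder_snd; exact: wcl_is_cder wv.
- case=> j; first by apply: bclass_zero; exact: pb_neq0.
  by rewrite /= oppr0 addr0; apply: IH; exact: wcl_der.
Qed.

Lemma schv_sqwgt v : schv v -> schv (fun y => sqwgt y * v y).
Proof.
move=> sv; apply: (schM_symb (m := 0)) sv => N; apply: wcl_symb.
by apply: wcl_weaken (wcl_sqwgt n).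
Qed.

(** The regularisation disappears in front of a Schwartz function: [elliptic] becomes multiplication
    by the inverse of [sqwgt]. The decay of [fourier v] is what keeps the right-hand integral
    absolutely convergent. *)
Lemma elliptic_ibp a m x t v : symb m a -> schv v ->
  cint (fun eta => elliptic a (t, x + eta) * fourier (fun y => sqwgt y * v y) eta) =
  cint (fun eta => a (t, x + eta) * fourier v eta).
Proof.
move=> sa sv; rewrite /elliptic (foldr_ibp _ x t sa (schv_sqwgt sv)).
apply: eq_cint => eta; congr (_ * _); rewrite (@eq_fourier _ v)// => y.
have E : (\prod_(j <- enum 'I_n) (1 + y 0 j ^+ 2) ^+ 2) * wgt y ^+ 2 = 1.
  rewrite /wgt -prodrXl big_enum/= -big_split/= big1// => j _.
  by rewrite -exprMn divff ?expr1n// gt_eqF// ltr_pwDl// sqr_ge0.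
by rewrite mulrA sqwgtE -rmorphM/= E mul1r.
Qed.

End inversion.

(** * Gaussians and their Fourier transforms *)

Section gaussian.
Context {R : realType}.
Local Notation Re := (@complex.Re R).
Local Notation Im := (@complex.Im R).
Local Notation C := R[i].
Local Notation bas := (@Defs.basis R _).
Variable n : nat.
Local Notation Ph := ('rV[R]_n * 'rV[R]_n)%type.
Local Notation m2pi := (@m2pi R).
Implicit Types (t x eta y : 'rV[R]_n) (p : Ph) (th s : R).

(** Any real [s] is allowed: [s = 0] gives the constant 1 and [s = -1] the reciprocal of [gau 1]. *)
Definition gau s y : C := (expR (- pi * s * dot y y))%:C.

Lemma sqr_norm_le_dot y : `|y| ^+ 2 <= dot y y.
Proof.
have [->|[j ->]] := norm_coord y; first by rewrite normr0 expr0n dot0l.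
rewrite real_normK ?num_real// /dot (bigD1 j)//= expr2 lerDl.
by apply: sumr_ge0 => i _; rewrite -expr2 sqr_ge0.
Qed.

Lemma gau_bound s m : 0 < s -> exists K, forall y, normc (gau s y) <= K * jap y `^ m.
Proof.
(* From [|m| * |y| <= s * |y|^2 + m^2 / s], after bounding the logarithm of [jap y] by [|y|]. *)
move=> s0; exists (expR (m ^+ 2 / s)) => y.
rewrite normcR ger0_norm ?expR_ge0// /powR gt_eqF ?jap_gt0// -expRD ler_expR.
have h1 : - (m * ln (jap y)) <= `|m| * `|y|.
  rewrite -mulNr; apply: (@le_trans _ _ (`|m| * ln (jap y))).
    by rewrite ler_wpM2r ?ln_ge0 ?jap_ge1// -normrN ler_norm.
  rewrite ler_wpM2l// /jap; apply: le_ln1Dx.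
  by have := normr_ge0 y; lra.
have h2 := sqr_norm_le_dot y.
have h3 : s * `|y| ^+ 2 <= pi * s * dot y y.
  rewrite -mulrA; apply: (@le_trans _ _ (s * dot y y)); first by rewrite ler_wpM2l// ltW.
  rewrite ler_peMl//; last by have := @pi_ge2 R; lra.
  by rewrite mulr_ge0 ?(ltW s0)// (le_trans (sqr_ge0 _) h2).
have h4 : `|m| * `|y| <= s * `|y| ^+ 2 + m ^+ 2 / s.
  rewrite -(ler_pM2l s0) mulrDr [s * (_ / s)]mulrC divfK ?gt_eqF//.
  have -> : m ^+ 2 = `|m| ^+ 2 by rewrite real_normK ?num_real.
  have := sqr_ge0 (`|m| - s * `|y|); have := sqr_ge0 `|m|; have := sqr_ge0 (s * `|y|); nra.
by rewrite mulNr mulNr; lra.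
Qed.

Lemma ccont_gau s y : ccont (gau s) y.
Proof.
apply: ccontR; apply: (continuous_for_comp (f := @expR R) (g := fun y => - pi * s * dot y y)); last exact: continuous_expR.
apply: (@continuousM _ _ (fun=> - pi * s) (fun y => dot y y)); first exact: continuous_for_cst.
by apply: continuous_dot; exact: continuous_for_id.
Qed.

Lemma is_cder_gau s j y : is_cder (bas j) (gau s) y (- (2 * pi * s)%:C * ((y 0 j)%:C * gau s y)).
Proof.
have E : is_derive y (bas j) (fun y => expR (- pi * s * dot y y))
   (- (2 * pi * s) * (y 0 j * expR (- pi * s * dot y y))).
  apply/is_derive_line.
  have F (u : R) : dot (y + u *: bas j) (y + u *: bas j) = dot y y + 2 * u * y 0 j + u ^+ 2 * dot (bas j) (bas j).
    by rewrite dotDl !dotDr !dotZl !dotZr (dotC (bas j) y) dot_basis; ring.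
  under eq_fun do rewrite F.
  have D : is_derive (0 : R) (1 : R) (fun u => - pi * s * (dot y y + 2 * u * y 0 j + u ^+ 2 * dot (bas j) (bas j)))
      (- pi * s * (2 * y 0 j)).
    by apply: is_derive_eq; rewrite /GRing.scale/=; ring.
  have := @is_derive1_comp R (@expR R) _ 0 _ _ (is_derive_expR _) D.
  move=> H; apply: (@is_derive_eq _ _ _ _ _ _ _ _ H).
  by rewrite !mulr0 mul0r expr0n/= mul0r !addr0; ring.
have := is_cderR E; apply: eq_is_cder => //.
by rewrite /gau -rmorphN -!rmorphM.
Qed.

Lemma schv_gau s : 0 < s -> schv (gau s).
Proof.
move=> s0 m N; elim: N m => [|N IH] m.
  split => // [p _|]; first by apply: (ccont_for_comp_snd (f := gau s)); exact: ccont_gau.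
  by have [K HK] := gau_bound m s0; exists K => p; exact: HK.
apply: (bclass_intro (@pb_neq0 R n) (F' := fun i (p : Ph) => match i with
  inl _ => 0 | inr j => - (2 * pi * s)%:C * ((p.2 0 j)%:C * gau s p.2) end)).
- by move=> p; apply: (ccont_for_comp_snd (f := gau s)); exact: ccont_gau.
- by have [K HK] := gau_bound m s0; exists K => p; exact: HK.
- by case=> j p; [exact: is_cder_snd0|apply: is_cder_snd; exact: is_cder_gau].
- case=> j; first by apply: bclass_zero; exact: pb_neq0.
  rewrite /= oppr0 addr0; apply: bclassZ; [exact: pb_neq0|exact: japp_gt0|].
  rewrite -[m](subrK 1) addrC.
  by apply: bclassM; [exact: pb_neq0|exact: japp_gt0|exact: (symb_coord j)|exact: IH].
Qed.

Lemma cint_gau : cint (gau 1) = 1.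
Proof.
rewrite /cint; apply: ReIm_eq => /=; last by have := congr1 Im (@cint0 R n).
rewrite -[RHS](@rint_gauss R n); congr rint; apply/funext => y.
rewrite -expR_sum; congr expR; rewrite mulr1 /dot mulr_sumr.
by apply: eq_bigr => j _; rewrite expr2.
Qed.

(* Both sides solve d_j f = - 2 pi eta_j f and agree at 0. *)
Lemma fourier_gau : fourier (gau 1) = gau 1.
Proof.
have sg := schv_gau ltr01.
have coordE j eta : fourier (fun y => (y 0 j)%:C * gau 1 y) eta = - (eta 0 j)%:C * 'i * fourier (gau 1) eta.
  have := fourier_ibp eta sg (is_cder_gau 1 j).
  have [K dK] := osc_cdom m2pi (schv_coord j sg).
  have -> : fourier (fun y => - (2 * pi * 1)%:C * ((y 0 j)%:C * gau 1 y)) eta =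
      m2pi%:C * fourier (fun y => (y 0 j)%:C * gau 1 y) eta.
    rewrite /fourier /osc -(cintZ _ (dK eta)); apply: eq_cint => y /=.
    by rewrite m2piE rmorphN mulr1; ring.
  have k0 : m2pi%:C != 0 :> C by rewrite (inj_eq (@complexI R)) m2pi_neq0.
  rewrite rmorphM/= => H; apply: (mulfI k0); apply: oppr_inj; rewrite -H; ring.
have der j eta : is_cder (bas j) (fourier (gau 1)) eta (- (2 * pi * 1)%:C * ((eta 0 j)%:C * fourier (gau 1) eta)).
  apply: is_cder_eq (fourier_der j eta sg) _; rewrite coordE m2piE mulr1 rmorphN.
  rewrite [LHS](_ : _ = (2 * pi : R)%:C * ('i ^+ 2 * ((eta 0 j)%:C * fourier (gau 1) eta))); last by ring.
  by rewrite sqr_i; ring.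
(* The quotient of the two sides. Its partial derivatives vanish, so it is constant on lines through
   0; at 0 it is the integral of [gau 1], which is 1. *)
pose H eta := fourier (gau 1) eta * (expR (pi * dot eta eta))%:C.
have eE eta : (expR (pi * dot eta eta))%:C = gau (-1) eta by rewrite /gau mulrN1 opprK.
have derH j eta : is_cder (bas j) H eta 0.
  rewrite /H; under eq_fun do rewrite eE.
  apply: is_cder_eq (is_cderM (der j eta) (is_cder_gau (-1) j eta)) _.
  by rewrite !mulr1 mulrN1 rmorphN; ring.
apply/funext => eta.
have lineH (s : R) : is_cder (1 : R) (fun s => H (s *: eta)) s 0.
  have := @is_cder_lincomb R 'rV[R]_n 'I_n (index_enum 'I_n) (fun j => bas j) (fun j => eta 0 j)
    H (fun j => fun=> 0) (s *: eta) derH (fun j => ccont_cst _ _).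
  rewrite -row_sum_delta big1 => [|j _]; last by rewrite mulr0.
  have -> : (fun s => H (s *: eta)) = (fun s => H (0 + s *: eta)) by apply/funext => u; rewrite add0r.
  by rewrite -{1}[s *: eta]add0r; exact: is_cder_line_at.
have cH : H eta = H 0.
  have c1 := @is_derive_0_is_cst R _ 1 0 (fun s => (lineH s).1).
  have c2 := @is_derive_0_is_cst R _ 1 0 (fun s => (lineH s).2).
  by apply: ReIm_eq; [move: c1|move: c2]; rewrite scale1r scale0r.
move: cH; rewrite /H dot0l mulr0 expR0 mulr1.
have -> : fourier (gau 1) 0 = 1.
  by rewrite fourierE -cint_gau; apply: eq_cint => y; rewrite /chr dot0l mulr0 expi0 mul1r.
move=> E; have e0 : (expR (pi * dot eta eta))%:C != 0 :> C.
  by rewrite (inj_eq (@complexI R)) gt_eqF// expR_gt0.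
apply: (mulIf e0); rewrite E /gau mulr1 -rmorphM/= -expRD mulNr addNr expR0.
by [].
Qed.

Lemma fourier_gau_scale th eta : 0 < th -> (th ^+ n)%:C * fourier (gau (th ^+ 2)) (th *: eta) = gau 1 eta.
Proof.
move=> th0; rewrite -fourier_gau !fourierE.
have [K dK] := osc_cdom m2pi (schv_gau (exprn_gt0 2 th0)).
pose f y := chr m2pi eta y * gau 1 y.
have E y : chr m2pi (th *: eta) y * gau (th ^+ 2) y = f (th *: y).
  by rewrite /f /chr /gau !dotZl !dotZr mulr1; congr (_ * (expR _)%:C); ring.
rewrite (eq_cint E) (@cint_scale _ _ K th f)//.
  by split => y; [apply: eq_ccont ((dK (th *: eta)).1 y) => z|rewrite -E; exact: (dK _).2];
    rewrite /= E.
by move=> y; apply: ccontM; [exact: ccont_chrr|exact: ccont_gau].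
Qed.

End gaussian.

(** * The value of c_th at th = 0 and its derivative in th *)

Section comp_symb_at_zero.
Context {R : realType}.
Local Notation Re := (@complex.Re R).
Local Notation Im := (@complex.Im R).
Local Notation C := R[i].
Local Notation bas := (@Defs.basis R _).
Variable n : nat.
Local Notation Ph := ('rV[R]_n * 'rV[R]_n)%type.
Variables rho delta : R.
Hypothesis rho0 : 0 <= rho.
Hypothesis delta0 : 0 <= delta.
Hypothesis delta1 : delta < 1.
Local Notation symb := (@symb R n rho delta).
Local Notation m2pi := (@m2pi R).
Local Notation sqwgt := (@sqwgt R n).
Implicit Types (a b : Ph -> C) (t x eta y z : 'rV[R]_n) (p : Ph) (th : R).

Lemma is_cder_fst (j : 'I_n) (f : 'rV[R]_n -> C) p d : is_cder (bas j) f p.1 d ->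
  is_cder (pb (inl j)) (fun q => f q.1) p d.
Proof.
move=> /is_cder_line H; apply/is_cder_line; apply: eq_is_cder H => // s.
Qed.

Lemma is_cder_fst0 (j : 'I_n) (f : 'rV[R]_n -> C) p :
  is_cder (pb (inr j)) (fun q => f q.1) p 0.
Proof.
apply/is_cder_line; apply: eq_is_cder (is_cder_cst _ (f p.1) _) => // s.
by rewrite /= scaler0 addr0.
Qed.

Lemma schv_bound v m : schv v -> exists2 K, 0 <= K & forall y, normc (v y) <= K * jap y `^ m.
Proof. by move=> sv; have [K K0 vK] := symb_bound (sv m); exists K => // y; exact: (vK (0, y)). Qed.

Lemma schv_cont v y : schv v -> ccont v y.
Proof. by move=> sv; exact: (ccont_slice (t := 0) (symb_cont _ (sv 0))). Qed.

Lemma schv_is_cder v j y : schv v -> is_cder (bas j) v y (cderive (bas j) v y).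
Proof.
move=> sv; have := is_cder_slice (symb_is_cder (inr j) (0, y) (sv 0)).
by move=> H; apply: is_cder_eq (H) _; rewrite -(is_cder_cderive H).
Qed.

Lemma schv_der (v : 'rV[R]_n -> C) j : schv v -> schv (cderive (bas j) v).
Proof.
move=> sv; have := sch_der (inr j) sv; congr sch.
Qed.

Lemma eq_cdom K (f g : 'rV[R]_n -> C) : f =1 g -> cdom K f -> cdom K g.
Proof. by move=> /funext ->. Qed.

Lemma symb_fst v : schv v -> symb 0 (fun p => v p.1).
Proof.
(* Generalised to all orders m >= 0, because a derivative in t leads to the order m + delta. *)
suff H N m : 0 <= m -> schv v -> bclass (@pb R n) (pwt rho delta) (@japp R n) N m (fun p => v p.1).
  by move=> sv N; exact: H.
elim: N m v => [|N IH] m v m0 sv.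
  split => // [p _|]; first by apply: (ccont_for_comp_fst (f := v)); exact: schv_cont.
  have [K K0 vK] := schv_bound 0 sv; exists K => p.
  by apply: le_trans (vK p.1) _; rewrite ler_wpM2l// powRr0 -(powRr0 (jap p.2)) jap_powR_mono.
apply: (bclass_intro (@pb_neq0 R n) (F' := fun i (p : Ph) => match i with
  inl j => cderive (bas j) v p.1 | inr _ => 0 end)).
- by move=> p; apply: (ccont_for_comp_fst (f := v)); exact: schv_cont.
- have [K K0 vK] := schv_bound 0 sv; exists K => p.
  by apply: le_trans (vK p.1) _; rewrite ler_wpM2l// powRr0 -(powRr0 (jap p.2)) jap_powR_mono.
- by case=> j p; [apply: is_cder_fst; exact: schv_is_cder|exact: is_cder_fst0].
- case=> j; last by apply: bclass_zero; exact: pb_neq0.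
  by apply: IH; [rewrite /= addr_ge0|exact: schv_der].
Qed.

Lemma symb_shift m F t : symb m F -> symb m (fun p => F (p.1 + t, p.2)).
Proof.
have cont m' H p : symb m' H -> ccont (fun p => H (p.1 + t, p.2)) p.
  move=> sH; apply: (ccont_comp (h := H) (g := fun p : Ph => (p.1 + t, p.2))) (symb_cont _ sH).
  apply: continuous_pair; last exact: cvg_snd.
  apply: (@continuousD _ _ _ (fun p : Ph => p.1) (fun=> t)); first exact: cvg_fst.
  exact: continuous_for_cst.
have bound m' H : symb m' H -> bounded_by (@japp R n) m' (fun p => H (p.1 + t, p.2)).
  by move=> /symb_bound[K K0 HK]; exists K => p; exact: (HK (p.1 + t, p.2)).
move=> sF N; elim: N m F sF => [|N IH] m F sF.
  by split => [p _||//]; [exact: cont sF|exact: bound].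
apply: (bclass_intro (@pb_neq0 R n) (F' := fun i p => cderive (pb i) F (p.1 + t, p.2))).
- by move=> p; exact: cont sF.
- exact: bound.
- move=> i p; apply/is_cder_line.
  have /is_cder_line := symb_is_cder i (p.1 + t, p.2) sF.
  by apply: eq_is_cder => // s; congr (F (_, _)); rewrite /= addrAC.
- by move=> i; apply: IH; exact: symb_der.
Qed.

Lemma jap_add_scale x z th m : `|th| <= 1 ->
  jap (x + th *: z) `^ m <= jap z `^ `|m| * jap x `^ m.
Proof.
move=> th1; have h : jap (th *: z) `^ `|m| <= jap z `^ `|m|.
  apply: ge0_ler_powR; first exact: normr_ge0.
  - by rewrite nnegrE ltW// jap_gt0.
  - by rewrite nnegrE ltW// jap_gt0.
  - by rewrite /jap lerD2l normrZ ler_piMl.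
exact: le_trans (peetre x (th *: z) m) (ler_wpM2r (powR_ge0 _ _) h).
Qed.

(** Serves to reach th = 0 from the values th in []0, 1[], where the Gaussian is a Schwartz
    function. *)
Lemma eq_right_limit (f g : R -> C) : ccont f 0 -> ccont g 0 ->
  (forall s, 0 < s < 1 -> f s = g s) -> f 0 = g 0.
Proof.
have key (u v : R -> R) : {for 0, continuous u} -> {for 0, continuous v} ->
    (forall s, 0 < s < 1 -> u s = v s) -> u 0 = v 0.
  move=> cu cv uv; apply/eqP; apply/negPn/negP => ne.
  have cd : {for 0, continuous (fun s => `|u s - v s|)}.
    apply: (continuous_for_comp (f := fun x : R => `|x|) (g := fun s => u s - v s)); last exact: norm_continuous.
    exact: continuousB.
  have d0 : 0 < `|u 0 - v 0| by rewrite normr_gt0 subr_eq0.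
  have : \forall s \near (0 : R), 0 < `|u s - v s| by apply: (cvgr_gt _ cd).
  move=> /nbhs_ballP[e /= e0] /(_ (Num.min e 1 / 2)).
  have m0 : 0 < Num.min e 1 by rewrite lt_min e0 ltr01.
  have m1 : Num.min e 1 <= e by rewrite ge_min lexx.
  have m2 : Num.min e 1 <= 1 by rewrite ge_min lexx orbT.
  rewrite -ball_normE /ball_/= sub0r normrN ger0_norm ?divr_ge0 ?(ltW m0)//.
  rewrite (_ : _ < e = true); last by lra.
  by move=> /(_ isT); rewrite (uv (Num.min e 1 / 2)) ?subrr ?normr0 ?ltxx//; lra.
move=> [f1 f2] [g1 g2] fg; apply: ReIm_eq.
  by apply: (key (fun s => Re (f s)) (fun s => Re (g s))) => // s /fg ->.
by apply: (key (fun s => Im (f s)) (fun s => Im (g s))) => // s /fg ->.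
Qed.

Lemma wgt_scale th z : 0 < th ->
  wgt (th *: z) <= (\prod_(j < n) (Num.max 1 (th ^- 2))) * wgt z.
Proof.
move=> th0; rewrite /wgt -big_split/=; apply: ler_prod => j _.
have t2 : 0 < th ^+ 2 by rewrite exprn_gt0.
have p0 : 0 < 1 + (th *: z) 0 j ^+ 2 by rewrite ltr_pwDl// sqr_ge0.
have q0 : 0 < 1 + z 0 j ^+ 2 by rewrite ltr_pwDl// sqr_ge0.
rewrite invr_ge0 (ltW p0)/= ler_pdivlMr// mulrC ler_pdivrMr//.
rewrite mxE exprMn; have z2 := sqr_ge0 (z 0 j).
have M1 : 1 <= Num.max 1 (th ^- 2) by rewrite le_max lexx.
have M2 : 1 <= Num.max 1 (th ^- 2) * th ^+ 2.
  by rewrite -[leLHS](@mulVf _ (th ^+ 2)) ?gt_eqF// ler_wpM2r ?(ltW t2)// le_max lexx orbT.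
by move: M1 M2; set M := Num.max _ _ => M1 M2; nra.
Qed.

(** The substitution eta = th z fixes the Gaussian and moves th into the argument of [a], where the
    limit th -> 0 is a matter of continuity. *)
Lemma cint_gau_scale a m t x th : symb m a -> 0 < th ->
  cint (fun eta => a (t, x + eta) * fourier (gau (th ^+ 2)) eta) =
  cint (fun z => a (t, x + th *: z) * gau 1 z).
Proof.
move=> sa th0; have sg := schv_gau n (exprn_gt0 2 th0); have sf := fourier_sch sg.
pose f eta := a (t, x + eta) * fourier (gau (th ^+ 2)) eta.
have c0 : (th ^+ n)%:C != 0 :> C by rewrite (inj_eq (@complexI R)) expf_neq0// gt_eqF.
have E z : a (t, x + th *: z) * gau 1 z = (th ^+ n)%:C * f (th *: z).
  by rewrite /f -(fourier_gau_scale z th0); ring.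
have [K dK] := shift_cdom x t sa sf.
have cf y : ccont f y := dK.1 y.
have [K' dK'] : exists K, cdom K (fun z => f (th *: z)).
  exists (K * (\prod_(j < n) (Num.max 1 (th ^- 2)))); split => z.
    by apply: (ccont_comp (h := f) (g := fun z => th *: z)); [exact: (@scaler_continuous _ _ th)|exact: cf].
  have wz : wgt (th *: z) <= (\prod_(j < n) (Num.max 1 (th ^- 2))) * wgt z.
    exact: wgt_scale.
  rewrite -mulrA; apply: le_trans (dK.2 (th *: z)) _.
  exact: (ler_wpM2l (cdom_ge0 dK) wz).
rewrite (eq_cint E) (cintZ _ dK').
by rewrite (@cint_scale _ _ K' th f).
Qed.

Lemma near0_le1 : \forall th \near (0 : R), `|th| <= 1.
Proof.
apply/nbhs_ballP; exists 1; first exact: ltr01.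
by move=> th; rewrite -ball_normE /ball_/= sub0r normrN => /ltW.
Qed.

Lemma cint_gau_cont a m t x : symb m a ->
  ccont (fun th => cint (fun z => a (t, x + th *: z) * gau 1 z)) 0.
Proof.
move=> sa; have nr := near0_le1.
have [K K0 aK] := symb_bound sa.
have [L L0 vL] := schv_bound (- `|m| - 2 * n%:R) (schv_gau n (@ltr01 R)).
apply: (cint_continuous (K := K * jap x `^ m * L)).
  apply: filterS nr => th th1; split => z.
    apply: ccontM; last exact: ccont_gau.
    apply: (ccont_comp (h := a) (g := fun z => (t, x + th *: z))) (symb_cont _ sa).
    apply: continuous_pair; first exact: continuous_for_cst.
    exact: (continuousD (@continuous_for_cst _ _ x z) (@scaler_continuous _ _ th z)).
  have jz := jap_gt0 z.
  have h1 : normc (a (t, x + th *: z)) <= K * (jap z `^ `|m| * jap x `^ m).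
    have h0 : jap (x + th *: z) `^ m <= jap z `^ `|m| * jap x `^ m.
      exact: jap_add_scale.
    exact: le_trans (aK (t, x + th *: z)) (ler_wpM2l K0 h0).
  rewrite normcM; apply: le_trans (ler_pM (normc_ge0 _) (normc_ge0 _) h1 (vL z)) _.
  rewrite [leLHS](_ : _ = K * jap x `^ m * L * (jap z `^ `|m| * jap z `^ (- `|m| - 2 * n%:R))); last by ring.
  rewrite ler_wpM2l ?mulr_ge0 ?powR_ge0// -powRD; last by rewrite (gt_eqF jz) implybT.
  by rewrite addrA subrr add0r jap_le_wgt.
move=> z; apply: ccontM; last exact: ccont_cst.
apply: (ccont_comp (h := a) (g := fun th => (t, x + th *: z))) (symb_cont _ sa).
apply: continuous_pair; first exact: continuous_for_cst.
exact: (continuousD (@continuous_for_cst _ _ x (0 : R)) (@scalel_continuous _ _ z (0 : R))).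
Qed.

(* Fourier inversion: replace [sqwgt] by [sqwgt * gau (th^2)], which makes [elliptic_ibp]
   applicable, and let th tend to 0. *)
Lemma cint_elliptic_sqwgt a m t x : symb m a ->
  cint (fun eta => elliptic a (t, x + eta) * fourier sqwgt eta) = a (t, x).
Proof.
move=> sa; have sP := symb_elliptic rho0 sa.
(* The Gaussian factor in the guise of a symbol centred at [t]: with [bG] in place of [b], [amp] is
   the transform of [sqwgt * gau (th ^+ 2)], and the bounds on [amp], uniform in th, dominate the
   limit. *)
pose bG (p : Ph) := gau 1 (p.1 - t).
have sG : symb 0 bG.
  by apply: (symb_shift (F := fun p => gau 1 p.1)); apply: symb_fst; exact: schv_gau.
pose f th := cint (fun eta => elliptic a (t, x + eta) * amp sqwgt bG th (t, x) eta).
pose g th := cint (fun z => a (t, x + th *: z) * gau 1 z).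
have ampE th eta : amp sqwgt bG th (t, x) eta = fourier (fun y => sqwgt y * gau (th ^+ 2) y) eta.
  rewrite fourierE; apply: eq_cint => y; rewrite /amp_integrand /bG /= addrC addKr -mulrA; congr (_ * (_ * _)).
  by rewrite /gau dotZl dotZr; congr ((expR _)%:C); ring.
have g1 : gau 0 = (fun=> 1) :> ('rV[R]_n -> C) by apply/funext => y; rewrite /gau mulr0 mul0r expR0.
have f0 : f 0 = cint (fun eta => elliptic a (t, x + eta) * fourier sqwgt eta).
  apply: eq_cint => eta; rewrite ampE expr0n/= g1; congr (_ * _).
  by rewrite (@eq_fourier _ _ _ sqwgt)// => y; rewrite mulr1.
have g0 : g 0 = a (t, x).
  (* With [k = 0] the character is 1, and this is the domination of the Gaussian itself. *)
  have [K dK] := osc_cdom 0 (schv_gau n (@ltr01 R)).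
  have dK0 : cdom K (@gau R n 1).
    by apply: eq_cdom (dK 0) => y; rewrite /chr mul0r expi0 mul1r.
  rewrite -[RHS]mulr1 -(cint_gau n) -(cintZ _ dK0); apply: eq_cint => z.
  by rewrite scale0r addr0.
have fg th : 0 < th < 1 -> f th = g th.
  move=> /andP[th0 th1]; rewrite /f (eq_cint (g := fun eta => elliptic a (t, x + eta) * fourier (fun y => sqwgt y * gau (th ^+ 2) y) eta)); last by move=> eta; rewrite ampE.
  rewrite (elliptic_ibp rho0 x t sa (schv_gau n (exprn_gt0 2 th0))).
  exact: cint_gau_scale.
have nr := near0_le1.
have cf : ccont f 0.
  have [K K0 dK] := mul_amp_cdom delta0 delta1 sG sP (wcl_sqwgt n).
  apply: (cint_continuous (K := K * jap x `^ (m + 0 + 2 * n%:R))).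
    apply: filterS nr => th th1; apply: (dK th (t, x)).
    by apply: le_trans th1 _; rewrite ler1n.
  move=> eta; apply: ccontM; first exact: ccont_cst.
  apply: (ccont_comp (h := fun q : R * Ph * 'rV[R]_n => amp sqwgt bG q.1.1 q.1.2 q.2)
    (g := fun th => (th, (t, x), eta))); last exact: (amp_cont _ (wcl_sqwgt n) sG).
  apply: continuous_pair; last exact: continuous_for_cst.
  exact: continuous_pairl.
have cg : ccont g 0 by exact: (cint_gau_cont t x sa).
by rewrite -f0 -g0; exact: (eq_right_limit cf cg fg).
Qed.

(** At th = 0 the factor [b p] leaves the inner integral, and Fourier inversion evaluates what
    remains. *)
Lemma comp_symb_th0 a b m1 m2 p : symb m1 a -> symb m2 b -> comp_symb a b 0 p = a p * b p.
Proof.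
move=> sa sb; have [K K0 dK] := amp_integrand_cdom (wcl_sqwgt n) (@symb_cst R n rho delta 1).
have sP := symb_elliptic rho0 sa.
have ampE eta : amp sqwgt b 0 p eta = b p * fourier sqwgt eta.
  have E y : amp_integrand sqwgt (fun=> 1) 0 p eta y = chr m2pi eta y * sqwgt y by rewrite /amp_integrand mulr1.
  rewrite fourierE -(eq_cint E) -(cintZ _ (dK 0 p eta)); apply: eq_cint => y.
  by rewrite /amp_integrand scale0r addr0 -surjective_pairing; ring.
have [L L0 dL] := mul_amp_cdom delta0 delta1 (@symb_cst R n rho delta 1) sP (wcl_sqwgt n).
have := dL 0 p; rewrite normr0 => /(_ (ler0n _ _)) dL0.
case: p ampE dL0 => t x ampE dL0; rewrite -(cint_elliptic_sqwgt t x sa) mulrC.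
have E eta : amp sqwgt (fun=> 1) 0 (t, x) eta = fourier sqwgt eta.
  by rewrite fourierE; apply: eq_cint => y; rewrite /amp_integrand mulr1.
have dL1 : cdom (L * jap (t, x).2 `^ (m1 + 0 + 2 * n%:R)) (fun eta => elliptic a (t, x + eta) * fourier sqwgt eta).
  by apply: eq_cdom dL0 => eta; rewrite E.
rewrite -(cintZ _ dL1); apply: eq_cint => eta.
by rewrite /comp_integrand ampE; ring.
Qed.

(** This is 2 pi i, spelled as in [composition_term] so that the two expansions can be matched. *)
Definition ipi : C := 0 +i* (2 * pi).

Lemma m2pi_i : m2pi%:C * 'i = - ipi.
Proof. by apply: ReIm_eq; rewrite m2piE /ipi /=; ring. Qed.

Lemma ipi_neq0 : ipi != 0.
Proof.
rewrite -oppr_eq0 -m2pi_i mulf_neq0 ?neq0Ci//.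
by rewrite (inj_eq (@complexI R)) m2pi_neq0.
Qed.

(** Up to the factor - 2 pi i, multiplying the inner integrand by y_j is differentiating [amp] in
    eta_j; integration by parts moves that derivative to [a]. *)
Lemma comp_symb_ibp a b m1 m2 j p th : symb m1 a -> symb m2 b -> `|th| <= 2 ->
  cint (fun eta => elliptic a (p.1, p.2 + eta) * amp (fun y => (y 0 j)%:C * sqwgt y) b th p eta) =
  ipi^-1 * comp_symb (cderive (pb (inr j)) a) b th p.
Proof.
move=> sa sb th2; have sP := symb_elliptic rho0 sa; have sa' := symb_der (inr j) sa.
have [K1 _ /(_ th p th2) d1] := mul_amp_cdom delta0 delta1 sb sP (wcl_sqwgt n).
have [K2 _ /(_ th p th2) d2] := mul_amp_cdom delta0 delta1 sb (symb_elliptic rho0 sa') (wcl_sqwgt n).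
have [K3 _ /(_ th p th2) d3] := mul_amp_cdom delta0 delta1 sb sP (wcl_coord_sqwgt j).
have d3' := cdomZ (- ipi) d3; have d23 := cdomD d2 d3'.
set k1 := K1 * _ in d1; set k23 := _ + _ in d23.
have H := @cint_ibp _ n j (`|k1| + `|k23|) (fun eta => elliptic a (p.1, p.2 + eta) * amp sqwgt b th p eta)
  (fun eta => elliptic (cderive (pb (inr j)) a) (p.1, p.2 + eta) * amp sqwgt b th p eta +
   - ipi * (elliptic a (p.1, p.2 + eta) * amp (fun y => (y 0 j)%:C * sqwgt y) b th p eta)).
have {}H : comp_symb (cderive (pb (inr j)) a) b th p =
    ipi * cint (fun eta => elliptic a (p.1, p.2 + eta) * amp (fun y => (y 0 j)%:C * sqwgt y) b th p eta).
  apply/eqP; rewrite -subr_eq0 -mulNr; apply/eqP.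
  rewrite -(cintZ _ d3) /comp_symb -(cintD d2 d3'); apply: H.
  - by apply: cdomW d1; rewrite (le_trans (ler_norm _))// lerDl.
  - by apply: cdomW d23; rewrite (le_trans (ler_norm _))// lerDr.
  - move=> eta.
    have h1 : is_cder (bas j) (fun eta => elliptic a (p.1, p.2 + eta)) eta
        (elliptic (cderive (pb (inr j)) a) (p.1, p.2 + eta)).
      by rewrite -(der_elliptic rho0 (inr j) sa); exact: is_cder_shift sP.
    have h2 := amp_der_eta th p eta (wcl_sqwgt n) (wcl_coord_sqwgt j) sb.
    apply: is_cder_eq (is_cderM h1 h2) _; rewrite m2pi_i; ring.
by rewrite H mulrA mulVf ?ipi_neq0// mul1r.
Qed.

Lemma comp_symb_der_th a b m1 m2 p th : symb m1 a -> symb m2 b -> `|th| <= 1 ->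
  is_cder (1 : R) (fun th => comp_symb a b th p) th
    (ipi^-1 * \sum_(j < n) comp_symb (cderive (pb (inr j)) a) (cderive (pb (inl j)) b) th p).
Proof.
move=> sa sb th1; have sP := symb_elliptic rho0 sa.
have th2 : `|th| <= 2 by rewrite (le_trans th1)// ler1n.
have [K K0 dK] := mul_amp_cdom delta0 delta1 sb sP (wcl_sqwgt n).
have /choice[K' dK'] : forall j, exists K, forall th, `|th| <= 2 ->
    cdom K (fun eta => elliptic a (p.1, p.2 + eta) * amp (fun y => (y 0 j)%:C * sqwgt y) (cderive (pb (inl j)) b) th p eta).
  move=> j; have [K' _ dK'] := mul_amp_cdom delta0 delta1 (symb_der (inl j) sb) sP (wcl_coord_sqwgt j).
  by eexists => th' th'2; exact: (dK' th' p th'2).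
have -> : ipi^-1 * \sum_(j < n) comp_symb (cderive (pb (inr j)) a) (cderive (pb (inl j)) b) th p =
   \sum_(j < n) cint (fun eta => elliptic a (p.1, p.2 + eta) * amp (fun y => (y 0 j)%:C * sqwgt y) (cderive (pb (inl j)) b) th p eta).
  rewrite mulr_sumr; apply: eq_bigr => j _.
  by rewrite (comp_symb_ibp j p sa (symb_der (inl j) sb) th2).
rewrite -(cint_sum (index_enum 'I_n) (fun j => dK' j th th2)).
have dS th' (h : `|th'| <= 2) := cdom_sum (index_enum 'I_n) (fun j => dK' j th' h).
have S0 := cdom_ge0 (dS th th2).
set S := \sum_(j <- index_enum 'I_n) _ in dS S0.
pose M1 := K * jap p.2 `^ (m1 + m2 + 2 * n%:R).
have M10 : 0 <= M1 by rewrite mulr_ge0 ?powR_ge0.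
have thu (u : R) : `|u| < 1 -> `|th + u *: (1 : R)| <= 2.
  move=> u1; rewrite /GRing.scale/= mulr1 (le_trans (ler_normD _ _))//.
  by have := lerD th1 (ltW u1).
apply/is_cder_line.
have := @cint_derive _ n (fun u => comp_integrand a b (th + u *: (1 : R)) p)
  (fun u eta => \sum_(j <- index_enum 'I_n) elliptic a (p.1, p.2 + eta) *
     amp (fun y => (y 0 j)%:C * sqwgt y) (cderive (pb (inl j)) b) (th + u *: (1 : R)) p eta) (M1 + S).
rewrite /= scale0r addr0; apply.
- by move=> u u1; apply: cdomW (dK _ _ (thu u u1)); rewrite lerDl.
- move=> u eta _; rewrite /comp_integrand.
  have h := amp_der_th (th + u *: (1 : R)) p eta (wcl_sqwgt n) (@wcl_coord_sqwgt R n) sb.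
  rewrite -mulr_sumr; apply: is_cderZ.
  exact: (is_cder_line_at (f := fun th => amp sqwgt b th p eta)).
- move=> u eta u1; apply: le_trans ((dS _ (thu u u1)).2 _) _.
  by rewrite ler_wpM2r ?(ltW (wgt_gt0 _))// lerDr.
Qed.

End comp_symb_at_zero.

(** * The asymptotic expansion *)

Section asymptotics.
Context {R : realType}.
Local Notation Re := (@complex.Re R).
Local Notation Im := (@complex.Im R).
Local Notation C := R[i].
Local Notation bas := (@Defs.basis R _).
Variable n : nat.
Local Notation Ph := ('rV[R]_n * 'rV[R]_n)%type.
Variables rho delta : R.
Hypothesis rho0 : 0 <= rho.
Hypothesis delta0 : 0 <= delta.
Hypothesis delta1 : delta < 1.
Hypothesis delta_rho : delta < rho.
Local Notation symb := (@symb R n rho delta).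
Local Notation ipi := (@ipi R).
Implicit Types (a b : Ph -> C) (t x eta y z : 'rV[R]_n) (p : Ph) (th : R).

Lemma normc_mean_value (f f' : R -> C) (K th : R) : 0 <= th ->
  (forall s, 0 <= s <= th -> is_cder (1 : R) f s (f' s)) ->
  (forall s, 0 <= s <= th -> normc (f' s) <= K) ->
  normc (f th - f 0) <= 2 * (K * th).
Proof.
move=> th0 df f'K.
have key (u v : R -> R) : (forall s, 0 <= s <= th -> is_derive s (1 : R) u (v s)) ->
    (forall s, 0 <= s <= th -> `|v s| <= K) -> `|u th - u 0| <= K * th.
  move=> du vK.
  have [] := @MVT_segment _ u v 0 th th0.
  - by move=> s; rewrite in_itv/= => /andP[s0 s1]; apply: du; rewrite !ltW.
  - apply: derivable_within_continuous => s; rewrite in_itv/= => s1.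
    exact: (@ex_derive _ _ _ _ _ _ _ (du s s1)).
  - move=> s; rewrite in_itv/= => s1 ->; rewrite subr0 normrM (ger0_norm th0).
    by rewrite ler_wpM2r//; exact: vK.
apply: le_trans (normc_le_ReIm _) _; rewrite !ReD !ImD !ReN !ImN mulr2n mulrDl !mul1r.
apply: lerD.
  apply: (key (fun s => Re (f s)) (fun s => Re (f' s))) => s /[dup] /df[h _] // /f'K.
  exact: le_trans (Re_le_normc _).
apply: (key (fun s => Im (f s)) (fun s => Im (f' s))) => s /[dup] /df[_ h] // /f'K.
exact: le_trans (Im_le_normc _).
Qed.

(** Indexed by words of length k instead of multi-indices: the recursion is that of the derivative
    in th, and the multi-index alpha is counted |alpha|!/alpha! times. *)
Fixpoint exp_term k a b p : C := match k with
  | 0 => a p * b p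
  | k.+1 => \sum_(j < n) exp_term k (cderive (pb (inr j)) a) (cderive (pb (inl j)) b) p
  end.

Lemma symb_cast m m' F : m = m' -> symb m F -> symb m' F.
Proof. by move=> ->. Qed.

Lemma symb_exp_term k a b m1 m2 : symb m1 a -> symb m2 b ->
  symb (m1 + m2 - (rho - delta) * k%:R) (exp_term k a b).
Proof.
elim: k a b m1 m2 => [|k IH] a b m1 m2 sa sb.
  by apply: symb_cast (symbM sa sb); rewrite mulr0 subr0.
apply: symb_sum => j _; apply: symb_cast (IH _ _ _ _ (symb_der (inr j) sa) (symb_der (inl j) sb)).
by rewrite /= -natr1; ring.
Qed.

Lemma exp_term_der k i a b m1 m2 p : symb m1 a -> symb m2 b ->
  is_cder (pb i) (exp_term k a b) p (exp_term k (cderive (pb i) a) b p + exp_term k a (cderive (pb i) b) p).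
Proof.
elim: k a b m1 m2 => [|k IH] a b m1 m2 sa sb /=.
  by apply: is_cder_eq (is_cderM (symb_is_cder i p sa) (symb_is_cder i p sb)) _; ring.
rewrite -big_split/=.
have H := @is_cder_sum R Ph (pb i) 'I_n (index_enum 'I_n)
  (fun j p => exp_term k (cderive (pb (inr j)) a) (cderive (pb (inl j)) b) p)
  (fun j => exp_term k (cderive (pb i) (cderive (pb (inr j)) a)) (cderive (pb (inl j)) b) p +
     exp_term k (cderive (pb (inr j)) a) (cderive (pb i) (cderive (pb (inl j)) b)) p) p.
apply: is_cder_eq (H _) _.
  by move=> j; exact: (IH _ _ _ _ (symb_der (inr j) sa) (symb_der (inl j) sb)).
by apply: eq_bigr => j _; rewrite (symb_clairaut i (inr j) sa) (symb_clairaut i (inl j) sb).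
Qed.

(** Kept for every th, although th = 1 is the case of interest: the th-derivative of
    [remainder N.+1] is a combination of remainders of order N, which drives the induction. *)
Definition remainder N a b th p : C :=
  comp_symb a b th p - \sum_(k < N) (th%:C / ipi) ^+ k / k`!%:R * exp_term k a b p.

Lemma remainder0 a b th p : remainder 0 a b th p = comp_symb a b th p.
Proof. by rewrite /remainder big_ord0 subr0. Qed.

Lemma remainderS_th0 N a b m1 m2 p : symb m1 a -> symb m2 b -> remainder N.+1 a b 0 p = 0.
Proof.
move=> sa sb; rewrite /remainder (comp_symb_th0 rho0 delta0 delta1 p sa sb) big_ord_recl big1 => [|k _].
  by rewrite expr0 fact0 /= invr1 !mul1r addr0 subrr.
by rewrite mul0r exprS !mul0r.
Qed.

Lemma remainderS_der_th N a b m1 m2 p th : symb m1 a -> symb m2 b -> `|th| <= 1 ->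
  is_cder (1 : R) (fun th => remainder N.+1 a b th p) th
    (ipi^-1 * \sum_(j < n) remainder N (cderive (pb (inr j)) a) (cderive (pb (inl j)) b) th p).
Proof.
move=> sa sb th1.
have dI : is_cder (1 : R) (fun th => th%:C / ipi) th ipi^-1.
  have h : is_cder (1 : R) (fun th : R => th%:C) th 1%:C by apply: is_cderR; exact: is_derive_id.
  by apply: is_cder_eq (is_cderM h (is_cder_cst _ ipi^-1 th)) _; rewrite rmorph1; ring.
have dX k : is_cder (1 : R) (fun th => (th%:C / ipi) ^+ k) th (k%:R * (th%:C / ipi) ^+ k.-1 / ipi).
  elim: k => [|k IH]; first by apply: is_cder_eq (is_cder_cst _ _ _) _; rewrite !mul0r.
  under eq_fun do rewrite exprS.
  apply: is_cder_eq (is_cderM dI IH) _; rewrite -natr1 /=; case: k {IH} => [|k] /=; first by rewrite !expr0; ring.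
  by rewrite exprS; ring.
apply: is_cder_eq (is_cderB (comp_symb_der_th rho0 delta0 delta1 p sa sb th1) (is_cder_sum _ (fun k : 'I_N.+1 => is_cderM (is_cderM (dX k) (is_cder_cst _ (k`!%:R^-1) th)) (is_cder_cst _ (exp_term k a b p) th)))) _.
rewrite /remainder sumrB mulrBr; congr (_ - _).
rewrite exchange_big/= mulr_sumr big_ord_recl [X in X + _](_ : _ = 0); last first.
  by rewrite !mul0r !mulr0 !addr0 mul0r.
rewrite add0r; apply: eq_bigr => k _.
rewrite [nat_of_ord (lift ord0 k)]/= /bump/= add1n !mulr0 !addr0 /= -mulr_sumr factS natrM.
set S := \sum_(j < n) _; set T := (_ / _) ^+ k.
have k0 : k.+1%:R != 0 :> C by rewrite pnatr_eq0.
have f0 : k`!%:R != 0 :> C by rewrite pnatr_eq0 -lt0n fact_gt0.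
clearbody S T; move: k0 f0 (@ipi_neq0 R); move: k.+1%:R (k`!%:R) ipi => u v w u0 v0 w0.
by field; rewrite u0 v0 w0.
Qed.

Lemma remainder_der N i a b m1 m2 th p : symb m1 a -> symb m2 b -> `|th| <= 2 ->
  is_cder (pb i) (remainder N a b th) p (remainder N (cderive (pb i) a) b th p + remainder N a (cderive (pb i) b) th p).
Proof.
move=> sa sb th2.
apply: is_cder_eq (is_cderB (comp_symb_der rho0 delta0 delta1 i p sa sb th2)
  (is_cder_sum _ (fun k : 'I_N => is_cderZ ((th%:C / ipi) ^+ k / k`!%:R) (exp_term_der k i p sa sb)))) _.
rewrite /remainder [RHS]addrACA -opprD -big_split/=; congr (_ - _).
by apply: eq_bigr => k _; rewrite mulrDr.
Qed.

Lemma remainder_cont N a b m1 m2 th p : symb m1 a -> symb m2 b -> `|th| <= 2 -> ccont (remainder N a b th) p.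
Proof.
move=> sa sb th2; apply: ccontB; first exact: comp_symb_cont sa sb _ _ th2.
by apply: ccont_sum => k; apply: ccontM; [exact: ccont_cst|exact: symb_cont (symb_exp_term k sa sb)].
Qed.

(** The remainder of order N + 1 vanishes at th = 0 and is bounded through its th-derivative, where
    [a] has lost rho and [b] gained delta. Each step thus gains rho - delta, and the 2n of the base
    case is carried along unchanged. *)
Lemma remainder_bound N a b m1 m2 : symb m1 a -> symb m2 b -> exists2 K, 0 <= K & forall th p,
  0 <= th <= 1 ->
  normc (remainder N a b th p) <= K * jap p.2 `^ (m1 + m2 - (rho - delta) * N%:R + 2 * n%:R).
Proof.
elim: N a b m1 m2 => [|N IH] a b m1 m2 sa sb.
  have [K K0 bK] := comp_symb_bound rho0 delta0 delta1 sa sb; exists K => // th p /andP[th0 th1].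
  rewrite remainder0 mulr0 subr0; apply: bK; rewrite ger0_norm//.
  by apply: le_trans th1 _; rewrite ler1n.
have /choice[K KP] : forall j, exists K, 0 <= K /\ forall th p, 0 <= th <= 1 ->
    normc (remainder N (cderive (pb (inr j)) a) (cderive (pb (inl j)) b) th p) <=
    K * jap p.2 `^ (m1 + m2 - (rho - delta) * N.+1%:R + 2 * n%:R).
  move=> j; have [K K0 bK] := IH _ _ _ _ (symb_der (inr j) sa) (symb_der (inl j) sb).
  exists K; split => // th p h; have := bK th p h; congr (_ <= _ * _ `^ _).
  by rewrite /= -natr1; ring.
exists (2 * (normc ipi^-1 * \sum_j K j)).
  by rewrite !mulr_ge0 ?normc_ge0// sumr_ge0// => j _; have [] := KP j.
move=> th p /andP[th0 th1].
have le1 s : 0 <= s <= th -> `|s| <= 1.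
  by move=> /andP[s0 s1]; rewrite ger0_norm// (le_trans s1).
have := @normc_mean_value (fun th => remainder N.+1 a b th p) _
  (normc ipi^-1 * ((\sum_j K j) * jap p.2 `^ (m1 + m2 - (rho - delta) * N.+1%:R + 2 * n%:R))) th th0
  (fun s hs => remainderS_der_th N p sa sb (le1 s hs)).
rewrite (remainderS_th0 _ _ sa sb) subr0; set Z := normc _ => H; apply: le_trans (H _) _.
- move=> s /andP[s0 s1]; rewrite normcM; apply: ler_wpM2l; first exact: normc_ge0.
  apply: le_trans (normc_sum _ _ _) _; rewrite mulr_suml; apply: ler_sum => j _.
  have [_] := KP j; apply.
  by rewrite s0 (le_trans s1 th1).
- rewrite -!mulrA ler_wpM2l// ler_wpM2l ?normc_ge0//.
  have S0 : 0 <= \sum_j K j by rewrite sumr_ge0// => j _; have [] := KP j.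
  by rewrite ler_wpM2l// ler_piMr ?powR_ge0.
Qed.

(* [remainder (N + M)] obeys the lossy bound with an exponent that is small enough, and
   the additional terms are symbols of the right order. *)
Lemma remainder_bound_sharp N a b m1 m2 : symb m1 a -> symb m2 b ->
  bounded_by (@japp R n) (m1 + m2 - (rho - delta) * N%:R) (remainder N a b 1).
Proof.
move=> sa sb; have dr : 0 < rho - delta by rewrite subr_gt0.
(* The number of additional terms whose total gain (rho - delta) M covers the loss 2n. *)
pose M := Num.bound (2 * n%:R / (rho - delta)).
have MP : 2 * n%:R <= (rho - delta) * M%:R.
  rewrite [leRHS]mulrC -ler_pdivrMr//; apply: ltW; apply: archi_boundP.
  by rewrite divr_ge0 ?mulr_ge0// ltW.
have [K K0 EK] := remainder_bound (N + M) sa sb.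
have /choice[L LP] : forall k : 'I_M, exists L, 0 <= L /\ forall p,
    normc ((1%:C / ipi) ^+ (N + k) / (N + k)`!%:R * exp_term (N + k) a b p) <=
    L * jap p.2 `^ (m1 + m2 - (rho - delta) * N%:R).
  move=> k; have [L L0 SL] := symb_bound (symb_exp_term (N + k) sa sb).
  exists (normc ((1%:C / ipi) ^+ (N + k) / (N + k)`!%:R) * L); split.
    by rewrite mulr_ge0 ?normc_ge0.
  move=> p; rewrite normcM -mulrA; apply: ler_wpM2l; first exact: normc_ge0.
  apply: le_trans (SL p) (ler_wpM2l L0 (jap_powR_mono _ _)).
  rewrite lerD2l lerN2 ler_wpM2l ?(ltW dr)// ler_nat; exact: leq_addr.
exists (K + \sum_k L k) => p.
have E : remainder N a b 1 p = remainder (N + M) a b 1 p +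
    \sum_(k < M) (1%:C / ipi) ^+ (N + k) / (N + k)`!%:R * exp_term (N + k) a b p.
  by rewrite /remainder big_split_ord/= opprD addrA subrK.
rewrite E; apply: le_trans (normcD _ _) _; rewrite mulrDl; apply: lerD.
  apply: le_trans (EK 1 p _) (ler_wpM2l K0 (jap_powR_mono _ _)); first by rewrite ler01 lexx.
  rewrite natrD mulrDr; lra.
apply: le_trans (normc_sum _ _ _) _; rewrite mulr_suml; apply: ler_sum => k _.
by have [_] := LP k; exact.
Qed.

Lemma symb_remainder N a b m1 m2 : symb m1 a -> symb m2 b ->
  symb (m1 + m2 - (rho - delta) * N%:R) (remainder N a b 1).
Proof.
move=> sa sb M; elim: M a b m1 m2 sa sb => [|M IH] a b m1 m2 sa sb.
  split => // [p _|]; last exact: remainder_bound_sharp.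
  by apply: remainder_cont sa sb _; rewrite normr1 ler1n.
apply: (bclass_intro (@pb_neq0 R n) (F' := fun i p => remainder N (cderive (pb i) a) b 1 p + remainder N a (cderive (pb i) b) 1 p)).
- by move=> p; apply: remainder_cont sa sb _; rewrite normr1 ler1n.
- exact: remainder_bound_sharp.
- by move=> i p; apply: remainder_der sa sb _; rewrite normr1 ler1n.
- move=> i; apply: bclassD; first exact: pb_neq0.
    have := IH _ _ _ _ (symb_der i sa) sb; congr (bclass _ _ _ _ _); ring.
  have := IH _ _ _ _ sa (symb_der i sb); congr (bclass _ _ _ _ _); ring.
Qed.

End asymptotics.

(** * Powers of commuting operators *)

Section mpower_commutation.
Variables (n : nat) (T K : Type) (D : K -> T -> T) (S : T -> Prop).
Hypothesis SD : forall k F, S F -> S (D k F).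
Hypothesis DC : forall i j F, S F -> D i (D j F) = D j (D i F).
Implicit Types (g : 'I_n -> K) (alpha : mindex n) (F : T).

Definition madd alpha (j : 'I_n) : mindex n := fun i => (alpha i + (i == j))%N.

Let Siter k m F : S F -> S (iter m (D k) F).
Proof. by move=> sF; elim: m => //= m; exact: SD. Qed.

Let Sfold g alpha (r : seq 'I_n) F : S F ->
  S (foldr (fun j h => iter (alpha j) (D (g j)) h) F r).
Proof. by move=> sF; elim: r => //= j r; exact: Siter. Qed.

Let D_iter k i m F : S F -> D k (iter m (D i) F) = iter m (D i) (D k F).
Proof.
move=> sF; elim: m => //= m <-; rewrite DC//; exact: Siter.
Qed.

Let D_fold g alpha k (r : seq 'I_n) F : S F ->
  D k (foldr (fun j h => iter (alpha j) (D (g j)) h) F r) =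
  foldr (fun j h => iter (alpha j) (D (g j)) h) (D k F) r.
Proof.
move=> sF; elim: r => //= j r <-; rewrite D_iter//; exact: Sfold.
Qed.

Lemma mpower_stable g alpha F : S F -> S (mpower (fun j => D (g j)) alpha F).
Proof. exact: Sfold. Qed.

Lemma mpower_comm g alpha k F : S F ->
  D k (mpower (fun j => D (g j)) alpha F) = mpower (fun j => D (g j)) alpha (D k F).
Proof. exact: D_fold. Qed.

Lemma mpower_madd g alpha j F : S F ->
  mpower (fun j => D (g j)) (madd alpha j) F = D (g j) (mpower (fun j => D (g j)) alpha F).
Proof.
move=> sF; rewrite /mpower.
(* In a duplicate-free list [j] is met at most once, so the additional operator appears exactly when
   [j] belongs to the list. *)
have H r : uniq r -> foldr (fun i h => iter (madd alpha j i) (D (g i)) h) F r =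
   if j \in r then D (g j) (foldr (fun i h => iter (alpha i) (D (g i)) h) F r)
   else foldr (fun i h => iter (alpha i) (D (g i)) h) F r.
  elim: r => //= i r IH /andP[ir /IH ->]; rewrite in_cons /madd.
  have [<-|ij] := eqVneq i j; first by rewrite /= (negbTE ir) addn1.
  by rewrite addn0 /=; case: ifP => // _; rewrite D_iter//; exact: Sfold.
by rewrite H ?enum_uniq// mem_enum.
Qed.

Lemma eq_mpower (E : 'I_n -> T -> T) alpha beta F : alpha =1 beta ->
  mpower E alpha F = mpower E beta F.
Proof. by move=> ab; rewrite /mpower; elim: (enum _) => //= i r ->; rewrite ab. Qed.

Lemma mpower0 (E : 'I_n -> T -> T) F : mpower E (fun=> 0%N) F = F.
Proof. by rewrite /mpower; elim: (enum _). Qed.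

End mpower_commutation.

(** * From words to multi-indices *)

Section multinomial.
Variables (R : numFieldType) (n : nat).
Implicit Types (F : mindex n -> R) (alpha : mindex n).

Lemma eq_mdegree alpha beta : alpha =1 beta -> mdegree alpha = mdegree beta.
Proof. by move=> ab; apply: eq_bigr => j _. Qed.

Lemma eq_mfact alpha beta : alpha =1 beta -> mfact alpha = mfact beta.
Proof. by move=> ab; apply: eq_bigr => j _; rewrite ab. Qed.

Lemma mdegree_madd alpha j : mdegree (madd alpha j) = (mdegree alpha).+1.
Proof.
rewrite /mdegree /madd big_split/= -addn1; congr (_ + _)%N.
rewrite (bigD1 j)//= eqxx big1// => i ij.
by rewrite (negbTE ij).
Qed.

Lemma mfact_madd alpha j : mfact (madd alpha j) = ((alpha j).+1 * mfact alpha)%N.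
Proof.
rewrite /mfact (bigD1 j)//= [in RHS](bigD1 j)//= /madd eqxx addn1 factS mulnA.
by congr (_ * _)%N; apply: eq_bigr => i ij; rewrite (negbTE ij) addn0.
Qed.

(* The sum of [F] over the multi-indices of all words of length [k]. *)
Fixpoint word_sum k F : R := match k with
  | 0 => F (fun=> 0%N)
  | k.+1 => \sum_(j < n) word_sum k (fun alpha => F (madd alpha j))
  end.

Lemma eq_word_sum k F H : F =1 H -> word_sum k F = word_sum k H.
Proof.
elim: k F H => [|k IH] F H FH /=; first exact: FH.
by apply: eq_bigr => j _; apply: IH => alpha.
Qed.

(** The multinomial count: alpha comes from |alpha|!/alpha! words. Stripping a letter j produces the
    weight alpha_j, and these weights add up to k + 1. Multi-indices are functions, hence the
    requirement that [F] respect pointwise equality. *)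
Lemma word_sumE N k F : (forall alpha beta, alpha =1 beta -> F alpha = F beta) ->
  (k < N)%N -> word_sum k F / k`!%:R =
  \sum_(alpha : {ffun 'I_n -> 'I_N} | mdegree (fun j => alpha j) == k)
     F (fun j => alpha j) / (mfact (fun j => alpha j))%:R.
Proof.
case: N => // N; elim: k F => [|k IH] F extF kN.
  have E : mdegree (fun j => [ffun _ : 'I_n => ord0 : 'I_N.+1] j : nat) = 0%N.
    by rewrite /mdegree big1// => j _; rewrite ffunE.
  rewrite (big_pred1 [ffun _ => ord0]) /=; last first.
    move=> alpha; apply/eqP/eqP => [a0|->//].
    apply/ffunP => j; rewrite ffunE; apply/val_inj/eqP => /=.
    by rewrite -leqn0 -a0 /mdegree (bigD1 j)//= leq_addr.
  rewrite (extF _ (fun=> 0%N)) => [|j]; last by rewrite ffunE.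
  congr (_ / _%:R); rewrite /mfact big1// => j _; by rewrite ffunE.
(* [up j] and [dn j] add and remove one letter j. They are inverse to each other between degree k
   and degree k + 1 with a positive entry at j, a range in which [inord] does not overflow. *)
pose up j (beta : {ffun 'I_n -> 'I_N.+1}) : {ffun 'I_n -> 'I_N.+1} :=
  [ffun i => inord (madd (fun i => beta i) j i)].
pose dn j (alpha : {ffun 'I_n -> 'I_N.+1}) : {ffun 'I_n -> 'I_N.+1} :=
  [ffun i => inord (alpha i - (i == j))].
have dnE j (alpha : {ffun 'I_n -> 'I_N.+1}) i : dn j alpha i = (alpha i - (i == j))%N :> nat.
  by rewrite ffunE inordK// ltnS (leq_trans (leq_subr _ _))// -ltnS.
have upE j (beta : {ffun 'I_n -> 'I_N.+1}) : (beta j < N)%N ->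
    (fun i => up j beta i : nat) =1 madd (fun i => beta i) j.
  move=> bN i; rewrite ffunE inordK// ltnS /madd.
  by have [->|ij] := eqVneq i j; rewrite ?addn1// addn0 -ltnS.
have fact0 m : m`!%:R != 0 :> R by rewrite pnatr_eq0 -lt0n fact_gt0.
have mfact0 alpha : (mfact alpha)%:R != 0 :> R.
  by rewrite pnatr_eq0 -lt0n prodn_gt0// => i; exact: fact_gt0.
have deg_le (beta : {ffun 'I_n -> 'I_N.+1}) j : (beta j <= mdegree (fun i => beta i))%N.
  by rewrite /mdegree (bigD1 j)//= leq_addr.
have step j : word_sum k (fun alpha => F (madd alpha j)) / k`!%:R =
   \sum_(alpha : {ffun 'I_n -> 'I_N.+1} | mdegree (fun j => alpha j) == k.+1)
     (alpha j)%:R * (F (fun j => alpha j) / (mfact (fun j => alpha j))%:R).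
  rewrite IH; [|by move=> al be ab; apply: extF => i; rewrite /madd ab|exact: ltnW].
  rewrite [RHS](bigID (fun alpha : {ffun 'I_n -> 'I_N.+1} => 0 < alpha j)%N)/=.
  rewrite [X in _ + X]big1 ?addr0; last first.
    by move=> alpha /andP[_]; rewrite -eqn0Ngt => /eqP ->; rewrite mul0r.
  rewrite [RHS](reindex_onto (up j) (dn j)); last first.
    move=> alpha /andP[_ a0]; apply/ffunP => i; apply: val_inj.
    rewrite ffunE /= inordK /madd dnE; have [->|ij] := eqVneq i j; rewrite ?subnK ?subn0 ?addn0//.
  apply: esym; apply: eq_big => [beta|beta].
    apply/andP/idP => [[/andP[/eqP d1 u0] /eqP e]|/eqP bk].
      (* If [beta j] were N, [inord] would overflow to its default value 0, against [u0]. *)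
      have bN : (beta j < N)%N.
        rewrite ltn_neqAle -ltnS ltn_ord andbT; apply: contraTneq u0 => bj.
        by rewrite ffunE /madd eqxx bj addn1 /inord val_insubd ltnn.
      by move/eqP: d1; rewrite (eq_mdegree (upE j beta bN)) mdegree_madd eqSS.
    have bN : (beta j < N)%N by rewrite (leq_ltn_trans (deg_le beta j)) ?bk.
    split; last first.
      apply/eqP/ffunP => i; apply: val_inj; rewrite [LHS]dnE upE// /madd addnK//.
    rewrite upE// /madd eqxx addn1 andbT.
    by rewrite (eq_mdegree (upE j beta bN)) mdegree_madd bk.
  move=> /andP[/andP[_ u0] _]; have bN : (beta j < N)%N.
    rewrite ltn_neqAle -ltnS ltn_ord andbT; apply: contraTneq u0 => bj.
    by rewrite ffunE /madd eqxx bj addn1 /inord val_insubd ltnn.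
  rewrite (extF _ _ (upE j beta bN)) (eq_mfact (upE j beta bN)) mfact_madd upE// /madd eqxx addn1.
  by rewrite natrM invfM mulrCA mulVKf// pnatr_eq0.
rewrite /= factS natrM.
transitivity (k.+1%:R^-1 * \sum_(j < n) (word_sum k (fun alpha => F (madd alpha j)) / k`!%:R)).
  by rewrite -mulr_suml invfM mulrCA mulrA.
rewrite (eq_bigr _ (fun j _ => step j)) exchange_big/= mulr_sumr.
apply: eq_bigr => alpha /eqP ak; rewrite -mulr_suml -natr_sum -/(mdegree _) ak.
by rewrite mulKf// pnatr_eq0.
Qed.

Lemma sum_by_degree N F :
  \sum_(alpha : {ffun 'I_n -> 'I_N} | (mdegree (fun j => alpha j) < N)%N) F (fun j => alpha j) =
  \sum_(k < N) \sum_(alpha : {ffun 'I_n -> 'I_N} | mdegree (fun j => alpha j) == k) F (fun j => alpha j).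
Proof.
rewrite (exchange_big_dep (fun alpha : {ffun 'I_n -> 'I_N} => mdegree (fun j => alpha j) < N)%N)/=; last first.
  by move=> k alpha _ /eqP ->.
apply: eq_bigr => alpha aN.
by rewrite (big_pred1 (Ordinal aN))// => k; apply/eqP/eqP => [H|->//]; exact: val_inj.
Qed.

End multinomial.

(** * The expansion over multi-indices *)

Section composition.
Context {R : realType}.
Local Notation C := R[i].
Local Notation bas := (@Defs.basis R _).
Variable n : nat.
Local Notation Ph := ('rV[R]_n * 'rV[R]_n)%type.
Variables rho delta : R.
Local Notation symb := (@symb R n rho delta).
Implicit Types (a b : Ph -> C) (p : Ph).

Definition Dxi (j : 'I_n) a := cderive (pb (inr j)) a.
Definition Dx (j : 'I_n) a := cderive (pb (inl j)) a.

Definition is_symb a := exists m, symb m a.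

Lemma is_symb_der k a : is_symb a -> is_symb (cderive (pb k) a).
Proof. by move=> [m sa]; eexists; exact: symb_der sa. Qed.

Lemma is_symb_comm i j a : is_symb a ->
  cderive (pb i) (cderive (pb j) a) = cderive (pb j) (cderive (pb i) a).
Proof. by move=> [m sa]; exact: symb_clairaut sa. Qed.

Lemma exp_termS k a b p : exp_term k.+1 a b p = \sum_(j < n) exp_term k (Dxi j a) (Dx j b) p.
Proof. by []. Qed.

Lemma exp_term_word_sum k a b p : is_symb a -> is_symb b ->
  exp_term k a b p = word_sum k (fun alpha => mpower Dxi alpha a p * mpower Dx alpha b p).
Proof.
elim: k a b => [|k IH] a b sa sb; first by rewrite /= !mpower0.
rewrite exp_termS; apply: eq_bigr => j _.
rewrite (IH _ _ (is_symb_der (inr j) sa) (is_symb_der (inl j) sb)).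
apply: eq_word_sum => alpha.
have e1 : mpower Dxi (madd alpha j) a = mpower Dxi alpha (Dxi j a).
  exact: etrans (mpower_madd is_symb_der is_symb_comm inr alpha j sa)
    (mpower_comm is_symb_der is_symb_comm inr alpha (inr j) sa).
have e2 : mpower Dx (madd alpha j) b = mpower Dx alpha (Dx j b).
  exact: etrans (mpower_madd is_symb_der is_symb_comm inl alpha j sb)
    (mpower_comm is_symb_der is_symb_comm inl alpha (inl j) sb).
exact: (f_equal2 (fun f g : Ph -> C => f p * g p) (esym e1) (esym e2)).
Qed.

Definition comp_sum a b N p : C :=
  \sum_(alpha : {ffun 'I_n -> 'I_N} | (mdegree (fun j => alpha j) < N)%N)
    ipi ^- mdegree (fun j => alpha j) / (mfact (fun j => alpha j))%:R
    * mpower Dxi (fun j => alpha j) a p * mpower Dx (fun j => alpha j) b p.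

Lemma comp_sumE a b N p : is_symb a -> is_symb b ->
  comp_sum a b N p = \sum_(k < N) (1%:C / ipi) ^+ k / k`!%:R * exp_term k a b p.
Proof.
have aux (z w x y : C) k : z ^- k / w * x * y = (1%:C / z) ^+ k * (x * y / w).
  by rewrite div1r exprVn; ring.
move=> sa sb; rewrite /comp_sum.
rewrite (@sum_by_degree _ _ N (fun alpha => ipi ^- mdegree alpha / (mfact alpha)%:R
    * mpower Dxi alpha a p * mpower Dx alpha b p)).
apply: eq_bigr => k _; rewrite (exp_term_word_sum k p sa sb) -mulrA [_^-1 * _]mulrC.
rewrite (word_sumE _ (ltn_ord k)); last first.
  move=> al be ab.
  exact: (f_equal2 (fun f g : Ph -> C => f p * g p) (eq_mpower Dxi a ab) (eq_mpower Dx b ab)).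
rewrite mulr_sumr; apply: eq_bigr => alpha /eqP ->.
exact: aux.
Qed.

End composition.

(** * Composition of operators *)

Section operator_composition.
Context {R : realType}.
Local Notation C := R[i].
Local Notation bas := (@Defs.basis R _).
Variable n : nat.
Local Notation Ph := ('rV[R]_n * 'rV[R]_n)%type.
Variables rho delta : R.
Hypothesis rho0 : 0 <= rho.
Hypothesis delta0 : 0 <= delta.
Hypothesis delta1 : delta < 1.
Local Notation symb := (@symb R n rho delta).
Local Notation m2pi := (@m2pi R).
Local Notation sqwgt := (@sqwgt R n).
Implicit Types (a b : Ph -> C) (t x s eta xi zeta y z : 'rV[R]_n) (p : Ph) (v g : 'rV[R]_n -> C).

Lemma schv_intro v (v' : 'I_n -> 'rV[R]_n -> C) m N : (forall y, ccont v y) ->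
  (exists K, forall y, normc (v y) <= K * jap y `^ m) ->
  (forall j y, is_cder (bas j) v y (v' j y)) ->
  (forall j, bclass (@pb R n) (pwt 0 1) (@japp R n) N m (fun p => v' j p.2)) ->
  bclass (@pb R n) (pwt 0 1) (@japp R n) N.+1 m (fun p => v p.2).
Proof.
move=> cv [K bv] dv sv'.
apply: (bclass_intro (@pb_neq0 R n) (F' := fun i (p : Ph) => match i with
  inl _ => 0 | inr j => v' j p.2 end)).
- by move=> p; exact: ccont_for_comp_snd.
- by exists K => p; exact: bv.
- by case=> j p; [exact: is_cder_snd0|apply: is_cder_snd].
- case=> j; first by apply: bclass_zero; exact: pb_neq0.
  by rewrite /= oppr0 addr0.
Qed.

Lemma schv_shift v t : schv v -> schv (fun y => v (t + y)).
Proof.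
have cont v' y : schv v' -> ccont (fun y => v' (t + y)) y.
  move=> sv; apply: (ccont_comp (h := v') (g := fun y => t + y)); last exact: schv_cont.
  exact: (continuousD (@continuous_for_cst _ _ t y) (@continuous_for_id _ y)).
have bound v' m : schv v' -> exists K, forall y, normc (v' (t + y)) <= K * jap y `^ m.
  move=> sv; have [K K0 vK] := schv_bound m sv; exists (K * jap t `^ `|m|) => y.
  have h : jap (t + y) `^ m <= jap t `^ `|m| * jap y `^ m by rewrite addrC; exact: peetre.
  by apply: le_trans (vK (t + y)) _; rewrite -mulrA; exact: ler_wpM2l.
move=> sv m N; elim: N v m sv => [|N IH] v m sv.
  split => // [p _|]; first by apply: (ccont_for_comp_snd (f := fun y => v (t + y))); exact: cont.
  by have [K HK] := bound v m sv; exists K => p; exact: HK.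
apply: (@schv_intro (fun y => v (t + y)) (fun j y => cderive (bas j) v (t + y))).
- by move=> y; exact: cont.
- exact: bound.
- move=> j y; apply/is_cder_line; have /is_cder_line := schv_is_cder j (t + y) sv.
  by apply: eq_is_cder => // s; rewrite addrA.
- by move=> j; apply: IH; exact: schv_der.
Qed.

(** The argument [g] is the Fourier transform of the function to which the operator is applied. *)
Definition pdo b g t : C := cint (fun xi => chr (2 * pi) t xi * b (t, xi) * g xi).

Lemma sch_pdo b m g : symb m b -> schv g -> sch (fun p => b p * g p.2).
Proof.
move=> sb sg; apply: (schM_symb (m := m)) sg.
exact: (symb_weaken rho0 (ltW delta1) (lexx m) sb).
Qed.

Lemma schv_pdo b m g : symb m b -> schv g -> schv (pdo b g).
Proof.
move=> sb sg; have k0 : 2 * pi != 0 :> R by rewrite mulf_neq0// gt_eqF// pi_gt0.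
have := osc_sch k0 (sch_pdo sb sg); congr sch; apply/funext => p.
by apply: eq_cint => xi; rewrite mulrA.
Qed.

Lemma chr_m2pi s y : chr m2pi (- s) y = chr (2 * pi) y s.
Proof. by rewrite /chr dotC -scaleN1r dotZr m2piE; congr expi; ring. Qed.

(** The characters combine, exp(-2 i pi y.(zeta - xi)) exp(2 i pi t.xi) being exp(-2 i pi y.zeta)
    exp(2 i pi (t + y).xi); once y is outermost, the integral in xi is [pdo b g] at t + y. *)
Lemma inner_fubini b m g t zeta : symb m b -> schv g ->
  cint (fun xi => amp sqwgt b 1 (t, xi) (zeta - xi) * (chr (2 * pi) t xi * g xi)) =
  fourier (fun y => sqwgt y * pdo b g (t + y)) zeta.
Proof.
move=> sb sg; have [K K0 dK] := amp_integrand_cdom (wcl_sqwgt n) sb.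
have [L L0 gL] := schv_bound (- m - 2 * n%:R) sg.
pose F (p : Ph) := amp_integrand sqwgt b 1 (t, p.1) (zeta - p.1) p.2 * (chr (2 * pi) t p.1 * g p.1).
have E xi y : F (xi, y) = chr m2pi zeta y * sqwgt y * (chr (2 * pi) (t + y) xi * b (t + y, xi) * g xi).
  by rewrite /F /amp_integrand /= scale1r chrDl chr_m2pi chrDl; ring.
transitivity (cint (fun xi => cint (fun y => F (xi, y)))).
  apply: eq_cint => xi; rewrite [LHS]mulrC -(cintZ _ (dK 1 (t, xi) (zeta - xi))).
  by apply: eq_cint => y; rewrite /F mulrC.
rewrite (@cint_fubini _ _ _ (K * L)).
- rewrite fourierE; apply: eq_cint => y; rewrite [RHS]mulrA -[RHS]/(_ * pdo b g (t + y)).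
  have [M dM] := osc_cdom (2 * pi) (sch_pdo sb sg).
  have dM' : cdom M (fun xi => chr (2 * pi) (t + y) xi * b (t + y, xi) * g xi).
    by apply: eq_cdom (dM (t + y)) => xi; rewrite mulrA.
  by rewrite /pdo -(cintZ _ dM'); apply: eq_cint => xi; rewrite E.
- case=> xi y; apply: (eq_ccont (f := fun p : Ph => chr m2pi zeta p.2 * sqwgt p.2 *
    (chr (2 * pi) (t + p.2) p.1 * b (t + p.2, p.1) * g p.1))).
    by case=> xi' y'; rewrite E.
  have c1 : {for (xi, y), continuous (fun p : Ph => p.1)} by exact: cvg_fst.
  have c2 : {for (xi, y), continuous (fun p : Ph => p.2)} by exact: cvg_snd.
  have ct : {for (xi, y), continuous (fun p : Ph => t + p.2)}.
    by apply: (@continuousD _ _ _ (fun=> t) (fun p : Ph => p.2)); first exact: continuous_for_cst.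
  apply: ccontM; first apply: ccontM.
  + by apply: ccont_chr => //; exact: continuous_for_cst.
  + by apply: (ccont_for_comp_snd (f := sqwgt)); exact: (wcl_cont _ (wcl_sqwgt n)).
  + apply: ccontM; last by apply: (ccont_for_comp_fst (f := g)); exact: schv_cont.
    apply: ccontM; first by apply: ccont_chr; [exact: ct|exact: c1].
    apply: (ccont_comp (h := b) (g := fun p : Ph => (t + p.2, p.1))) (symb_cont _ sb).
    exact: continuous_pair.
- move=> xi y; rewrite -[F _]/(amp_integrand sqwgt b 1 (t, xi) (zeta - xi) y * (chr (2 * pi) t xi * g xi)).
  rewrite normcM [X in _ * X]normcM normc_chr mul1r.
  have jx := jap_gt0 xi.
  apply: le_trans (ler_pM (normc_ge0 _) (normc_ge0 _) ((dK 1 (t, xi) (zeta - xi)).2 y) (gL xi)) _.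
  rewrite /= [leLHS](_ : _ = K * L * (jap xi `^ m * jap xi `^ (- m - 2 * n%:R)) * wgt y); last by ring.
  have -> : jap xi `^ m * jap xi `^ (- m - 2 * n%:R) = jap xi `^ (- (2 * n%:R)).
    rewrite -powRD; last by rewrite (gt_eqF jx) implybT.
    by congr (_ `^ _); ring.
  apply: ler_wpM2r; first exact: ltW (wgt_gt0 _).
  by apply: ler_wpM2l; [exact: mulr_ge0|exact: jap_le_wgt].
Qed.

Lemma amp_mul_cdom b m g t zeta : symb m b -> schv g ->
  exists K, cdom K (fun xi => amp sqwgt b 1 (t, xi) (zeta - xi) * (chr (2 * pi) t xi * g xi)).
Proof.
move=> sb sg; have [K K0 bK] := amp_bound (wcl_sqwgt n) sb.
have [L L0 gL] := schv_bound (- m - 2 * n%:R) sg.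
exists (K * L); split => xi.
  apply: ccontM; last by apply: ccontM; [exact: ccont_chrr|exact: schv_cont].
  apply: (ccont_comp (h := fun q : R * Ph * 'rV[R]_n => amp sqwgt b q.1.1 q.1.2 q.2)
    (g := fun xi => (1, (t, xi), zeta - xi))); last exact: (amp_cont _ (wcl_sqwgt n) sb).
  apply: continuous_pair.
    by apply: continuous_pair; [exact: continuous_for_cst|exact: continuous_pairr].
  exact: (continuousB (@continuous_for_cst _ _ zeta xi) (@continuous_for_id _ xi)).
have jx := jap_gt0 xi; rewrite !normcM normc_chr mul1r.
apply: le_trans (ler_pM (normc_ge0 _) (normc_ge0 _) (bK 1 (t, xi) (zeta - xi)) (gL xi)) _.
rewrite /= [leLHS](_ : _ = K * L * (jap xi `^ m * jap xi `^ (- m - 2 * n%:R))); last by ring.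
have -> : jap xi `^ m * jap xi `^ (- m - 2 * n%:R) = jap xi `^ (- (2 * n%:R)).
  rewrite -powRD; last by rewrite (gt_eqF jx) implybT.
  by congr (_ `^ _); ring.
by apply: ler_wpM2l; [exact: mulr_ge0|exact: jap_le_wgt].
Qed.

Lemma fourier_shift v t zeta : schv v ->
  fourier (fun y => v (t + y)) zeta = chr (2 * pi) t zeta * fourier v zeta.
Proof.
move=> sv; rewrite !fourierE.
have [K dK] := osc_cdom m2pi sv.
have cf y : ccont (fun y => chr m2pi zeta y * v y) y by exact: (dK zeta).1.
rewrite -(cintZ _ (dK zeta)) /= -(cint_shift t (f := fun y => chr (2 * pi) t zeta * (chr m2pi zeta y * v y))).
  apply: eq_cint => y; rewrite [t + y]addrC chrDr mulrA mulrA; congr (_ * _).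
  rewrite mulrAC -[LHS]mul1r; congr (_ * _); apply: esym.
  rewrite [chr m2pi _ _]chrC -{2}[t]opprK chr_m2pi chrC.
  by rewrite -chrDr subrr chrC /chr dot0l mulr0 expi0.
by move=> y; apply: ccontM; [exact: ccont_cst|exact: cf].
Qed.

(** With zeta = xi + eta and zeta outermost, [inner_fubini] yields the transform of [sqwgt] times a
    translate of [pdo b g]. This translate is Schwartz, so [elliptic_ibp] removes the
    regularisation, and the translation becomes the character of the outer operator. *)
Lemma pdo_comp a b m1 m2 g t : symb m1 a -> symb m2 b -> schv g ->
  pdo (comp_symb a b 1) g t = pdo a (fourier (pdo b g)) t.
Proof.
move=> sa sb sg; have sP := symb_elliptic rho0 sa; have su := schv_pdo sb sg.
have th1 : `|1 : R| <= 2 by rewrite normr1 ler1n.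
have [K K0 dK] := comp_integrand_cdom rho0 delta0 delta1 sa sb.
pose M := m1 + m2 + 2 * n%:R.
(* Decay demanded of [g]: M for the growth of the dominating constant of [comp_integrand], 2n for
   translating the weight by xi, and 2n for domination in xi. *)
have [L L0 gL] := schv_bound (- M - 2 * n%:R - 2 * n%:R) sg.
pose F (p : Ph) := elliptic a (t, p.2) * (amp sqwgt b 1 (t, p.1) (p.2 - p.1) * (chr (2 * pi) t p.1 * g p.1)).
have cF p : ccont F p.
  case: p => xi zeta.
  have c1 : {for (xi, zeta), continuous (fun p : Ph => p.1)} by exact: cvg_fst.
  have c2 : {for (xi, zeta), continuous (fun p : Ph => p.2)} by exact: cvg_snd.
  apply: ccontM.
    apply: (ccont_comp (h := elliptic a) (g := fun p : Ph => (t, p.2))) (symb_cont _ sP).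
    by apply: continuous_pair => //; exact: continuous_for_cst.
  apply: ccontM.
    apply: (ccont_comp (h := fun q : R * Ph * 'rV[R]_n => amp sqwgt b q.1.1 q.1.2 q.2)
      (g := fun p : Ph => (1, (t, p.1), p.2 - p.1))); last exact: (amp_cont _ (wcl_sqwgt n) sb).
    apply: continuous_pair; last exact: (continuousB c2 c1).
    apply: continuous_pair; first exact: continuous_for_cst.
    by apply: continuous_pair; [exact: continuous_for_cst|exact: c1].
  apply: ccontM; last by apply: (ccont_for_comp_fst (f := g)); exact: schv_cont.
  by apply: ccont_chr; [exact: continuous_for_cst|exact: c1].
have bF xi zeta : normc (F (xi, zeta)) <= K * L * 2 ^+ n * wgt xi * wgt zeta.
  have jx := jap_gt0 xi; rewrite /F /= !normcM normc_chr mul1r mulrA.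
  have := (dK 1 (t, xi) th1).2 (zeta - xi); rewrite /comp_integrand /= [xi + _]addrC subrK normcM => h1.
  have h2 := wgt_shift_jap zeta (- xi); rewrite japN in h2.
  have h3 := le_trans h1 (ler_wpM2l (mulr_ge0 K0 (powR_ge0 _ _)) h2).
  apply: le_trans (ler_pM (mulr_ge0 (normc_ge0 _) (normc_ge0 _)) (normc_ge0 _) h3 (gL xi)) _.
  rewrite -/M [leLHS](_ : _ = K * L * 2 ^+ n * (jap xi `^ M * jap xi `^ (2 * n%:R) *
    jap xi `^ (- M - 2 * n%:R - 2 * n%:R)) * wgt zeta); last by ring.
  have -> : jap xi `^ M * jap xi `^ (2 * n%:R) * jap xi `^ (- M - 2 * n%:R - 2 * n%:R) = jap xi `^ (- (2 * n%:R)).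
    rewrite -!powRD; [|by rewrite (gt_eqF jx) implybT..].
    by congr (_ `^ _); ring.
  apply: ler_wpM2r; first exact: ltW (wgt_gt0 _).
  by apply: ler_wpM2l; [rewrite !mulr_ge0// exprn_ge0|exact: jap_le_wgt].
transitivity (cint (fun xi => cint (fun zeta => F (xi, zeta)))).
  apply: eq_cint => xi.
  have cFs y : ccont (fun y => F (xi, y)) y by exact: ccont_slice.
  rewrite -(cint_shift xi cFs) mulrAC -(cintZ _ (dK 1 (t, xi) th1)).
  apply: eq_cint => eta; rewrite /F /comp_integrand /= addrK [xi + eta]addrC; ring.
rewrite (cint_fubini cF bF).
(* The sum [0 + zeta] puts the integral in the form of [elliptic_ibp] at the frequency x = 0. *)
transitivity (cint (fun zeta => elliptic a (t, 0 + zeta) * fourier (fun y => sqwgt y * pdo b g (t + y)) zeta)).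
  apply: eq_cint => zeta; rewrite add0r -(inner_fubini _ _ sb sg).
  by have [K' dK'] := amp_mul_cdom t zeta sb sg; rewrite -(cintZ _ dK').
rewrite (elliptic_ibp rho0 0 t sa (schv_shift t su)).
apply: eq_cint => zeta; rewrite add0r (fourier_shift _ _ su).
by rewrite mulrCA mulrA.
Qed.

End operator_composition.

(** * Transfer to (-1,1)^n *)

Section smooth_functions.
Context {R : realType}.
Local Notation C := R[i].
Variables (V : normedModType R) (I : Type) (e : I -> V).
Hypothesis e0 : forall i, e i != 0.
Implicit Types (D : set V) (F : V -> C).

Definition cinf D F := forall N m, cb e (fun=> 0) D (fun _ _ => True) N m F.

Lemma cinf_intro D F (F' : I -> V -> C) : open D -> (forall x, D x -> ccont F x) ->
  (forall i x, D x -> is_cder (e i) F x (F' i x)) -> (forall i, cinf D (F' i)) ->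
  cinf D F.
Proof.
move=> oD cF dF cF' [|N] m; first by split.
apply: (@cb_intro R V I e (fun=> 0) D oD (fun _ _ => True) _ e0 N m F F') => // i.
by rewrite addr0; exact: cF'.
Qed.

Lemma eq_cinf D F G : open D -> (forall x, D x -> F x = G x) -> cinf D F -> cinf D G.
Proof. by move=> oD FG cF N m; apply: (@eq_cb R V I e (fun=> 0) D oD (fun _ _ => True) _ e0 N m F G). Qed.

Lemma cinf_cont D F x : cinf D F -> D x -> ccont F x.
Proof. by move=> /(_ 0%N 0)/cb_cont; exact. Qed.

Lemma cinf_der D F i : cinf D F -> cinf D (cderive (e i) F).
Proof. by move=> cF N m; have [_] := cb_der i (cF N.+1 m); rewrite addr0. Qed.

Lemma cinf_is_cder D F i x : cinf D F -> D x -> is_cder (e i) F x (cderive (e i) F x).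
Proof. by move=> cF; have [] := cb_der i (cF 1%N 0); move=> + _; exact. Qed.

Lemma cinfM D F G : open D -> cinf D F -> cinf D G -> cinf D (fun x => F x * G x).
Proof.
move=> oD cF cG N m; rewrite -[m]addr0.
by apply: (@cbM R V I e (fun=> 0) D oD (fun _ _ => True)).
Qed.

Lemma cinf_cst D (c : C) : open D -> cinf D (fun=> c).
Proof.
move=> oD N; elim: N c => [|N IH] c m; first by split => // x _; exact: ccont_cst.
apply: (@cb_intro R V I e (fun=> 0) D oD (fun _ _ => True) _ e0 N m _ (fun _ _ => 0)) => //.
- by move=> x _; exact: ccont_cst.
- by move=> k x _; exact: is_cder_cst.
Qed.

Lemma cinfD D F G : open D -> cinf D F -> cinf D G -> cinf D (fun x => F x + G x).
Proof.
move=> oD cF cG N m.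
by apply: (@cbD R V I e (fun=> 0) D oD (fun _ _ => True)).
Qed.

Lemma smooth_cinf D F : smooth e D F -> cinf D F.
Proof.
move=> sF N m; have H s : cb e (fun=> 0) D (fun _ _ => True) N m (foldr (fun i => cderive (e i)) F s).
  elim: N m s => [|N IH] m s.
    by split => // x Dx; have [] := sF s x Dx.
  split => // [x Dx|i]; first by have [] := sF s x Dx.
  split => [x Dx|]; last exact: (IH _ (i :: s)).
  by have [_ _ /(_ i)[d1 d2]] := sF s x Dx; exact: is_cderP.
exact: (H [::]).
Qed.

Lemma cinf_smooth D F : cinf D F -> smooth e D F.
Proof.
move=> cF s x Dx; have {}cF : cinf D (foldr (fun i => cderive (e i)) F s).
  by elim: s => //= i s; exact: cinf_der.
split; [exact: (cinf_cont cF Dx).1|exact: (cinf_cont cF Dx).2|].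
by move=> i; have := is_cder_derivable (cinf_is_cder i cF Dx).
Qed.

Lemma cinf_clairaut F i j : cinf setT F ->
  cderive (e i) (cderive (e j) F) = cderive (e j) (cderive (e i) F).
Proof.
move=> cF; apply/funext => x.
have ci := cinf_der i cF; have cj := cinf_der j cF.
apply: (clairaut_complex (f := F) (fu := cderive (e j) F) (fv := cderive (e i) F) (u := e j) (v := e i));
  try (by move=> y; exact: cinf_is_cder); apply: (@cinf_cont setT) => //; exact: cinf_der.
Qed.

End smooth_functions.

Section coordinate_change.
Context {R : realType}.
Local Notation C := R[i].
Local Notation bas := (@Defs.basis R _).
Variable n : nat.
Local Notation Ph := ('rV[R]_n * 'rV[R]_n)%type.
Local Notation GR := (@GxRn R n).
Implicit Types (F H : Ph -> C) (p : Ph) (x t xi : 'rV[R]_n).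

Definition xmap t : 'rV[R]_n := \row_j xcoord (t 0 j).

Lemma xmap_G t : G (xmap t).
Proof. by move=> j; rewrite mxE xcoord_itv. Qed.

Lemma tmapK x : G x -> xmap (tmap x) = x.
Proof. by move=> Gx; apply/rowP => j; rewrite !mxE -/(tcoord _) tcoordK. Qed.

Lemma open_GxRn : open GR.
Proof.
rewrite openE => p Gp; rewrite /interior.
rewrite /GxRn/= /G; apply: (@filter_forall _ 'I_n (fun j (q : Ph) => -1 < q.1 0 j < 1) (nbhs p)) => j.
have /andP[x1 x2] := Gp j.
have c : {for p, continuous (fun p : Ph => p.1 0 j)}.
  by apply: (continuous_coord (f := fun p : Ph => p.1)); exact: cvg_fst.
near=> q; apply/andP; split.
  by near: q; apply: (cvgr_gt (p.1 0 j)); [exact: c|].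
by near: q; apply: (cvgr_lt (p.1 0 j)); [exact: c|].
Unshelve. all: by end_near.
Qed.

Lemma is_derive_xcoord (t : R) : is_derive t (1 : R) (@xcoord R) (- (1 - xcoord t ^+ 2)).
Proof.
have e0 : 1 + expR (2 * t) != 0 :> R by rewrite gt_eqF// ltr_pwDl// ltW// expR_gt0.
have de : is_derive t (1 : R) (fun t : R => expR (2 * t)) (2 * expR (2 * t)).
  have d2 : is_derive t (1 : R) (fun t : R => 2 * t) 2.
    by apply: is_derive_eq; rewrite /GRing.scale/=; ring.
  have := @is_derive1_comp R (@expR R) _ t _ _ (is_derive_expR _) d2.
  by move=> h; apply: (is_derive_eq h); rewrite mulrC.
rewrite /xcoord.
have d1 : is_derive t (1 : R) (fun t : R => 1 + expR (2 * t)) (2 * expR (2 * t)).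
  by apply: is_derive_eq (is_deriveD (is_derive_cst (1 : R) t (1 : R)) de) _; rewrite add0r.
have d2 : is_derive t (1 : R) (fun t : R => 1 - expR (2 * t)) (- (2 * expR (2 * t))).
  by apply: is_derive_eq (is_deriveB (is_derive_cst (1 : R) t (1 : R)) de) _; rewrite sub0r.
have dV := @is_deriveV R (fun t : R => 1 + expR (2 * t)) t _ 1 e0 d1.
apply: is_derive_eq (is_deriveM d2 dV) _.
rewrite /GRing.scale/=; move: e0; set E := expR _ => e0.
by field.
Qed.

Section change.
Variables (phi : R -> R) (mm : 'rV[R]_n -> 'rV[R]_n).
Hypothesis mmE : forall x j, mm x 0 j = phi (x 0 j).

(** Stated for any map acting coordinatewise, so that it serves both [xmap] and [tmap]. *)
Lemma is_cder_change_x F j x xi e d : is_derive (x 0 j) (1 : R) phi e ->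
  is_cder (pb (inl j)) F (mm x, xi) d ->
  is_cder (pb (inl j)) (fun p => F (mm p.1, p.2)) (x, xi) (e%:C * d).
Proof.
move=> dphi /is_cder_line dF; apply/is_cder_line.
(* The increment of the j-th new coordinate: a line in direction j goes to a line in the same
   direction, run through with parameter h. *)
pose h (s : R) := phi (x 0 j + s) - phi (x 0 j).
have h0 : h 0 = 0 by rewrite /h addr0 subrr.
have dh : is_derive (0 : R) (1 : R) h e.
  have /is_derive_line d1 := dphi.
  have d2 := is_deriveB d1 (is_derive_cst (phi (x 0 j)) (0 : R) (1 : R)).
  move: d2; rewrite subr0; congr is_derive; apply/funext => s.
  by rewrite /h -[LHS]/(phi (x 0 j + s * 1) - _) mulr1.
rewrite -h0 in dF; have := @is_cder_comp R _ h 0 _ _ dF dh.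
apply: eq_is_cder => [s|]; last by rewrite mulrC.
congr (F (_, _)); last by rewrite /= !scaler0 !addr0.
apply/rowP => i; rewrite /= mmE !coord_line !mmE /h.
by have [<-|ij] := eqVneq i j; rewrite ?mulr1 ?mulr0 ?addr0// addrC subrK.
Qed.

Lemma is_cder_change_xi F j x xi d : is_cder (pb (inr j)) F (mm x, xi) d ->
  is_cder (pb (inr j)) (fun p => F (mm p.1, p.2)) (x, xi) d.
Proof.
move=> /is_cder_line dF; apply/is_cder_line; apply: eq_is_cder dF => // s.
by congr (F (_, _)); rewrite /= !scaler0 !addr0.
Qed.

Lemma ccont_change F p : (forall j, {for p.1 0 j, continuous phi}) ->
  ccont F (mm p.1, p.2) -> ccont (fun p => F (mm p.1, p.2)) p.
Proof.
move=> cphi; apply: (ccont_comp (h := F) (g := fun p : Ph => (mm p.1, p.2))).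
apply: continuous_pair; last exact: cvg_snd.
apply: continuous_rV => j.
apply: (eq_continuous_at (f := fun p : Ph => phi (p.1 0 j))); first by move=> q; rewrite mmE.
apply: (continuous_for_comp (f := phi) (g := fun p : Ph => p.1 0 j)); last exact: cphi.
by apply: (continuous_coord (f := fun p : Ph => p.1)); exact: cvg_fst.
Qed.

End change.

Lemma is_derive_continuous (f : R -> R) (u d : R) : is_derive u (1 : R) f d -> {for u, continuous f}.
Proof. by move=> [df _]; apply: differentiable_continuous; apply/derivable1_diffP. Qed.

(** Since [xmap] lands in [G], only the meaningful values of [F] enter. *)
Definition xlift F p := F (xmap p.1, p.2).

Lemma GxRn_xmap p : GR (xmap p.1, p.2).
Proof. exact: xmap_G. Qed.

Lemma xmapE x j : xmap x 0 j = xcoord (x 0 j). Proof. by rewrite mxE. Qed.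
Lemma tmapE x j : tmap x 0 j = tcoord (x 0 j). Proof. by rewrite mxE. Qed.

Lemma cinf_coord (D : set Ph) j : open D -> cinf (@pb R n) D (fun p => (p.1 0 j)%:C).
Proof.
move=> oD.
apply: (cinf_intro (@pb_neq0 R n) (F' := fun k _ => match k with inl i => (i == j)%:R%:C | inr _ => 0 end)) => //.
- move=> p _; apply: ccontR; apply: (continuous_coord (f := fun p : Ph => p.1)); exact: cvg_fst.
- case=> i p _; apply/is_cder_line.
    have E (s : R) : ((p + s *: pb (inl i)).1 0 j)%:C = (p.1 0 j)%:C + (j == i)%:R%:C * s%:C :> C.
      by rewrite /= coord_line rmorphD rmorphM/= mulrC.
    under eq_fun do rewrite E.
    have h : is_cder (1 : R) (fun s : R => s%:C) (0 : R) 1%:C by apply: is_cderR; exact: is_derive_id.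
    apply: is_cder_eq (is_cderD (is_cder_cst _ _ _) (is_cderZ _ h)) _.
    by rewrite add0r mulr1 eq_sym.
  apply: eq_is_cder (is_cder_cst _ ((p.1 0 j)%:C) _) => // s.
  by rewrite /= scaler0 addr0.
- by move=> k; apply: cinf_cst => //; exact: pb_neq0.
Qed.

(** The counterpart of [cderive (pb k)] on G x R^n: [xlift] exchanges the two, because the
    derivative of [xcoord] is [- (1 - xcoord ^+ 2)]. *)
Definition deriv_G (k : 'I_n + 'I_n) F := match k with
  | inl j => canonical_deriv j F | inr j => pderiv_xi j F end.

Lemma cinf_deriv_G k F : cinf (@pb R n) GR F -> cinf (@pb R n) GR (deriv_G k F).
Proof.
have oG := open_GxRn; have p0 := @pb_neq0 R n.
move=> cF; case: k => j; last exact: (cinf_der (inr j) cF).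
apply: (cinfM p0 oG); last exact: (cinf_der (inl j) cF).
have cx := cinf_coord j oG.
apply: (eq_cinf p0 oG _ (cinfD p0 oG (cinf_cst p0 (- 1) oG) (cinfM p0 oG cx cx))) => p _.
by apply: ReIm_eq; rewrite /=; ring.
Qed.

Lemma is_cder_lift k F p : cinf (@pb R n) GR F ->
  is_cder (pb k) (xlift F) p (xlift (deriv_G k F) p).
Proof.
move=> cF; case: p => t xi; have Gp := GxRn_xmap (t, xi).
case: k => j.
  apply: (is_cder_change_x xmapE); last exact: cinf_is_cder Gp.
  by rewrite xmapE; exact: is_derive_xcoord.
apply: (@is_cder_change_xi xmap F j t xi); exact: (cinf_is_cder (inr j) cF Gp).
Qed.

Lemma ccont_lift F p : cinf (@pb R n) GR F -> ccont (xlift F) p.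
Proof.
move=> cF; apply: (ccont_change xmapE); last exact: cinf_cont (GxRn_xmap p).
by move=> j; exact: (is_derive_continuous (is_derive_xcoord _)).
Qed.

Lemma cinf_lift F : cinf (@pb R n) GR F -> cinf (@pb R n) setT (xlift F).
Proof.
move=> + N; elim: N F => [|N IH] F cF m; first by split => // p _; exact: ccont_lift.
apply: (@cb_intro R Ph _ (@pb R n) (fun=> 0) setT openT (fun _ _ => True) _ (@pb_neq0 R n) N m _ (fun k => xlift (deriv_G k F))) => //.
- by move=> p _; exact: ccont_lift.
- by move=> k p _; exact: is_cder_lift.
- by move=> k; apply: IH; exact: cinf_deriv_G.
Qed.

End coordinate_change.

(** * Sorting words of derivatives *)

Section words.
Variables (n : nat) (T : Type) (D : 'I_n + 'I_n -> T -> T) (S : T -> Prop).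
Hypothesis SD : forall k F, S F -> S (D k F).
Hypothesis DC : forall i j F, S F -> D i (D j F) = D j (D i F).

(** The classes [symb] involve derivatives in every order, whereas [symbol_class] bounds only those
    taken first in x and then in xi; commutation reduces the former to the latter. *)
Lemma foldr_words (s : seq ('I_n + 'I_n)) F : S F ->
  foldr D F s = mpower (fun j => D (inr j)) (fun j => count_mem (inr j) s)
    (mpower (fun j => D (inl j)) (fun j => count_mem (inl j) s) F).
Proof.
move=> sF; elim: s => [|k s IH]; first by rewrite !mpower0.
set al := (X in mpower _ X (mpower _ _ _)); set be := (X in mpower _ _ (mpower _ X _)).
set al' := (X in _ = mpower _ X (mpower _ _ _)) in IH; set be' := (X in _ = mpower _ _ (mpower _ X _)) in IH.
have sG := mpower_stable SD inl be' sF.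
rewrite /= IH; case: k @al @be => j al be.
  rewrite (mpower_comm SD DC inr al' (inl j) sG).
  rewrite -(mpower_madd SD DC inl be' j sF).
  rewrite (eq_mpower (fun j => D (inr j)) _ (_ : al =1 al')); last by [].
  congr mpower; apply: eq_mpower => i.
  by rewrite /madd /be /be' /= addnC eq_sym.
rewrite -(mpower_madd SD DC inr al' j sG).
rewrite (eq_mpower (fun j => D (inl j)) _ (_ : be =1 be')); last by [].
apply: eq_mpower => i; by rewrite /madd /al /al' /= addnC eq_sym.
Qed.

End words.

(** * Symbols on G x R^n and on R^n x R^n *)

Section transfer.
Context {R : realType}.
Local Notation C := R[i].
Local Notation bas := (@Defs.basis R _).
Variable n : nat.
Local Notation Ph := ('rV[R]_n * 'rV[R]_n)%type.
Local Notation GR := (@GxRn R n).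
Implicit Types (F H : Ph -> C) (p : Ph) (x t xi : 'rV[R]_n).

Lemma enorm_jap xi : jap xi <= 1 + enorm xi /\ 1 + enorm xi <= (n.+1)%:R * jap xi.
Proof.
have d0 : 0 <= dot xi xi by rewrite (le_trans (sqr_ge0 _) (sqr_norm_le_dot xi)).
have eE : enorm xi = Num.sqrt (dot xi xi).
  by congr Num.sqrt; apply: eq_bigr => j _; rewrite expr2.
split; first by rewrite lerD2l eE -[leLHS]ger0_norm// -sqrtr_sqr ler_wsqrtr// sqr_norm_le_dot.
have h : enorm xi <= n%:R * `|xi|.
  rewrite eE -[leRHS]ger0_norm ?mulr_ge0// -sqrtr_sqr ler_wsqrtr//.
  apply: (@le_trans _ _ (\sum_(j < n) `|xi| ^+ 2)).
    apply: ler_sum => j _; rewrite -expr2 -[leLHS]real_normK ?num_real//.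
    by rewrite lerXn2r ?nnegrE// coord_le_norm.
  rewrite sumr_const card_ord exprMn -[leLHS]mulr_natl ler_wpM2r ?sqr_ge0//.
  by rewrite -natrX ler_nat; case: (n) => // k; rewrite expnS leq_pmulr// expn_gt0.
rewrite /jap -natr1; have := normr_ge0 xi; have : 0 <= n%:R :> R by []; nra.
Qed.

Lemma jap_enorm_powR m xi :
  (1 + enorm xi) `^ m <= n.+1%:R `^ `|m| * jap xi `^ m /\
  jap xi `^ m <= n.+1%:R `^ `|m| * (1 + enorm xi) `^ m.
Proof.
have [h1 h2] := enorm_jap xi; have j0 := jap_gt0 xi.
have e0 : 0 < 1 + enorm xi by exact: lt_le_trans j0 h1.
have n1 : 1 <= n.+1%:R :> R by rewrite ler1n.
by split; apply: powR_compare => //; nra.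
Qed.

Lemma cderive_lift k F : cinf (@pb R n) GR F -> cderive (pb k) (xlift F) = xlift (deriv_G k F).
Proof. by move=> cF; apply/funext => p; apply: is_cder_cderive; exact: is_cder_lift. Qed.

Lemma mpower_lift (g : 'I_n -> 'I_n + 'I_n) alpha F : cinf (@pb R n) GR F ->
  mpower (fun j => cderive (pb (g j))) alpha (xlift F) = xlift (mpower (fun j => deriv_G (g j)) alpha F).
Proof.
move=> cF; rewrite /mpower.
have key r : cinf (@pb R n) GR (foldr (fun j h => iter (alpha j) (deriv_G (g j)) h) F r) /\
  foldr (fun j h => iter (alpha j) (cderive (pb (g j))) h) (xlift F) r =
  xlift (foldr (fun j h => iter (alpha j) (deriv_G (g j)) h) F r).
  elim: r => //= j r [cr ->]; elim: (alpha j) => //= k [ck ->].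
  by split; [exact: cinf_deriv_G|exact: cderive_lift].
by have [] := key (enum 'I_n).
Qed.

Lemma cinfT_der k F : cinf (@pb R n) setT F -> cinf (@pb R n) setT (cderive (pb k) F).
Proof. exact: cinf_der. Qed.

Lemma cinfT_comm i j F : cinf (@pb R n) setT F ->
  cderive (pb i) (cderive (pb j) F) = cderive (pb j) (cderive (pb i) F).
Proof. exact: cinf_clairaut. Qed.

Lemma symb_of_words rho delta m F : cinf (@pb R n) setT F ->
  (forall s, bounded_by (@japp R n) (m + \sum_(k <- s) pwt rho delta k)
     (foldr (fun k => cderive (pb k)) F s)) -> symb rho delta m F.
Proof.
move=> cF bF N; suff H : forall s, bclass (@pb R n) (pwt rho delta) (@japp R n) N
    (m + \sum_(k <- s) pwt rho delta k) (foldr (fun k => cderive (pb k)) F s).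
  by have := H [::]; rewrite big_nil addr0.
have cs r : cinf (@pb R n) setT (foldr (fun k => cderive (pb k)) F r).
  by elim: r => //= k r; exact: cinfT_der.
elim: N => [|N IH] s; first by split => // p _; exact: (cinf_cont (cs s)).
apply: (bclass_intro (@pb_neq0 R n) (F' := fun k => foldr (fun k => cderive (pb k)) F (k :: s))).
- by move=> p; exact: (cinf_cont (cs s)).
- exact: bF.
- by move=> k p; exact: (cinf_is_cder k (cs s)).
- by move=> k; have := IH (k :: s); rewrite big_cons addrCA addrC.
Qed.

Lemma sum_pwt (rho delta : R) (s : seq ('I_n + 'I_n)) : \sum_(k <- s) pwt rho delta k =
  - rho * (mdegree (fun j : 'I_n => count_mem (inr j) s))%:R +
  delta * (mdegree (fun j : 'I_n => count_mem (inl j) s))%:R.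
Proof.
rewrite /mdegree; elim: s => [|k s IH].
  by rewrite big_nil !big1// !mulr0 addr0.
rewrite big_cons {}IH /= !big_split/=.
have one (j : 'I_n) : (\sum_(i < n) (j == i))%N = 1%N.
  by rewrite (bigD1 j)//= eqxx big1// => i; rewrite eq_sym => /negbTE ->.
have zl (j : 'I_n) : (\sum_(i < n) ((inl j : 'I_n + 'I_n) == inr i))%N = 0%N by rewrite big1.
have zr (j : 'I_n) : (\sum_(i < n) ((inr j : 'I_n + 'I_n) == inl i))%N = 0%N by rewrite big1.
have ol (j : 'I_n) : (\sum_(i < n) ((inl j : 'I_n + 'I_n) == inl i))%N = 1%N by exact: one.
have or (j : 'I_n) : (\sum_(i < n) ((inr j : 'I_n + 'I_n) == inr i))%N = 1%N by exact: one.
by case: k => j; [rewrite ol zl|rewrite or zr]; rewrite add0n add1n -natr1 /=; ring.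
Qed.

Lemma symb_lift rho delta m (sigma : Ph -> C) : symbol_class m rho delta sigma -> symb rho delta m (xlift sigma).
Proof.
move=> [/(smooth_cinf (e := @pb R n)) cs bs]; have cl := cinf_lift cs.
apply: symb_of_words => // s.
rewrite (foldr_words cinfT_der cinfT_comm s cl).
set al := (X in mpower _ X (mpower _ _ _)); set be := (X in mpower _ _ (mpower _ X _)).
rewrite (mpower_lift inl be cs) (mpower_lift inr al (mpower_stable (@cinf_deriv_G R n) inl be cs)).
have [K K0 bK] := bs al be.
have sE : \sum_(k <- s) pwt rho delta k = - rho * (mdegree al)%:R + delta * (mdegree be)%:R.
  exact: sum_pwt.
rewrite sE addrA mulNr; set M := m - _ + _.
exists (K * n.+1%:R `^ `|M|) => -[t xi].
apply: le_trans (bK (xmap t) xi (xmap_G t)) _.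
by rewrite -mulrA; apply: (ler_wpM2l (ltW K0)); have [] := jap_enorm_powR M xi.
Qed.

(* [H] is [F] read in the coordinates of G, where alone its values matter. *)
Definition agree H F := forall p, GR p -> H p = F (tmap p.1, p.2).

Lemma xcoord_oneB p j : GR p -> 0 < 1 - p.1 0 j ^+ 2.
Proof. by move=> /(_ j) /andP[h1 h2]; nra. Qed.

(** The function U = 1 / (1 - x_j^2) satisfies U' = 2 x_j U^2, so its derivatives are polynomials in
    x_j and U and the induction closes. *)
Lemma tdensity_cinf j : cinf (@pb R n) GR (fun p => ((1 - p.1 0 j ^+ 2)^-1)%:C).
Proof.
have oG := @open_GxRn R n; have p0 := @pb_neq0 R n; have cx := cinf_coord j oG.
pose U p : C := ((1 - p.1 0 j ^+ 2)^-1)%:C.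
pose U' (k : 'I_n + 'I_n) p : C := match k with
  inl i => (i == j)%:R * (2 * ((p.1 0 j)%:C * (U p * U p))) | inr _ => 0 end.
have cU p : GR p -> ccont U p.
  move=> Gp; apply: ccontR; apply: (@continuous_for_comp _ _ _ (fun u : R => (1 - u ^+ 2)^-1) (fun p : Ph => p.1 0 j)).
    by apply: (continuous_coord (f := fun p : Ph => p.1)); exact: cvg_fst.
  have D : is_derive (p.1 0 j) (1 : R) (fun u : R => 1 - u ^+ 2) (- (2 * p.1 0 j)).
    by apply: is_derive_eq; rewrite /GRing.scale/=; ring.
  apply: (is_derive_continuous (is_deriveV _ D)).
  by rewrite gt_eqF// (xcoord_oneB j Gp).
have dU k p : GR p -> is_cder (pb k) U p (U' k p).
  move=> Gp; apply/is_cder_line; case: k => i; last first.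
    by apply: eq_is_cder (is_cder_cst _ (U p) _) => // s; rewrite /U /= scaler0 addr0.
  have E s : U (p + s *: pb (inl i)) = ((1 - (p.1 0 j + s * (j == i)%:R) ^+ 2)^-1)%:C.
    by rewrite /U /= coord_line.
  under eq_fun do rewrite E.
  rewrite /U' /U; have := xcoord_oneB j Gp; move: (p.1 0 j) => u u0.
  have D : is_derive (0 : R) (1 : R) (fun s : R => 1 - (u + s * (j == i)%:R) ^+ 2) (- (2 * u * (j == i)%:R)).
    by apply: is_derive_eq; rewrite /GRing.scale/=; ring.
  have ne : 1 - (u + 0 * (j == i)%:R) ^+ 2 != 0 by rewrite mul0r addr0 gt_eqF.
  have := is_cderR (@is_deriveV R (fun s : R => 1 - (u + s * (j == i)%:R) ^+ 2) 0 _ 1 ne D).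
  apply: eq_is_cder => //; rewrite /GRing.scale/= mul0r addr0.
  have [_|_] := eqVneq i j; last by rewrite !mulr0 oppr0 mulr0 mul0r.
  by rewrite mulr1 mul1r -!rmorphM; apply: ReIm_eq; rewrite /=; field; rewrite gt_eqF.
move=> N; elim: N => [|N IH] m; first by split.
apply: (@cb_intro R Ph _ (@pb R n) (fun=> 0) GR oG (fun _ _ => True) _ p0 N m U U') => //.
have M m1 (F1 F2 : Ph -> C) : cb (@pb R n) (fun=> 0) GR (fun _ _ => True) N m1 F1 ->
    cb (@pb R n) (fun=> 0) GR (fun _ _ => True) N 0 F2 ->
    cb (@pb R n) (fun=> 0) GR (fun _ _ => True) N m1 (fun p => F1 p * F2 p).
  by move=> h1 h2; rewrite -[m1]addr0; apply: (@cbM R Ph _ (@pb R n) (fun=> 0) GR oG (fun _ _ => True)).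
have cc c m1 : cb (@pb R n) (fun=> 0) GR (fun _ _ => True) N m1 (fun=> c) by exact: (cinf_cst p0 c oG).
case=> i; last exact: cc.
apply: (M _ (fun=> _)); first exact: cc.
apply: (M _ (fun=> _)); first exact: cc.
apply: (M _ _ _); first exact: cx.
by apply: (M _ _ _); exact: IH.
Qed.

Lemma is_cder_push k F p : cinf (@pb R n) setT F -> GR p ->
  is_cder (pb k) (fun p => F (tmap p.1, p.2)) p
   ((if k is inl j then - ((1 - p.1 0 j ^+ 2)^-1)%:C else 1) * cderive (pb k) F (tmap p.1, p.2)).
Proof.
case: p => x xi cF Gp; case: k => j.
  rewrite -rmorphN; apply: (is_cder_change_x (@tmapE R n)); last exact: cinf_is_cder.
  exact: is_derive_tcoord (Gp j).
rewrite mul1r; apply: (@is_cder_change_xi R n (@tmap R n) F j x xi); exact: cinf_is_cder.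
Qed.

Lemma ccont_push F p : cinf (@pb R n) setT F -> GR p -> ccont (fun p => F (tmap p.1, p.2)) p.
Proof.
move=> cF Gp; apply: (ccont_change (@tmapE R n)); last exact: cinf_cont cF _.
by move=> j; exact: (is_derive_continuous (is_derive_tcoord (Gp j))).
Qed.

Lemma cinf_push F : cinf (@pb R n) setT F -> cinf (@pb R n) GR (fun p => F (tmap p.1, p.2)).
Proof.
have oG := @open_GxRn R n; have p0 := @pb_neq0 R n.
move=> + N; elim: N F => [|N IH] F cF m; first by split => // p; exact: ccont_push.
apply: (@cb_intro R Ph _ (@pb R n) (fun=> 0) GR oG (fun _ _ => True) _ p0 N m _
  (fun k p => (if k is inl j then - ((1 - p.1 0 j ^+ 2)^-1)%:C else 1) * cderive (pb k) F (tmap p.1, p.2))) => //.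
- by move=> p; exact: ccont_push.
- by move=> k p; exact: is_cder_push.
- move=> k; rewrite -[m + 0]addr0.
  apply: (@cbM R Ph _ (@pb R n) (fun=> 0) GR oG (fun _ _ => True)) => //; last exact: IH (cinfT_der k cF) 0.
  case: k => j; last exact: (cinf_cst p0 1 oG).
  have := cinfM p0 oG (cinf_cst p0 (- 1) oG) (tdensity_cinf j) N (m + 0).
  by apply: eq_cb => // p _; rewrite mulN1r.
Qed.

Lemma agree_deriv_G k H F : cinf (@pb R n) setT F -> agree H F -> agree (deriv_G k H) (cderive (pb k) F).
Proof.
move=> cF HF p Gp.
have nr : \forall q \near p, F (tmap q.1, q.2) = H q.
  by apply: (nearD (@open_GxRn R n)) Gp => q Gq; rewrite HF.
have := is_cder_cderive (near_is_cder (pb_neq0 k) nr (is_cder_push k cF Gp)).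
case: k => j /= E; rewrite /canonical_deriv /pderiv_xi E ?mul1r//.
(* The coefficient - (1 - x_j^2) of the canonical derivative cancels the derivative of [tcoord]. *)
rewrite mulrA -rmorphN -rmorphM mulrNN mulfV ?mul1r//.
by rewrite gt_eqF// (xcoord_oneB j Gp).
Qed.

Lemma agree_mpower (g : 'I_n -> 'I_n + 'I_n) alpha H F : cinf (@pb R n) setT F -> agree H F ->
  agree (mpower (fun j => deriv_G (g j)) alpha H) (mpower (fun j => cderive (pb (g j))) alpha F).
Proof.
move=> cF HF; rewrite /mpower.
have key r : cinf (@pb R n) setT (foldr (fun j h => iter (alpha j) (cderive (pb (g j))) h) F r) /\
  agree (foldr (fun j h => iter (alpha j) (deriv_G (g j)) h) H r)
    (foldr (fun j h => iter (alpha j) (cderive (pb (g j))) h) F r).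
  elim: r => //= j r [cr ar]; elim: (alpha j) => //= k [ck ak].
  by split; [exact: cinfT_der|exact: agree_deriv_G].
by have [] := key (enum 'I_n).
Qed.

Lemma symb_cinf rho delta m F : symb rho delta m F -> cinf (@pb R n) setT F.
Proof.
move=> + N; elim: N m F => [|N IH] m F sF m'; first by split => // p _; exact: symb_cont sF.
apply: (@cb_intro R Ph _ (@pb R n) (fun=> 0) setT openT (fun _ _ => True) _ (@pb_neq0 R n) N m' F (fun k => cderive (pb k) F)) => //.
- by move=> p _; exact: symb_cont sF.
- by move=> k p _; exact: symb_is_cder sF.
- by move=> k; exact: IH (symb_der k sF) _.
Qed.

Lemma symb_mpower rho delta (g : 'I_n -> 'I_n + 'I_n) (w : R) alpha m F :
  (forall j, pwt rho delta (g j) = w) -> symb rho delta m F ->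
  symb rho delta (m + w * (mdegree alpha)%:R) (mpower (fun j => cderive (pb (g j))) alpha F).
Proof.
move=> gw sF; rewrite /mpower /mdegree -big_enum/=.
elim: (enum _) => [|j r IH]; first by rewrite big_nil mulr0 addr0.
rewrite big_cons /=; elim: (alpha j) => [|k IHk]; first by rewrite add0n.
apply: symb_cast (symb_der (g j) IHk).
by rewrite gw addSn -natr1; ring.
Qed.

Lemma symbol_class_push rho delta m H F : symb rho delta m F -> agree H F -> symbol_class m rho delta H.
Proof.
move=> sF HF; have cF := symb_cinf sF; split.
  apply: (cinf_smooth (e := @pb R n)).
  by apply: (eq_cinf (@pb_neq0 R n) (@open_GxRn R n) _ (cinf_push cF)) => p Gp; rewrite HF.
move=> alpha beta.
have s2 := symb_mpower alpha (fun j => erefl : pwt rho delta (inr j) = - rho)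
  (symb_mpower beta (fun j => erefl : pwt rho delta (inl j) = delta) sF).
have [K K0 bK] := symb_bound s2.
set M := m - _ + _; have ME : m + delta * (mdegree beta)%:R + - rho * (mdegree alpha)%:R = M.
  by rewrite /M; ring.
rewrite ME in bK.
(* The summand 1 makes the constant positive, as [symbol_class] demands, even if K = 0. *)
exists (K * n.+1%:R `^ `|M| + 1); first by rewrite ltr_wpDl// mulr_ge0 ?powR_ge0.
move=> x xi Gx.
have cB := mpower_stable cinfT_der inl beta cF.
have := agree_mpower inr alpha cB (agree_mpower inl beta cF HF) (p := (x, xi)) Gx.
move=> /= E.
apply: (@le_trans _ _ (K * n.+1%:R `^ `|M| * (1 + enorm xi) `^ M)); last first.
  by rewrite ler_wpM2r ?powR_ge0// lerDl.
have := bK (tmap x, xi); rewrite -E => h; apply: le_trans h _.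
by rewrite -mulrA; apply: (ler_wpM2l K0); have [] := jap_enorm_powR M xi.
Qed.

End transfer.

(** * Operators on G and on R^n *)

Section quantisation.
Context {R : realType}.
Local Notation Re := (@complex.Re R).
Local Notation Im := (@complex.Im R).
Local Notation C := R[i].
Local Notation bas := (@Defs.basis R _).
Variable n : nat.
Local Notation Ph := ('rV[R]_n * 'rV[R]_n)%type.
Local Notation m2pi := (@m2pi R).
Implicit Types (p : Ph) (x t xi : 'rV[R]_n) (f phi : 'rV[R]_n -> C).

Lemma schwartz_bound phi beta (m : R) : schwartz phi ->
  exists K, forall x, normc (mpower (fun j => cderive (bas j)) beta phi x) <= K * jap x `^ m.
Proof.
move=> [_ bphi]; pose L := Num.bound `|m|.
(* Decay of order L in each coordinate, together with boundedness, then gives the bound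
   [jap ^ m]. *)
have mL : - L%:R <= m.
  by rewrite lerNl (le_trans (ler_norm _))// normrN ltW// archi_boundP.
have [K0 bK0] := bphi (fun=> 0%N) beta.
have /choice[K bK] : forall j : 'I_n, exists K, forall x,
    `|x 0 j| ^+ L * normc (mpower (fun j => cderive (bas j)) beta phi x) <= K.
  move=> j; have [K bK] := bphi (fun i => if i == j then L else 0%N) beta.
  exists K => x; apply: le_trans (bK x); rewrite (bigD1 j)//= eqxx big1 ?mulr1 ?normrX// => i ij.
  by rewrite (negbTE ij) expr0.
pose M := 2 ^+ L * (K0 + \sum_j K j); exists M => x.
set z := normc _; have z0 : 0 <= z by exact: normc_ge0.
have jx := jap_gt0 x.
have h : jap x ^+ L * z <= M.
  apply: le_trans (ler_wpM2r z0 (jap_pow_le x L)) _.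
  rewrite -mulrA; apply: ler_wpM2l; first exact: exprn_ge0.
  rewrite mulrDl mul1r; apply: lerD.
    by have := bK0 x; rewrite big1 ?normr1 ?mul1r// => i _; rewrite expr0.
  by rewrite mulr_suml; apply: ler_sum => j _; exact: bK.
have M0 : 0 <= M by apply: le_trans h; rewrite mulr_ge0 ?exprn_ge0// ltW.
apply: le_trans (ler_wpM2l M0 (jap_powR_mono x mL)).
by rewrite powRN powR_mulrn ?(ltW jx)// ler_pdivlMr ?exprn_gt0// mulrC.
Qed.

Lemma foldr_count (T : Type) (D : 'I_n -> T -> T) (S : T -> Prop) (s : seq 'I_n) F :
  (forall k F, S F -> S (D k F)) ->
  (forall i j F, S F -> D i (D j F) = D j (D i F)) -> S F ->
  foldr D F s = mpower D (fun j => count_mem j s) F.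
Proof.
move=> SD DC sF; elim: s => [|k s /= ->]; first by rewrite mpower0.
rewrite -(mpower_madd SD DC id _ k sF); apply: eq_mpower => i.
by rewrite /madd addnC eq_sym.
Qed.

Lemma schwartz_schv phi : schwartz phi -> schv phi.
Proof.
move=> sphi; have b0 := @bas_neq0 R n.
have cphi : cinf (@Defs.basis R n) setT phi by apply: smooth_cinf; exact: sphi.1.
have cs s : cinf (@Defs.basis R n) setT (foldr (fun j => cderive (bas j)) phi s).
  by elim: s => //= k s; exact: cinf_der.
have bs s m : exists K, forall x, normc (foldr (fun j => cderive (bas j)) phi s x) <= K * jap x `^ m.
  rewrite (@foldr_count _ _ (cinf (@Defs.basis R n) setT) s phi (fun k F => @cinf_der _ _ _ _ _ F k)
    (fun i j F => @cinf_clairaut _ _ _ _ F i j) cphi).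
  exact: schwartz_bound.
move=> m N; have H s : bclass (@pb R n) (pwt 0 1) (@japp R n) N m
    (fun p => foldr (fun j => cderive (bas j)) phi s p.2); last exact: (H [::]).
elim: N s => [|N IH] s.
  split => // [p _|]; first by apply: (@ccont_for_comp_snd R _ _ (foldr (fun j => cderive (bas j)) phi s)); exact: (cinf_cont (cs s)).
  by have [K bK] := bs s m; exists K => p; exact: bK.
apply: (@schv_intro R n _ (fun j => foldr (fun j => cderive (bas j)) phi (j :: s))).
- by move=> y; exact: (cinf_cont (cs s)).
- exact: bs.
- by move=> j y; exact: (cinf_is_cder j (cs s)).
- by move=> j; exact: IH (j :: s).
Qed.

Lemma character_chr x xi : character x xi = chr (2 * pi) (tmap x) xi.
Proof.
have -> : character x xi = \prod_(j < n) expi (pi * xi 0 j * ln ((1 - x 0 j) / (1 + x 0 j))) by [].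
rewrite -(big_morph expi (@expiD R) (@expi0 R)); congr expi.
rewrite /dot mulr_sumr; apply: eq_bigr => j _; rewrite mxE.
by field.
Qed.

Lemma eq_integral_G f g : (forall x, G x -> f x = g x) -> integral_G f = integral_G g.
Proof.
move=> fg; rewrite /integral_G /integral_Rn.
have E (h : C -> R) : \int[lebesgue_tuple R n]_(t in @rv_of_tuple R n @^-1` G)
      h (f (rv_of_tuple t) / (\prod_(j < n) (1 - rv_of_tuple t 0 j ^+ 2))%:C) =
    \int[lebesgue_tuple R n]_(t in @rv_of_tuple R n @^-1` G)
      h (g (rv_of_tuple t) / (\prod_(j < n) (1 - rv_of_tuple t 0 j ^+ 2))%:C).
  by apply: eq_Rintegral => t; rewrite inE => Gt; rewrite fg.
by rewrite (E Re) (E Im).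
Qed.

Lemma fourier_G_fourier f phi xi : schv phi -> (forall x, G x -> f x = phi (tmap x)) ->
  fourier_G f xi = fourier phi xi.
Proof.
move=> sphi fE; rewrite /fourier_G.
rewrite (@eq_integral_G _ (fun x => (fun t => chr m2pi xi t * phi t) (tmap x))); last first.
  by move=> x Gx; rewrite fE// character_chr -[xi in RHS]opprK chr_m2pi.
by rewrite (cint_tmap (f := fun t => chr m2pi xi t * phi t))// => t; apply: ccontM; [exact: ccont_chrr|exact: schv_cont].
Qed.

Lemma quantisation_pdo sigma b f phi x : (forall xi, sigma (x, xi) = b (tmap x, xi)) ->
  schv phi -> (forall x, G x -> f x = phi (tmap x)) ->
  quantisation sigma f x = pdo b (fourier phi) (tmap x).
Proof.
move=> sb sphi fE; rewrite /quantisation integral_RnT; apply: eq_cint => xi.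
by rewrite character_chr sb (fourier_G_fourier xi sphi fE).
Qed.

End quantisation.

Theorem theorem3p3 (R : realType) (n : nat) (hn : (1 <= n)%N)
    (rho delta m1 m2 : R)
    (hdelta : 0 <= delta) (hdelta_rho : delta < rho) (hrho : rho <= 1)
    (a b : 'rV[R]_n * 'rV[R]_n -> R[i])
    (ha : symbol_class m1 rho delta a) (hb : symbol_class m2 rho delta b) :
  exists c : 'rV[R]_n * 'rV[R]_n -> R[i],
    [/\ symbol_class (m1 + m2) rho delta c,
        forall f, schwartz_G f -> forall x, G x ->
          quantisation c f x = quantisation a (quantisation b f) x &
        forall N : nat,
          symbol_class (m1 + m2 - (rho - delta) * N%:R) rho delta
            (fun p => c p - composition_sum a b N p)].
Proof.
have rho0 : 0 <= rho by rewrite ltW// (le_lt_trans hdelta).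
have delta1 : delta < 1 by exact: lt_le_trans hrho.
have sa := symb_lift ha; have sb := symb_lift hb.
(* This is c_1 of the lifted symbols, read back in the coordinates of [G]. *)
pose c p := comp_symb (xlift a) (xlift b) 1 (tmap p.1, p.2).
have aE : agree a (xlift a) by case=> x xi Gx; rewrite /xlift tmapK.
have bE : agree b (xlift b) by case=> x xi Gx; rewrite /xlift tmapK.
exists c; split.
(* The remainder of order 0 is the symbol itself, so membership of [c] in its class is the expansion
   with no terms. *)
- have := symb_remainder rho0 hdelta delta1 hdelta_rho 0 sa sb; rewrite mulr0 subr0 => s0.
  by apply: (symbol_class_push s0) => p _; rewrite remainder0.
- move=> f [phi /schwartz_schv sphi fE] x Gx.
  have sg := fourier_sch sphi; have su := schv_pdo rho0 delta1 sb sg.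
  (* On [G] the inner result is again a Schwartz function of [tmap y], so the outer quantisation can
     be transferred in the same way. *)
  have quE y : G y -> quantisation b f y = pdo (xlift b) (fourier phi) (tmap y).
    by move=> Gy; apply: quantisation_pdo => // xi; exact: (bE (y, xi) Gy).
  have cE xi : c (x, xi) = comp_symb (xlift a) (xlift b) 1 (tmap x, xi) by [].
  rewrite (quantisation_pdo cE sphi fE).
  rewrite (pdo_comp rho0 hdelta delta1 _ sa sb sg).
  by rewrite (quantisation_pdo (fun xi => aE (x, xi) Gx) su quE).
- move=> N; apply: (symbol_class_push (symb_remainder rho0 hdelta delta1 hdelta_rho N sa sb)) => p Gp.
  have ia : is_symb rho delta (xlift a) by exists m1.
  have ib : is_symb rho delta (xlift b) by exists m2.
  rewrite /remainder -(comp_sumE N _ ia ib); congr (_ - _).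
  apply: eq_bigr => alpha _; rewrite /composition_term.
  have Ea : mpower pderiv_xi (fun j => alpha j) a p =
      mpower (@Dxi R n) (fun j => alpha j) (xlift a) (tmap p.1, p.2).
    exact: (agree_mpower inr (fun j => alpha j) (symb_cinf sa) aE Gp).
  have Eb : mpower canonical_deriv (fun j => alpha j) b p =
      mpower (@Dx R n) (fun j => alpha j) (xlift b) (tmap p.1, p.2).
    exact: (agree_mpower inl (fun j => alpha j) (symb_cinf sb) bE Gp).
  exact: (f_equal2 (fun u v => ipi ^- mdegree (fun j => alpha j) / (mfact (fun j => alpha j))%:R * u * v) Ea Eb).
Qed.
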